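(* Let $2\le s<\infty$ and let $X$ be a Banach space with martingale cotype $s$. (1) If $s\le p<\infty$, then there is a constant $C$ depending only on $p,s,X$ such that for every simple, adapted $X$-valued process $\phi$ and every $B\in\mathcal{J}$, $$\|\phi\mathbf 1_B\|_{\mathcal{D}^p_{s,X}\cap\mathcal{D}^p_{p,X}}\le C\Big(\mathbb{E}\Big\|\int_{\mathbb{R}_+\times B}\phi\,\mathrm{d}\tilde N\Big\|_X^p\Big)^{1/p}.$$ (2) If $1<p<s$, then there is a constant $C$ depending only on $p,s,X$ such that for every simple, adapted $X$-valued process $\phi$ and every $B\in\mathcal{J}$, $$\|\phi\mathbf 1_B\|_{\mathcal{D}^p_{s,X}+\mathcal{D}^p_{p,X}}\le C\Big(\mathbb{E}\Big\|\int_{\mathbb{R}_+\times B}\phi\,\mathrm{d}\tilde N\Big\|_X^p\Big)^{1/p}.$$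
   Context: Martingale cotype: for $2\le r<\infty$, a Banach space $X$ has martingale cotype $r$ if there is a constant $C$ such that every finite martingale difference sequence $(d_i)$ in $L^r(\Omega;X)$ satisfies $(\sum_i\mathbb{E}\|d_i\|_X^r)^{1/r}\le C(\mathbb{E}\|\sum_i d_i\|_X^r)^{1/r}$. Poisson random measure: let $(\Omega,\mathcal{F},\mathbb{P})$ be a probability space. A Poisson random measure on a measurable space $(E,\mathcal{E})$ with $\sigma$-finite intensity measure $\mu$ is a map $N:\Omega\times\mathcal{E}\to\mathbb{N}\cup\{\infty\}$ such that $N(B)$ is a random variable for each $B\in\mathcal{E}$, $N(\omega,\cdot)$ is a measure for each $\omega$, $N(B)$ is Poisson distributed with parameter $\mu(B)$ for each $B$ ($N(B)=\infty$ a.s. if $\mu(B)=\infty$), and $N(B_1),\dots,N(B_n)$ are independent for pairwise disjoint $B_1,\dots,B_n\in\mathcal{E}$. For $\mu(B)<\infty$ put $\tilde N(B):=N(B)-\mu(B)$. Setting: $(J,\mathcal{J},\nu)$ is a $\sigma$-finite measure space and $N$ is a Poisson random measure on $(\mathbb{R}_+\times J,\mathcal{B}(\mathbb{R}_+)\times\mathcal{J})$ with intensity measure $dt\times\nu$. $\mathcal{F}_t$ is the $\sigma$-algebra generated by the random variables $N((s,u]\times A)$, $0\le s<u\le t$, $A\in\mathcal{J}$ ($\mathcal{F}_0$ is trivial). Simple adapted processes: a simple, adapted $X$-valued process is a map $\phi:\Omega\times\mathbb{R}_+\times J\to X$ of the form $\phi=\sum_{i=1}^l\sum_{j=1}^m\sum_{k=1}^n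 F_{ijk}\mathbf 1_{(t_i,t_{i+1}]}\mathbf 1_{A_j}x_{ijk}$ with $0=t_1<t_2<\dots<t_{l+1}<\infty$, $F_{ijk}\in L^\infty(\Omega,\mathcal{F}_{t_i})$, disjoint $A_1,\dots,A_m\in\mathcal{J}$ with $\nu(A_j)<\infty$, and $x_{ijk}\in X$. For $B\in\mathcal{J}$, $$\int_{\mathbb{R}_+\times B}\phi\,\mathrm{d}\tilde N:=\sum_{i,j,k}F_{ijk}\,\tilde N((t_i,t_{i+1}]\times(A_j\cap B))\,x_{ijk}.$$ Norms: for $1\le p,q<\infty$, $\mathcal{D}^p_{q,X}:=L^p(\Omega;L^q(\mathbb{R}_+\times J;X))$, i.e. $\|\phi\|_{\mathcal{D}^p_{q,X}}=\big(\mathbb{E}(\int_{\mathbb{R}_+\times J}\|\phi\|_X^q\,dt\times d\nu)^{p/q}\big)^{1/p}$. The intersection of two such spaces carries the maximum of the two norms, and the sum carries the norm $\|\phi\|_{Y_0+Y_1}=\inf\{\|\phi_0\|_{Y_0}+\|\phi_1\|_{Y_1}:\phi=\phi_0+\phi_1\}$. *)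

(* Defs.v *)
From HB Require Import structures.
From mathcomp Require Import all_boot all_order all_algebra.
From mathcomp Require Import all_classical all_reals all_analysis.
From mathcomp Require Import measurable_realfun.

Set Implicit Arguments.
Unset Strict Implicit.
Unset Printing Implicit Defensive.

Import Order.TTheory GRing.Theory Num.Theory.
Import numFieldNormedType.Exports.

Local Open Scope classical_set_scope.
Local Open Scope ring_scope.

(* [S] is the sigma-algebra with respect to which measurability is meant; it is
   a parameter so that sub-sigma-algebras can be used.
   Strong measurability is in the everywhere sense; classes modulo null sets
   are handled by the almost-everywhere equalities below. *)
Section strong_measurability.
Context {R : realType} {T : Type} {X : normedModType R}.
Variable S : set (set T).

Definition is_simple (f : T -> X) : Prop :=
  finite_set (range f) /\ forall x : X, S (f @^-1` [set x]).

Definition strongly_measurable (f : T -> X) : Prop :=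
  exists s : nat -> T -> X,
    (forall n : nat, is_simple (s n)) /\ (forall x : T, s n x @[n --> \oo] --> f x).

End strong_measurability.

Section bochner.
Context {R : realType} {d : measure_display} {T : measurableType d}.
Context {X : normedModType R}.

Definition bochner_norm (mu : {measure set T -> \bar R}) (p : R) (f : T -> X)
    : \bar R :=
  ('N[mu]_p%:E[(fun x => (`|f x|)%:E)])%E.

Variable P : probability T R.

Definition simple_integral (f : T -> X) : X :=
  \sum_(x \in range f) fine (P (f @^-1` [set x])) *: x.

Definition has_bochner_integral (f : T -> X) (v : X) : Prop :=
  strongly_measurable measurable f /\
  exists s : nat -> T -> X,
    [/\ forall n, is_simple measurable (s n),
        (\int[P]_w (`|f w - s n w|)%:E)%E @[n --> \oo] --> 0%E &
        simple_integral (s n) @[n --> \oo] --> v].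

(* E[f | G] = 0, i.e. the Bochner integral of f over every A in G is 0. *)
Definition cond_expectation_eq0 (G : set (set T)) (f : T -> X) : Prop :=
  forall A, G A -> has_bochner_integral (fun w => \1_A w *: f w) 0.

(* The differences d_0, ..., d_{n-1} are martingale differences in L^r(T; X)
   with respect to G_0, ..., G_n: d_i is G_{i+1}-measurable and
   E[d_i | G_i] = 0. *)
Definition martingale_difference (r : R) (n : nat) (G : nat -> set (set T))
    (D : 'I_n -> T -> X) : Prop :=
  [/\ forall i, (i <= n)%N -> sigma_algebra setT (G i) /\ G i `<=` measurable,
      forall i, (i < n)%N -> G i `<=` G i.+1,
      forall i : 'I_n, strongly_measurable (G i.+1) (D i),
      forall i : 'I_n, (bochner_norm P r (D i) < +oo)%E &
      forall i : 'I_n, cond_expectation_eq0 (G i) (D i)].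

End bochner.

Definition martingale_cotype {R : realType} (X : normedModType R) (r : R)
    : Prop :=
  exists C : R,
    forall (d : measure_display) (T : measurableType d) (P : probability T R)
      (n : nat) (G : nat -> set (set T)) (D : 'I_n -> T -> X),
    martingale_difference P r G D ->
    ((\sum_(i < n) \int[P]_w (`|D i w| `^ r)%:E) `^ r^-1 <=
     C%:E * (\int[P]_w (`|\sum_(i < n) D i w| `^ r)%:E) `^ r^-1)%E.

Section poisson.
Context {R : realType} {d d' : measure_display}.
Context {T : measurableType d} {E : measurableType d'}.

Definition mutually_independent (P : probability T R) (n : nat)
    (Y : 'I_n -> T -> \bar R) : Prop :=
  forall C : 'I_n -> set (\bar R), (forall i, measurable (C i)) ->
    (P [set w | forall i, C i (Y i w)] = \prod_(i < n) P (Y i @^-1` C i))%E.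

(* That N is a kernel says that each N w is a measure and that each N(B) is
   measurable.  The Poisson weights are spelled out because [poisson_pmf 0 k]
   is 1 for every k; here the parameter 0 gives the Dirac mass at 0. *)
Definition poisson_random_measure (P : probability T R)
    (mu : {measure set E -> \bar R}) (N : R.-ker T ~> E) : Prop :=
  [/\ sigma_finite setT mu,
      forall w B, measurable B -> N w B = +oo%E \/ exists k, N w B = k%:R%:E,
      forall B, measurable B -> (mu B < +oo)%E ->
        forall k, P [set w | N w B = k%:R%:E] =
          (fine (mu B) ^+ k / k`!%:R * expR (- fine (mu B)))%:E,
      forall B, measurable B -> mu B = +oo%E ->
        {ae P, forall w, N w B = +oo%E} &
      forall n (B : 'I_n -> set E), (forall i, measurable (B i)) ->
        trivIset setT B -> mutually_independent P (fun i w => N w (B i))].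

(* Real-valued: for [mu B < +oo], N(B) is almost surely finite, and the value
   of [fine] on the exceptional null set is irrelevant. *)
Definition compensated (mu : {measure set E -> \bar R}) (N : R.-ker T ~> E)
    (B : set E) (w : T) : R :=
  fine (N w B) - fine (mu B).

End poisson.

(* R_+ x J is rendered as R x J, with Lebesgue measure restricted to [0, +oo[
   as the measure on the time variable. *)
Definition lebesgue_Rplus (R : realType)
    : {measure set (measurableTypeR R) -> \bar R} :=
  mrestr (@lebesgue_measure R) (@measurable_itv R `[0, +oo[).

Section process.
Context {R : realType} {d d' : measure_display}.
Context {T : measurableType d} {J : measurableType d'}.

Definition intensity (nu : {sigma_finite_measure set J -> \bar R})
    : {measure set (measurableTypeR R * J) -> \bar R} :=
  (lebesgue_Rplus R \x nu)%E.

Definition filtration_generators (N : R.-ker T ~> (measurableTypeR R * J)%type)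
    (t : R) : set (set T) :=
  [set Z | exists s u A C,
     [/\ 0 <= s, s < u, u <= t, measurable A & measurable C /\
         Z = (fun w => N w (`]s, u]%classic `*` A)) @^-1` C]].

(* The carrier T with the sigma-algebra F_t. *)
Definition filtration (N : R.-ker T ~> (measurableTypeR R * J)%type) (t : R) :=
  g_sigma_algebraType (filtration_generators N t).

Record simple_process (P : probability T R)
    (nu : {sigma_finite_measure set J -> \bar R})
    (N : R.-ker T ~> (measurableTypeR R * J)%type) (X : normedModType R) :=
  SimpleProcess {
  sp_l : nat;
  sp_m : nat;
  sp_n : nat;
  (* sp_t i is t_{i+1}, only used for i <= l *)
  sp_t : nat -> R;
  sp_F : 'I_sp_l -> 'I_sp_m -> 'I_sp_n -> T -> R;
  sp_A : 'I_sp_m -> set J;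
  sp_x : 'I_sp_l -> 'I_sp_m -> 'I_sp_n -> X;
  sp_t0 : sp_t 0 = 0;
  sp_t_lt : forall i, (i < sp_l)%N -> sp_t i < sp_t i.+1;
  sp_F_measurable : forall (i : 'I_sp_l) j k,
    measurable_fun (setT : set (filtration N (sp_t i))) (sp_F i j k);
  sp_F_bounded : forall i j k, finite_norm P +oo%E (sp_F i j k);
  sp_A_measurable : forall j, measurable (sp_A j);
  sp_A_disjoint : trivIset setT sp_A;
  sp_A_finite : forall j, (nu (sp_A j) < +oo)%E }.

Section simple_process_ops.
Context {P : probability T R} {nu : {sigma_finite_measure set J -> \bar R}}.
Context {N : R.-ker T ~> (measurableTypeR R * J)%type} {X : normedModType R}.
Variable phi : simple_process P nu N X.

Definition process_fun (w : T) (z : measurableTypeR R * J) : X :=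
  \sum_(i < sp_l phi) \sum_(j < sp_m phi) \sum_(k < sp_n phi)
    (sp_F i j k w * \1_(`]sp_t phi i, sp_t phi i.+1]%classic) z.1
      * \1_(sp_A j) z.2) *: sp_x i j k.

Definition stochastic_integral (B : set J) (w : T) : X :=
  \sum_(i < sp_l phi) \sum_(j < sp_m phi) \sum_(k < sp_n phi)
    (sp_F i j k w *
     compensated (intensity nu) N
       (`]sp_t phi i, sp_t phi i.+1]%classic `*` (sp_A j `&` B)) w)
    *: sp_x i j k.

Definition process_restr (B : set J) (w : T) (z : measurableTypeR R * J) : X :=
  \1_B z.2 *: process_fun w z.

End simple_process_ops.
End process.

Section mixed_norms.
Context {R : realType} {d d' : measure_display}.
Context {T : measurableType d} {E : measurableType d'} {X : normedModType R}.
Variables (P : probability T R) (mu : {measure set E -> \bar R}).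
Implicit Types (p q : R) (f : T -> E -> X).

(* The norm of L^p(T; L^q(E; X)). *)
Definition mixed_norm p q f : \bar R :=
  ('N[P]_p%:E[(fun w => bochner_norm mu q (f w))])%E.

(* Elements of L^p(T; L^q(E; X)), represented by jointly strongly measurable
   functions. *)
Definition in_mixed p q f : Prop :=
  strongly_measurable measurable (fun z : T * E => f z.1 z.2) /\
  (mixed_norm p q f < +oo)%E.

Definition mixed_cap_norm p q0 q1 f : \bar R :=
  maxe (mixed_norm p q0 f) (mixed_norm p q1 f).

Definition mixed_sum_norm p q0 q1 f : \bar R :=
  ereal_inf [set r | exists f0 f1 : T -> E -> X,
    [/\ in_mixed p q0 f0, in_mixed p q1 f1,
        {ae P, forall w, {ae mu, forall z, f w z = f0 w z + f1 w z}} &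
        r = (mixed_norm p q0 f0 + mixed_norm p q1 f1)%E]].

End mixed_norms.

(* Main.v *)
(* Pisier renorming turns martingale cotype s into an equivalent norm |.|_* for which
   |.|_*^s is uniformly convex: U(x) is the infimum, over finite two-valued martingales
   (trees) started at x, of K E|f_n|^s - sum_k E|d_k|^s; cotype makes it comparable to
   |x|^s, and concatenating trees gives the convexity inequality.  Applied along a line,
   it yields for every p > 1 a pointwise inequality
     |x + t y|_*^p >= |x|_*^p + k t + c G(|x|_*, |t||y|),
   with G(a, b) = b^p if p >= s and G(a, b) = b^s (a + b)^(p - s) if p < s, and hence,
   for a centred Poisson variable xi of parameter l <= 1/2 in place of t, a gain of
   order l G(|x|_*, |y|) in expectation.

   The time grid is refined until every cell D_k = time interval x A_j has measure at
   most 1/2; the cells are ordered lexicographically, so that N(D_k) is independent of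
   the past, and f_k denotes the partial sums of sum_k (N(D_k) - l_k) y_k.  Summing the
   gains bounds sum_k l_k E G(|f_k|_*, |y_k|) by E|f_n|_*^p.
   - If p >= s, this is the D^p_p bound.  For D^p_s put V_k = sum_(i<k) l_i |y_i|^s and
     r = p / s; since V_(k+1) is known before step k, the case p = s with the weight
     V_(k+1)^(r-1) gives E V_n^r <= C E V_n^(r-1) |f_n|_*^s, and Young's inequality
     absorbs V_n.
   - If p < s, split y_k according to whether |y_k| > |f_k|_*.  The large part is
     controlled in D^p_p directly; the small part in D^p_s after replacing |f_k|_* by its
     running maximum, which Doob's inequality controls since p > 1. *)

Require Import Defs.
From HB Require Import structures.
From mathcomp Require Import all_boot all_order all_algebra.
From mathcomp Require Import all_classical all_reals all_analysis.
From mathcomp Require Import measurable_realfun.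
From mathcomp Require Import ring lra.

Set Implicit Arguments.
Unset Strict Implicit.
Unset Printing Implicit Defensive.

Import Order.TTheory GRing.Theory Num.Theory.
Import numFieldNormedType.Exports.

Local Open Scope classical_set_scope.
Local Open Scope ring_scope.

(** * Inequalities for real powers *)

Section powR_facts.
Context {R : realType}.
Implicit Types a b p s : R.

(** Trees are used because the infimum needs martingales that can be glued: they are finite data,
    closed under grafting, and they allow every branching weight. Weight 1/2 gives the midpoint
    inequality, while the triangle inequality for the s-th root of U needs the weight a / (a + b),
    where a and b are the new norms of the two summands. The bound 1/2 on the cells comes from the
    way the gain is extracted. Only the outcome of exactly one jump is kept; it has probability l
    exp(-l) and moves the sum by (1 - l) y. A gain proportional to l therefore requires l to be
    bounded away from 1. No constant depends on the number of cells, so refining the grid costs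
    nothing. Both absorptions, in Young's and in Doob's inequality, cancel a term that could be
    infinite. Its finiteness is proved beforehand by crude inductions over the cells; their bounds
    do depend on the number of cells and serve only qualitatively. *)

Lemma ler_powRl a b p : 0 <= p -> 0 <= a -> a <= b -> a `^ p <= b `^ p.
Proof.
move=> p0 a0 ab; apply: ge0_ler_powR => //; rewrite nnegrE //.
exact: le_trans ab.
Qed.

Lemma ler_powRl_neg a b p : p <= 0 -> 0 < a -> a <= b -> b `^ p <= a `^ p.
Proof.
move=> p0 a0 ab; rewrite -(opprK p) !(powRN _ (- p)).
rewrite lef_pV2 ?posrE ?powR_gt0 //; last exact: lt_le_trans ab.
by apply: ler_powRl => //; [rewrite oppr_ge0|exact: ltW].
Qed.

(** Young's inequality for b and a^(p - 1) with exponents p and p / (p - 1), rearranged; no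
    derivative is involved. The case p = 1 is apart because its conjugate exponent is infinite. *)
Lemma powR_tangent a b p : 1 <= p -> 0 <= a -> 0 <= b ->
  a `^ p + p * a `^ (p - 1) * (b - a) <= b `^ p.
Proof.
move=> p1 a0 b0; have p_gt0 : 0 < p by lra.
have [pE|pN1] := eqVneq p 1.
  by rewrite pE subrr powRr0 !powRr1 //; lra.
have p_gt1 : 1 < p by rewrite lt_neqAle eq_sym pN1.
have pB : 0 < p - 1 by lra.
have := @conjugate_powR R b (a `^ (p - 1)) p (p / (p - 1)) b0 (powR_ge0 _ _)
  p_gt0 (divr_gt0 p_gt0 pB).
have -> : p^-1 + (p / (p - 1))^-1 = 1 by field; lra.
rewrite -powRrM.
have -> : (p - 1) * (p / (p - 1)) = p by field; lra.
move=> /(_ erefl) H.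
have E : a `^ (p - 1) * a = a `^ p by rewrite mulrC mulr_powRB1.
rewrite mulrBr -!mulrA E.
have := ler_wpM2l (ltW p_gt0) H.
have -> : p * (b `^ p / p + a `^ p / (p / (p - 1))) = b `^ p + (p - 1) * a `^ p.
  by field; lra.
by rewrite [b * _]mulrC; lra.
Qed.

(** Tangents at the mean: their linear terms cancel in the average. *)
Lemma powR_convex2 (t a b p : R) : 1 <= p -> 0 <= t <= 1 -> 0 <= a -> 0 <= b ->
  (t * a + (1 - t) * b) `^ p <= t * a `^ p + (1 - t) * b `^ p.
Proof.
move=> p1 /andP[t0 t1] a0 b0; set m := t * a + (1 - t) * b.
have m0 : 0 <= m by apply: addr_ge0; apply: mulr_ge0 => //; lra.
have Ha := ler_wpM2l t0 (powR_tangent p1 m0 a0).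
have t1' : 0 <= 1 - t by lra.
have Hb := ler_wpM2l t1' (powR_tangent p1 m0 b0).
set M := m `^ p in Ha Hb *; set k := p * _ in Ha Hb.
have : t * (M + k * (a - m)) + (1 - t) * (M + k * (b - m)) = M.
  by rewrite /m; ring.
lra.
Qed.

Lemma powR_add_le a b p : 1 <= p -> 0 <= a -> 0 <= b ->
  (a + b) `^ p <= 2 `^ p * (a `^ p + b `^ p).
Proof.
move=> p1 a0 b0.
have h : 0 <= (2^-1 : R) <= 1 by apply/andP; split; lra.
have := powR_convex2 p1 h a0 b0.
have -> : a + b = 2 * (2^-1 * a + (1 - 2^-1) * b) by field.
rewrite powRM //; last by lra.
move=> H; apply: ler_wpM2l; first exact: powR_ge0.
apply: le_trans H _.
by have := powR_ge0 a p; have := powR_ge0 b p; lra.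
Qed.

(** From m^e >= 1 + e ln m and ln m >= 1 - 1/m. This lemma and the next are used with e = p - 1,
    which may be below 1, where m^e is concave and has no tangent from below. *)
Lemma powR_ge1B (m e : R) : 0 < e -> 1 <= m -> e * (m - 1) / m <= m `^ e - 1.
Proof.
move=> e0 m1; have m0 : 0 < m by lra.
have H1 : 1 + e * ln m <= m `^ e.
  by rewrite /powR gt_eqF //; exact: expR_ge1Dx.
have H2 : (m - 1) / m <= ln m.
  have mV : 0 < m^-1 by rewrite invr_gt0.
  have : -1 < m^-1 - 1 by lra.
  move/le_ln1Dx; rewrite addrCA subrr addr0 lnV ?posrE // => H.
  by rewrite mulrBl divff ?gt_eqF // div1r; lra.
by have := ler_wpM2l (ltW e0) H2; rewrite mulrA; lra.
Qed.

(** The bound m^(-e) >= 1 + e (1 - m), multiplied by m^e >= 2^(-e). *)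
Lemma powR_le1B (m e : R) : 0 < e -> 2^-1 <= m <= 1 ->
  2^-1 `^ e * e * (1 - m) <= 1 - m `^ e.
Proof.
move=> e0 /andP[m2 m1]; have m0 : 0 < m by lra.
have H1 : 1 + e * (1 - m) <= m `^ (- e).
  rewrite /powR gt_eqF //; apply: le_trans (expR_ge1Dx _).
  have : -1 < m - 1 by lra.
  move/le_ln1Dx; rewrite addrCA subrr addr0 => H.
  by have := ler_wpM2l (ltW e0) H; lra.
have me0 : 0 < m `^ e by apply: powR_gt0.
have := ler_wpM2l (ltW me0) H1.
rewrite powRN mulfV ?gt_eqF // => H2.
have H3 : 2^-1 `^ e <= m `^ e by apply: ler_powRl => //; lra.
have H4 : 0 <= e * (1 - m) by apply: mulr_ge0; lra.
have := ler_wpM2r H4 H3.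
by rewrite mulrA; lra.
Qed.

(* Both sides vanish to second order at 1, so on [0, r0] each is comparable to
   (r - 1)^2. *)
Lemma powR_bregman_compare p s r0 : 1 < p -> 2 <= s -> 1 <= r0 ->
  exists2 c : R, 0 < c & forall r : R, 0 <= r <= r0 ->
    c * (r `^ s - 1 - s * (r - 1)) <= r `^ p - 1 - p * (r - 1).
Proof.
move=> p1 s2 r01.
pose e := p - 1; have e0 : 0 < e by rewrite /e; lra.
pose ce := Num.min (e / r0) (2^-1 `^ e * e).
have ce0 : 0 < ce.
  rewrite lt_min divr_gt0 //=; last lra.
  by apply: mulr_gt0 => //; apply: powR_gt0; lra.
(* With m the midpoint of 1 and r, the tangent at m taken at r and the tangent at 1 taken at m add
   up to r^p - 1 - p (r - 1) >= p (m - 1) (m^(p - 1) - 1). Since m lies in [1/2, r0], the two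
   previous lemmas bound the product by a multiple of (m - 1)^2, a quarter of (r - 1)^2. *)
have low (r : R) : 0 <= r <= r0 ->
    p * ce / 4 * (r - 1) ^+ 2 <= r `^ p - 1 - p * (r - 1).
  move=> /andP[rge0 rr0]; pose m := (1 + r) / 2.
  have m0 : 0 <= m by rewrite /m; lra.
  have T1 := powR_tangent (ltW p1) m0 rge0.
  have T2 := powR_tangent (ltW p1) ler01 m0.
  rewrite !powR1 /= mulr1 in T2.
  have K : ce * (m - 1) ^+ 2 <= (m - 1) * (m `^ e - 1).
    have [m1|m1] := leP 1 m.
      have H := powR_ge1B e0 m1.
      have H1 : ce * (m - 1) <= m `^ e - 1.
        apply: le_trans H; rewrite mulrAC; apply: ler_wpM2r; first lra.
        rewrite ge_min; apply/orP; left; rewrite ler_pM2l // lef_pV2 ?posrE; rewrite /m in m1 *; lra.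
      by rewrite expr2 mulrA mulrC; apply: ler_wpM2l => //; lra.
    have H : 2^-1 `^ e * e * (1 - m) <= 1 - m `^ e.
      by apply: powR_le1B => //; rewrite /m in m1 *; lra.
    have H1 : ce * (1 - m) <= 1 - m `^ e.
      by apply: le_trans H; apply: ler_wpM2r; [lra|rewrite ge_min lexx orbT].
    have m1' : 0 <= 1 - m by lra.
    by have := ler_wpM2l m1' H1; lra.
  have -> : p * ce / 4 * (r - 1) ^+ 2 = p * (ce * (m - 1) ^+ 2).
    by rewrite /m; field.
  have p0 : 0 <= p by lra.
  have K' := ler_wpM2l p0 K; rewrite -/e in T1.
  have rE : r = 2 * m - 1 by rewrite /m; field.
  move: T1 T2 K'; rewrite rE; clearbody m; set x := (2 * m - 1) `^ p.
  set y := m `^ p; set z := m `^ e => T1 T2 K'.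
  have : p * z * (2 * m - 1 - m) = p * ((m - 1) * z) by ring.
  by rewrite mulrBr in K'; lra.
pose D := s * ((s - 1) * r0 `^ (s - 2) + 1) + s * (s - 1).
have D0 : 0 < D.
  rewrite /D; apply: ltr_wpDr; first by apply: mulr_ge0; lra.
  apply: mulr_gt0; first lra.
  by apply: ltr_wpDl => //; apply: mulr_ge0; [lra|exact: powR_ge0].
(* The tangent at r taken at 1 gives the upper bound s (r - 1) (r^(s - 1) - 1). The last factor is
   again compared with a tangent, of exponent s - 1 >= 1. *)
have up (r : R) : 0 <= r <= r0 -> r `^ s - 1 - s * (r - 1) <= D * (r - 1) ^+ 2.
  move=> /andP[rge0 rr0].
  have s1 : 1 <= s by lra.
  have T := powR_tangent s1 rge0 ler01; rewrite !powR1 /= in T.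
  have U : (r - 1) * (r `^ (s - 1) - 1)
      <= ((s - 1) * r0 `^ (s - 2) + (s - 1)) * (r - 1) ^+ 2.
    have s11 : 1 <= s - 1 by lra.
    have Q0 := powR_ge0 r0 (s - 2).
    have S0 : 0 <= (r - 1) ^+ 2 by exact: sqr_ge0.
    have [r1|r1] := leP 1 r.
      have T' := powR_tangent s11 rge0 ler01; rewrite !powR1 /= in T'.
      have E : s - 1 - 1 = s - 2 by ring.
      rewrite E in T'.
      have H : r `^ (s - 1) - 1 <= (s - 1) * r0 `^ (s - 2) * (r - 1).
        apply: (@le_trans _ _ ((s - 1) * r `^ (s - 2) * (r - 1))); first lra.
        apply: ler_wpM2r; first lra.
        by apply: ler_wpM2l; [lra|apply: ler_powRl; lra].
      have r1' : 0 <= r - 1 by lra.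
      have := ler_wpM2l r1' H.
      have : 0 <= (s - 1) * (r - 1) ^+ 2 by apply: mulr_ge0 => //; lra.
      by rewrite expr2; lra.
    have T' := powR_tangent s11 ler01 rge0; rewrite !powR1 in T'.
    have r1' : 0 <= 1 - r by lra.
    have H : 1 - r `^ (s - 1) <= (s - 1) * (1 - r) by lra.
    have := ler_wpM2l r1' H.
    have : 0 <= (s - 1) * r0 `^ (s - 2) * (r - 1) ^+ 2.
      by apply: mulr_ge0 => //; apply: mulr_ge0 => //; lra.
    by rewrite expr2; lra.
  have s0 : 0 <= s by lra.
  have := ler_wpM2l s0 U.
  have : 0 <= s * (r - 1) ^+ 2 by apply: mulr_ge0 => //; exact: sqr_ge0.
  by rewrite /D; lra.
exists (p * ce / 4 / D).
  by rewrite !divr_gt0 //; apply: mulr_gt0 => //; lra.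
move=> r rr; apply: le_trans (low _ rr).
rewrite -(mulrA _ D^-1); apply: ler_wpM2l.
  by apply: ltW; rewrite divr_gt0 // mulr_gt0 //; lra.
by rewrite ler_pdivrMl //; exact: up.
Qed.

End powR_facts.

(** * Transfer of a convexity gain from the exponent s to the exponent p *)

Section convexity_gain.
Context {R : realType}.
Implicit Types a b p s : R.

Lemma powR_le1 a p : 0 <= p -> 0 <= a <= 1 -> a `^ p <= 1.
Proof.
move=> p0 /andP[a0 a1]; have := ler_powRl p0 a0 a1.
by rewrite powR1.
Qed.

(** For p < s this interpolates between two regimes: it is of order b^s a^(p - s) when b is small
    against a, and of order b^p when b dominates. In both branches it is homogeneous of degree p in
    (a, b), which allows normalizing a to 1. *)
Definition gain p s a b : R :=
  if p < s then b `^ s * (a + b) `^ (p - s) else b `^ p.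

Lemma gain_ge0 p s a b : 0 <= gain p s a b.
Proof. by rewrite /gain; case: ifP => _; rewrite ?mulr_ge0 ?powR_ge0. Qed.

Lemma gainMl p s t a b : 0 < p -> 0 < t -> 0 <= a -> 0 <= b ->
  gain p s (t * a) (t * b) = t `^ p * gain p s a b.
Proof.
move=> p0 t0 a0 b0; have t0' := ltW t0.
rewrite /gain; case: ifP => _; last by rewrite powRM.
rewrite -mulrDr !powRM //; last exact: addr_ge0.
rewrite mulrACA -powRD ?subrKC //.
by rewrite (gt_eqF t0) implybT.
Qed.

Lemma gain_le_powR p s a b : 0 < p -> 0 < s -> 0 <= a -> 0 <= b ->
  gain p s a b <= b `^ p.
Proof.
move=> p0 s0 a0; rewrite le_eqVlt => /predU1P[<-|b0].
  by rewrite /gain !powR0 ?gt_eqF //; case: ifP => // _; rewrite mul0r.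
rewrite /gain; case: ifP => // ps.
have -> : b `^ p = b `^ s * b `^ (p - s).
  by rewrite -powRD ?subrKC // (gt_eqF b0) implybT.
apply: ler_wpM2l; first exact: powR_ge0.
by apply: ler_powRl_neg; lra.
Qed.

(** Meant for t = 1 - l, the displacement caused by one jump of a centred Poisson variable: it
    restores the full increment b. The exponent p + s serves both branches of [gain]. *)
Lemma gain_scale_ge p s t a b : 0 < p -> 0 < s -> 2^-1 <= t <= 1 ->
  0 <= a -> 0 <= b ->
  2^-1 `^ (p + s) * gain p s a b <= gain p s a (t * b).
Proof.
move=> p0 s0 /andP[t2 t1] a0 b0; have t0 : 0 < t by lra.
have h (q : R) : 0 <= q -> 2^-1 `^ q <= t `^ q.
  by move=> q0; apply: ler_powRl => //; lra.
have h1 (q : R) : 0 <= q -> 2^-1 `^ q <= (1 : R).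
  by move=> q0; apply: powR_le1 => //; lra.
have D : 2^-1 `^ (p + s) = 2^-1 `^ p * 2^-1 `^ s :> R.
  by rewrite powRD // implybE invr_eq0 pnatr_eq0 orbT.
have Dp : 2^-1 `^ (p + s) <= 2^-1 `^ p :> R.
  by rewrite D ler_piMr ?powR_ge0 ?h1 ?ltW.
have Ds : 2^-1 `^ (p + s) <= 2^-1 `^ s :> R.
  by rewrite D ler_piMl ?powR_ge0 ?h1 ?ltW.
move: b0; rewrite le_eqVlt => /predU1P[<-|b0].
  by rewrite mulr0 /gain !powR0 ?gt_eqF //; case: ifP => _; rewrite ?mul0r mulr0.
rewrite /gain; case: ifP => ps; last first.
  rewrite powRM ?(ltW t0) ?(ltW b0) //; apply: ler_wpM2r; first exact: powR_ge0.
  by apply: le_trans Dp _; apply: h; exact: ltW.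
rewrite powRM ?(ltW t0) ?(ltW b0) // mulrA; apply: ler_pM; rewrite ?mulr_ge0 ?powR_ge0 //.
  apply: ler_wpM2r; first exact: powR_ge0.
  by apply: le_trans Ds _; apply: h; exact: ltW.
have tb : t * b <= b by rewrite ler_piMl // ltW.
have tb0 : 0 < t * b by exact: mulr_gt0.
by apply: ler_powRl_neg; lra.
Qed.

Lemma gain_transfer1 p s k : 1 < p -> 2 <= s -> 0 < k ->
  exists2 c : R, 0 < c <= 1 & forall r v b : R, 0 <= r -> 0 <= b ->
    1 + v <= r -> 1 + s * v + k * b `^ s <= r `^ s -> b <= 1 + r ->
    1 + p * v + c * gain p s 1 b <= r `^ p.
Proof.
move=> p1 s2 k0; have p0 : 0 < p by lra. have s0 : 0 < s by lra.
(* Beyond this threshold p r <= r^p / 2. *)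
pose r0 := Num.max 1 ((2 * p) `^ (p - 1)^-1).
have r01 : 1 <= r0 by rewrite /r0 le_max lexx.
have [c1 c10 Hc1] := powR_bregman_compare p1 s2 r01.
pose c2 := Num.min c1 (p / s).
have c20 : 0 < c2 by rewrite lt_min c10 divr_gt0.
pose K3 := 1 + (1 + r0) `^ (p - s).
have K30 : 0 < K3 by rewrite /K3; have := powR_ge0 (1 + r0) (p - s); lra.
pose c := Num.min (c2 * k / K3) (2^-1 `^ p / 2).
have q0 : 0 < (2^-1 : R) `^ p by apply: powR_gt0; lra.
have c0 : 0 < c by rewrite lt_min divr_gt0 ?mulr_gt0 //= divr_gt0.
exists c.
  rewrite c0 /= /c ge_min; apply/orP; right.
  have : 2^-1 `^ p <= (1 : R).
    by apply: powR_le1; lra.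
  by lra.
move=> r v b rge0 bge0 vr Hs br.
have Gb := @gain_le_powR p s 1 b p0 s0 ler01 bge0.
have Gge0 := gain_ge0 p s 1 b.
have vr' : 0 <= r - 1 - v by lra.
have [rr0|rr0] := leP r r0; last first.
  have r1 : 1 < r by lra.
  have rp : p * r <= r `^ p / 2.
    have : (2 * p) `^ (p - 1)^-1 <= r.
      by apply: le_trans (ltW rr0); rewrite /r0 le_max lexx orbT.
    have pB : 0 < p - 1 by lra.
    have h0 := powR_ge0 (2 * p) (p - 1)^-1.
    move=> /(ler_powRl (ltW pB) h0).
    rewrite -powRrM mulVf ?gt_eqF // powRr1; last by lra.
    move=> /(ler_wpM2l rge0); rewrite mulr_powRB1 //; lra.
  have bp : b `^ p <= 2 `^ p * r `^ p.
    rewrite -powRM //.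
    by apply: ler_powRl; lra.
  have cG : c * gain p s 1 b <= r `^ p / 2.
    apply: (@le_trans _ _ (2^-1 `^ p / 2 * (2 `^ p * r `^ p))).
      apply: ler_pM => //; [exact: ltW| by rewrite /c ge_min lexx orbT|].
      exact: le_trans Gb bp.
    have -> : 2^-1 `^ p / 2 * (2 `^ p * r `^ p)
        = (2^-1 `^ p * 2 `^ p) * r `^ p / 2 by ring.
    by rewrite -powRM ?mulVf ?powR1 ?mul1r //; lra.
  have := ler_wpM2l (ltW p0) vr'.
  by lra.
have rr : 0 <= r <= r0 by rewrite rge0.
have H1 := Hc1 _ rr.
have s1 : 1 <= s by lra.
have T := powR_tangent s1 ler01 rge0; rewrite !powR1 /= mulr1 in T.
have As0 : 0 <= r `^ s - 1 - s * (r - 1) by lra.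
have H2 : c2 * (r `^ s - 1 - s * (r - 1)) <= r `^ p - 1 - p * (r - 1).
  by apply: le_trans H1; apply: ler_wpM2r => //; rewrite ge_min lexx.
have H3 : c2 * s * (r - 1 - v) <= p * (r - 1 - v).
  apply: ler_wpM2r => //; rewrite -ler_pdivlMr //.
  by rewrite /c2 ge_min lexx orbT.
have H4 : c2 * (k * b `^ s) <= c2 * (r `^ s - 1 - s * v).
  by rewrite ler_pM2l //; lra.
have HG : gain p s 1 b <= K3 * b `^ s.
  rewrite /gain /K3 mulrDl mul1r; case: ifP => ps.
    apply: (@le_trans _ _ (b `^ s)).
      rewrite ler_piMr ?powR_ge0 //.
      by rewrite -[leRHS](congr1 (@^~ (p - s)) (@powR1 R)); apply: ler_powRl_neg; lra.
    by rewrite lerDl mulr_ge0 ?powR_ge0.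
  move: bge0; rewrite le_eqVlt => /predU1P[<-|b0].
    by rewrite !powR0 ?gt_eqF // mulr0 addr0.
  have -> : b `^ p = b `^ (p - s) * b `^ s.
    by rewrite -powRD ?subrK // (gt_eqF b0) implybT.
  have ps' : s <= p by rewrite leNgt ps.
  apply: ler_wpDl; first exact: powR_ge0.
  apply: ler_wpM2r; first exact: powR_ge0.
  by apply: ler_powRl; lra.
have H5 : c * gain p s 1 b <= c2 * k * b `^ s.
  apply: (@le_trans _ _ (c2 * k / K3 * (K3 * b `^ s))).
    apply: ler_pM => //; first exact: ltW.
    by rewrite /c ge_min lexx.
  by rewrite mulrA mulfVK // gt_eqF.
by lra.
Qed.

(** To be read with a and r the norms of a point and of its displacement, v the increment of a
    supporting linear function and b the length of the displacement. For a > 0 homogeneity reduces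
    to a = 1; for a = 0 the claim is c b^p <= r^p, which is why [gain_transfer1] also provides c <=
    1. *)
Lemma gain_transfer p s k : 1 < p -> 2 <= s -> 0 < k ->
  exists2 c : R, 0 < c & forall a r v b : R,
    0 <= a -> 0 <= r -> 0 <= b ->
    a + v <= r -> a `^ s + s * a `^ (s - 1) * v + k * b `^ s <= r `^ s ->
    b <= a + r ->
    a `^ p + p * a `^ (p - 1) * v + c * gain p s a b <= r `^ p.
Proof.
move=> p1 s2 k0; have [c /andP[c0 c1] Hc] := gain_transfer1 p1 s2 k0.
have p0 : 0 < p by lra.
exists c => // a r v b; rewrite le_eqVlt => /predU1P[<-|a0] r0 b0.
  rewrite !add0r => vr _ br.
  have pB : p - 1 != 0 by rewrite gt_eqF //; lra.
  rewrite !powR0 // ?gt_eqF // add0r mulr0 mul0r add0r.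
  apply: (@le_trans _ _ (b `^ p)); last by apply: ler_powRl => //; exact: ltW.
  apply: le_trans (@gain_le_powR p s 0 b p0 _ _ b0) => //; last lra.
  by rewrite ler_piMl // gain_ge0.
move=> vr Hs br.
have aV : 0 < a^-1 by rewrite invr_gt0.
have sc (x y : R) : x <= y -> a^-1 * x <= a^-1 * y by rewrite ler_pM2l.
have dv (q x : R) : 0 <= x -> (a^-1 * x) `^ q = x `^ q / a `^ q.
  move=> x0; rewrite powRM ?(ltW aV) // mulrC; congr (_ * _).
  by rewrite -powR_inv1 ?ltW // -powRrM mulN1r powRN.
have pw (q : R) : a `^ q = a `^ (q - 1) * a.
  rewrite -{3}(powRr1 (ltW a0)) -powRD ?subrK //.
  by rewrite (gt_eqF a0) implybT.
have := Hc (a^-1 * r) (a^-1 * v) (a^-1 * b).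
have ap (q : R) : 0 < a `^ q by exact: powR_gt0.
have -> : gain p s 1 (a^-1 * b) = gain p s a b / a `^ p.
  rewrite -[X in gain _ _ X _](mulVf (lt0r_neq0 a0)) gainMl //; last exact: ltW.
  rewrite mulrC; congr (_ * _).
  by rewrite -(powR_inv1 (ltW a0)) -powRrM mulN1r powRN.
rewrite !dv // => H.
have {H} := H (mulr_ge0 (ltW aV) r0) (mulr_ge0 (ltW aV) b0).
have -> : 1 + a^-1 * v = a^-1 * (a + v) by rewrite mulrDr mulVf ?gt_eqF.
have -> : 1 + a^-1 * r = a^-1 * (a + r) by rewrite mulrDr mulVf ?gt_eqF.
move=> /(_ (sc _ _ vr)) H.
have {H} := H _ (sc _ _ br).
have R1 (q : R) : 1 + q * (a^-1 * v) = (a `^ q + q * a `^ (q - 1) * v) / a `^ q.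
  rewrite mulrDl divff ?gt_eqF // (pw q) invfM; congr (_ + _).
  have := lt0r_neq0 (ap (q - 1)); have := lt0r_neq0 a0.
  by move: (a `^ (q - 1)) => x x0 y0; field; rewrite x0 y0.
rewrite !R1 !(mulrA k) !(mulrA c) -!mulrDl.
rewrite !ler_pM2r ?invr_gt0 //; exact.
Qed.

End convexity_gain.

(** * Renorming by martingale trees *)

Section martingale_trees.
Context {R : realType} {X : normedModType R}.
Variable s : R.
Hypothesis s1 : 1 <= s.

(** One increment [h] and one weight per node describe every centred two-valued step, so that the
    martingale property is built into the type. *)
Inductive mtree := MLeaf | MNode of {i01 R} & X & mtree & mtree.

(* The node at x moves to x + (1 - p) h with probability p and to x - p h with
   probability 1 - p. *)
Fixpoint tree_cost (K : R) (t : mtree) (x : X) : R :=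
  if t is MNode p h l r then
    p%:num * (tree_cost K l (x + (1 - p%:num) *: h) - `|(1 - p%:num) *: h| `^ s) +
    (1 - p%:num) * (tree_cost K r (x - p%:num *: h) - `|p%:num *: h| `^ s)
  else K * `|x| `^ s.

Fixpoint tree_depth (t : mtree) : nat :=
  if t is MNode _ _ l r then (maxn (tree_depth l) (tree_depth r)).+1 else 0.

(* Paths are coded by natural numbers, least significant bit first; odd means
   that the first step goes to the left subtree. *)
Fixpoint tree_weight (t : mtree) (w : nat) : R :=
  if t is MNode p _ l r then
    if odd w then p%:num * tree_weight l w./2
    else (1 - p%:num) * tree_weight r w./2
  else (w == 0)%:R.

Fixpoint tree_diff (t : mtree) (k w : nat) : X :=
  if t is MNode p h l r then
    if k is k'.+1 then tree_diff (if odd w then l else r) k' w./2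
    else if odd w then (1 - p%:num) *: h else - (p%:num *: h)
  else 0.

Fixpoint tree_mean (V : lmodType R) (t : mtree) (g : nat -> V) : V :=
  if t is MNode p _ l r then
    p%:num *: tree_mean l (fun w => g w.*2.+1) +
    (1 - p%:num) *: tree_mean r (fun w => g w.*2)
  else g 0%N.

Lemma i01_ge0 (p : {i01 R}) : 0 <= p%:num.
Proof. by []. Qed.

Lemma i01_le1 (p : {i01 R}) : 0 <= 1 - p%:num.
Proof. by rewrite subr_ge0. Qed.

Lemma tree_weight_ge0 t w : 0 <= tree_weight t w.
Proof.
elim: t w => [|p h l IHl r IHr] w //=.
by case: ifP => _; apply: mulr_ge0 => //; exact: i01_le1.
Qed.

Lemma eq_tree_mean (V : lmodType R) t (f g : nat -> V) :
  f =1 g -> tree_mean t f = tree_mean t g.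
Proof. by move=> /funext ->. Qed.

Lemma tree_mean_cst (V : lmodType R) t (c : V) : tree_mean t (fun=> c) = c.
Proof.
elim: t => [|p h l IHl r IHr] //=.
by rewrite IHl IHr -scalerDl addrC subrK scale1r.
Qed.

Lemma tree_meanD (V : lmodType R) t (f g : nat -> V) :
  tree_mean t (fun w => f w + g w) = tree_mean t f + tree_mean t g.
Proof.
elim: t f g => [|p h l IHl r IHr] f g //=.
by rewrite IHl IHr !scalerDr addrACA.
Qed.

Lemma tree_meanZ t c (f : nat -> R^o) :
  tree_mean t (fun w => c * f w : R^o) = c * tree_mean t f.
Proof.
elim: t f => [|p h l IHl r IHr] f //=.
rewrite IHl IHr !/(_ *: _) /=; set a := tree_mean l _; set b := tree_mean r _.
ring.
Qed.

Lemma tree_mean_le t (f g : nat -> R^o) :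
  (forall w, f w <= g w) -> tree_mean t f <= tree_mean t g.
Proof.
elim: t f g => [|p h l IHl r IHr] f g fg //=.
apply: lerD; apply: ler_wpM2l => //; first exact: IHl.
exact: IHr.
Qed.

Lemma sum_double (V : zmodType) (F : nat -> V) n :
  \sum_(w < n.*2) F w = \sum_(w < n) F w.*2.+1 + \sum_(w < n) F w.*2.
Proof.
elim: n => [|n IH]; first by rewrite !big_ord0 addr0.
rewrite doubleS !big_ord_recr /= IH -!addrA; congr (_ + _).
by rewrite [RHS]addrC -addrA.
Qed.

Lemma tree_mean_sum (V : lmodType R) t (g : nat -> V) n :
  (tree_depth t <= n)%N ->
  tree_mean t g = \sum_(w < 2 ^ n) tree_weight t w *: g w.
Proof.
elim: t n g => [|p h l IHl r IHr] n g /=.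
  move=> _; have : (0 < 2 ^ n)%N by rewrite expn_gt0.
  case: (2 ^ n)%N => // m _; rewrite big_ord_recl /= scale1r.
  by rewrite big1 ?addr0 // => i _; rewrite scale0r.
case: n => // n; rewrite ltnS geq_max => /andP[ln rn].
rewrite expnS mul2n.
rewrite (sum_double (fun w => tree_weight (MNode p h l r) w *: g w)) /=.
congr (_ + _).
  rewrite (IHl n) // scaler_sumr; apply: eq_bigr => i _.
  by rewrite /= odd_double /= uphalf_double scalerA.
rewrite (IHr n) // scaler_sumr; apply: eq_bigr => i _.
by rewrite odd_double doubleK scalerA.
Qed.

Lemma tree_costE K t x n : (tree_depth t <= n)%N ->
  tree_cost K t x =
  tree_mean t (fun w => K * `|x + \sum_(k < n) tree_diff t k w| `^ s : R^o)
  - \sum_(k < n) tree_mean t (fun w => `|tree_diff t k w| `^ s : R^o).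
Proof.
have s0 : s != 0 by rewrite gt_eqF // (lt_le_trans _ s1).
elim: t n x => [|p h l IHl r IHr] n x /=.
  move=> _; rewrite big1 // addr0 big1 ?subr0 // => i _.
  by rewrite normr0 powR0.
case: n => // n; rewrite ltnS geq_max => /andP[ln rn].
rewrite (IHl n) // (IHr n) // big_ord_recl /=.
rewrite (@eq_tree_mean R^o l (fun w => K *
    `|x + \sum_(k < n.+1) match nat_of_ord k with
      | 0 => if odd w.*2.+1 then (1 - p%:num) *: h else - (p%:num *: h)
      | k'.+1 => tree_diff (if odd w.*2.+1 then l else r) k' w.*2.+1./2
      end| `^ s) (fun w => K *
    `|x + (1 - p%:num) *: h + \sum_(k < n) tree_diff l k w| `^ s)); last first.
  move=> w; rewrite big_ord_recl /= odd_double /= addrA.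
  congr (_ * (`|_ + _| `^ _)); apply: eq_bigr => i _ /=.
  by rewrite uphalf_double.
rewrite (@eq_tree_mean R^o r (fun w => K *
    `|x + \sum_(k < n.+1) match nat_of_ord k with
      | 0 => if odd w.*2 then (1 - p%:num) *: h else - (p%:num *: h)
      | k'.+1 => tree_diff (if odd w.*2 then l else r) k' w.*2./2
      end| `^ s) (fun w => K *
    `|x - p%:num *: h + \sum_(k < n) tree_diff r k w| `^ s)); last first.
  move=> w; rewrite big_ord_recl /= odd_double /= addrA.
  congr (_ * (`|_ + _| `^ _)); apply: eq_bigr => i _ /=.
  by rewrite doubleK.
rewrite (@eq_tree_mean R^o l (fun w => `|if odd w.*2.+1 then (1 - p%:num) *: h
   else - (p%:num *: h)| `^ s) (fun=> `|(1 - p%:num) *: h| `^ s)); last first.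
  by move=> w /=; rewrite odd_double.
rewrite (@eq_tree_mean R^o r (fun w => `|if odd w.*2 then (1 - p%:num) *: h
   else - (p%:num *: h)| `^ s) (fun=> `|p%:num *: h| `^ s)); last first.
  by move=> w /=; rewrite odd_double normrN.
rewrite !tree_mean_cst.
have -> : \sum_(i < n) (p%:num *: (tree_mean l (fun w =>
      `|tree_diff (if odd w.*2.+1 then l else r) i w.*2.+1./2| `^ s : R^o)) +
     (1 - p%:num) *: (tree_mean r (fun w =>
      `|tree_diff (if odd w.*2 then l else r) i w.*2./2| `^ s : R^o)))
  = p%:num *: (\sum_(i < n) tree_mean l (fun w => `|tree_diff l i w| `^ s : R^o))
   + (1 - p%:num) *:
     (\sum_(i < n) tree_mean r (fun w => `|tree_diff r i w| `^ s : R^o)).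
  rewrite !scaler_sumr -big_split /=; apply: eq_bigr => i _.
  congr (_ *: _ + _ *: _); apply: eq_tree_mean => w /=.
    by rewrite odd_double /= uphalf_double.
  by rewrite odd_double /= doubleK.
rewrite !/(_ *: _ : R^o) /=.
set a := tree_mean _ _; set b := \sum_(_ < _) _; set c := tree_mean _ _.
set d := \sum_(_ < _) _.
ring.
Qed.

Lemma tree_mean_convex t x n : (tree_depth t <= n)%N ->
  `|x| `^ s <=
  tree_mean t (fun w => `|x + \sum_(k < n) tree_diff t k w| `^ s : R^o).
Proof.
elim: t n x => [|p h l IHl r IHr] n x /=.
  by move=> _; rewrite big1 // addr0.
case: n => // n; rewrite ltnS geq_max => /andP[ln rn].
rewrite (@eq_tree_mean R^o l _ (fun w =>
    `|x + (1 - p%:num) *: h + \sum_(k < n) tree_diff l k w| `^ s)); last first.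
  move=> w; rewrite big_ord_recl /= odd_double /= addrA.
  congr (`|_ + _| `^ _); apply: eq_bigr => i _ /=.
  by rewrite uphalf_double.
rewrite (@eq_tree_mean R^o r _ (fun w =>
    `|x - p%:num *: h + \sum_(k < n) tree_diff r k w| `^ s)); last first.
  move=> w; rewrite big_ord_recl /= odd_double /= addrA.
  congr (`|_ + _| `^ _); apply: eq_bigr => i _ /=.
  by rewrite doubleK.
have s0 : 0 <= s by exact: le_trans s1.
have := lerD (ler_wpM2l (i01_ge0 p) (IHl n (x + (1 - p%:num) *: h) ln))
  (ler_wpM2l (i01_le1 p) (IHr n (x - p%:num *: h) rn)).
apply: le_trans.
apply: le_trans (powR_convex2 s1 _ (normr_ge0 _) (normr_ge0 _)); last first.
  by rewrite i01_ge0 /= -subr_ge0 i01_le1.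
apply: ler_powRl => //.
have {1}-> : x = p%:num *: (x + (1 - p%:num) *: h)
    + (1 - p%:num) *: (x - p%:num *: h).
  rewrite !scalerDr addrACA -scalerDl subrKC scale1r scalerN !scalerA.
  by rewrite [(1 - _) * _]mulrC subrr addr0.
apply: le_trans (ler_normD _ _) _.
by rewrite !normrZ (ger0_norm (i01_ge0 p)) (ger0_norm (i01_le1 p)).
Qed.

(* The left factor depends on the first k bits only. *)
Lemma tree_mean_diff0 t k (c : nat -> R) :
  (forall w w', w = w' %[mod 2 ^ k] -> c w = c w') ->
  tree_mean t (fun w => c w *: tree_diff t k w) = 0.
Proof.
elim: t k c => [|p h l IHl r IHr] k c Hc /=; first by rewrite scaler0.
case: k Hc => [|k] Hc.
  have c0 w : c w = c 0%N by apply: Hc; rewrite expn0 !modn1.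
  rewrite (@eq_tree_mean X l _ (fun=> c 0%N *: ((1 - p%:num) *: h))); last first.
    by move=> w; rewrite c0 /= odd_double.
  rewrite (@eq_tree_mean X r _ (fun=> c 0%N *: (- (p%:num *: h)))); last first.
    by move=> w; rewrite c0 /= odd_double.
  rewrite !tree_mean_cst !scalerN !scalerA -scalerBl.
  by rewrite (_ : _ - _ = 0) ?scale0r //; ring.
rewrite (@eq_tree_mean X l _ (fun w => c w.*2.+1 *: tree_diff l k w)); last first.
  by move=> w; rewrite /= odd_double /= uphalf_double.
rewrite (@eq_tree_mean X r _ (fun w => c w.*2 *: tree_diff r k w)); last first.
  by move=> w; rewrite odd_double doubleK.
rewrite IHl ?IHr ?scaler0 ?addr0 // => w w' ww'; apply: Hc.
  by rewrite -!muln2 expnSr -!muln_modl ww'.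
apply/eqP; rewrite -(addn1 w.*2) -(addn1 w'.*2) eqn_modDr.
by rewrite -!muln2 expnSr -!muln_modl ww'.
Qed.

Lemma tree_diff_range t k : finite_set (range (tree_diff t k)).
Proof.
elim: t k => [|p h l IHl r IHr] k /=.
  by apply: sub_finite_set (finite_set1 (0 : X)) => _ [w _ <-].
case: k => [|k].
  apply: sub_finite_set (_ : finite_set [set (1 - p%:num) *: h; - (p%:num *: h)]).
    by move=> _ [w _ <-]; case: ifP => _; [left|right].
  exact: finite_set2.
apply: (@sub_finite_set _ _ (range (tree_diff l k) `|` range (tree_diff r k))).
  by move=> _ [w _ <-]; case: ifP => _; [left|right]; exists w./2.
by rewrite finite_setU.
Qed.

Lemma tree_diff_mod t k w w' : w = w' %[mod 2 ^ k.+1] ->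
  tree_diff t k w = tree_diff t k w'.
Proof.
elim: t k w w' => [//|p h l IHl r IHr] k w w' ww' /=.
have modd : odd w = odd w'.
  have d2 : (2 %| 2 ^ k.+1)%N by rewrite expnS dvdn_mulr.
  have := congr1 (fun m => m %% 2)%N ww'; rewrite !modn_dvdm // !modn2.
  by case: (odd w); case: (odd w').
case: k ww' => [|k] ww'; first by rewrite modd.
have h2 : w./2 = w'./2 %[mod 2 ^ k.+1].
  by rewrite -!divn2 !modn_divl -expnSr ww'.
by rewrite modd; case: ifP => _; [apply: IHl|apply: IHr].
Qed.

End martingale_trees.

Lemma bochner_normE {R : realType} {d} {T : measurableType d}
    {X : normedModType R} (mu : {measure set T -> \bar R}) (p : R) (f : T -> X) :
  bochner_norm mu p f = ((\int[mu]_w (`|f w| `^ p)%:E) `^ p^-1)%E.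
Proof.
rewrite /bochner_norm Lnorm.unlock; congr (poweR _ _).
by apply: eq_integral => w _; rewrite /= normr_id.
Qed.

(** * Trees as martingales on a discrete probability space *)

Section tree_cotype.
Context {R : realType} {X : normedModType R}.
Implicit Types t : @mtree R X.

(** The law of the path code. Every subset of [nat] is measurable, so the cotype hypothesis applies
    to a tree without measurability conditions on its increments beyond adaptedness. *)
Definition tree_prob t : set nat -> \bar R :=
  msum (fun w => mscale (NngNum (tree_weight_ge0 t w)) (@dirac _ nat w R))
       (2 ^ tree_depth t).

HB.instance Definition _ t := Measure.on (tree_prob t).

Lemma integral_tree_prob t (g : nat -> R) : (forall w, 0 <= g w) ->
  (\int[tree_prob t]_w (g w)%:E)%E = (tree_mean t (g : nat -> R^o))%:E.
Proof.
move=> g0; rewrite /tree_prob ge0_integral_measure_sum //; last first.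
  by move=> w _; rewrite lee_fin.
rewrite (tree_mean_sum _ (leqnn _)) -sumEFin; apply: eq_bigr => w _.
rewrite ge0_integral_mscale //=; last by move=> ? _; rewrite lee_fin.
by rewrite integral_dirac // diracT mul1e.
Qed.

Lemma tree_probE t (A : set nat) :
  tree_prob t A = (\sum_(w < 2 ^ tree_depth t) tree_weight t w * \1_A (w : nat))%:E.
Proof.
by rewrite /tree_prob /msum -sumEFin; apply: eq_bigr => w _; rewrite /= /mscale /= diracE.
Qed.

Lemma tree_prob_setT t : tree_prob t setT = 1%E.
Proof.
rewrite tree_probE; congr EFin.
transitivity (tree_mean t (fun=> 1 : R^o)); last exact: tree_mean_cst.
rewrite (tree_mean_sum _ (leqnn _)); apply: eq_bigr => w _.
by rewrite indicE in_setT.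
Qed.

HB.instance Definition _ t :=
  Measure_isProbability.Build _ _ _ (tree_prob t) (tree_prob_setT t).

Lemma simple_integral_tree_prob t (f : nat -> X) : finite_set (range f) ->
  simple_integral (tree_prob t) f = tree_mean t f.
Proof.
move=> fr; rewrite /simple_integral fsbig_finite //=.
under eq_bigr do rewrite tree_probE /= scaler_suml.
rewrite exchange_big (tree_mean_sum _ (leqnn _)); apply: eq_bigr => w _ /=.
rewrite (bigD1_seq (f w)) /=; last 2 first.
  - by rewrite in_fset_set // inE; exists (w : nat).
  - exact: finmap.fset_uniq.
rewrite indicE mem_set // mulr1 big1 ?addr0 // => x xw.
rewrite indicE memNset ?mulr0 ?scale0r //= => /esym/eqP.
by rewrite (negbTE xw).
Qed.

(** The information carried by the first i steps: a path code modulo 2^i is its first i bits. *)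
Definition bit_algebra (i : nat) : set (set nat) :=
  [set A | forall w w', w = w' %[mod 2 ^ i] -> A w -> A w'].

Lemma simple_bit (f : nat -> X) : finite_set (range f) ->
  is_simple measurable f.
Proof. by move=> fr; split. Qed.

Lemma tree_martingale_difference t s : 1 <= s ->
  martingale_difference (tree_prob t) s bit_algebra
    (fun i : 'I_(tree_depth t) => tree_diff t i).
Proof.
move=> s1; split.
- move=> i _; split=> //; split.
  + by move=> w w' _.
  + move=> A HA w w' ww' [_ Aw]; split=> // Aw'; apply: Aw.
    by apply: HA Aw'.
  + by move=> A HA w w' ww' [k _ Akw]; exists k => //; apply: HA Akw.
- move=> i _ A HA w w' ww'; apply: HA.
  have d2 : (2 ^ i %| 2 ^ i.+1)%N by rewrite expnS dvdn_mull.
  by have := congr1 (fun m => m %% 2 ^ i)%N ww'; rewrite !modn_dvdm.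
- move=> i; exists (fun=> tree_diff t i); split; last by move=> w; exact: cvg_cst.
  move=> _; split; first exact: tree_diff_range.
  by move=> x w w' ww' /= <-; apply/esym/tree_diff_mod.
- move=> i; rewrite bochner_normE integral_tree_prob; last by move=> w; exact: powR_ge0.
  by rewrite poweR_EFin ltry.
- move=> i A HA.
  have fr : finite_set (range (fun w => (\1_A w : R) *: tree_diff t i w)).
    apply: (@sub_finite_set _ _ (range (tree_diff t i) `|` [set 0])).
      move=> _ [w _ <-]; rewrite indicE; case: (w \in A).
        by left; exists w => //; rewrite scale1r.
      by right; rewrite scale0r.
    by rewrite finite_setU; split => //; exact: tree_diff_range.
  split.
    exists (fun=> fun w => \1_A w *: tree_diff t i w); split.
      by move=> _; exact: simple_bit.
    by move=> w; exact: cvg_cst.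
  exists (fun=> fun w => \1_A w *: tree_diff t i w); split.
  + by move=> _; exact: simple_bit.
  + under eq_fun => n do under eq_integral => w _ do rewrite subrr normr0.
    by rewrite integral0; exact: cvg_cst.
  + rewrite simple_integral_tree_prob // tree_mean_diff0; first exact: cvg_cst.
    move=> w w' ww'; rewrite !indicE.
    suff -> : (w \in A) = (w' \in A) by [].
    by apply/idP/idP; rewrite !inE; apply: HA.
Qed.

Lemma tree_cotype s : 1 <= s -> martingale_cotype X s ->
  exists2 C : R, 0 <= C & forall t,
    \sum_(k < tree_depth t) tree_mean t (fun w => `|tree_diff t k w| `^ s : R^o)
    <= C * tree_mean t
             (fun w => `|\sum_(k < tree_depth t) tree_diff t k w| `^ s : R^o).
Proof.
(* The constant in [martingale_cotype] has no prescribed sign, hence the absolute value; the power s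
   removes the roots. *)
move=> s1 [C HC]; exists (`|C| `^ s); first exact: powR_ge0.
have s0 : 0 < s by exact: lt_le_trans s1.
move=> t; have := HC _ _ _ _ _ _ (tree_martingale_difference t s1).
under eq_bigr do rewrite (integral_tree_prob _ (fun=> powR_ge0 _ _)).
rewrite (integral_tree_prob _ (fun=> powR_ge0 _ _)).
rewrite sumEFin !poweR_EFin -EFinM lee_fin.
set a := \sum_(_ < _) _; set b := tree_mean _ _ => H.
have a0 : 0 <= a.
  apply: sumr_ge0 => k _.
  rewrite -(tree_mean_cst (V := R^o) t 0); apply: tree_mean_le => w.
  exact: powR_ge0.
have b0 : 0 <= b.
  rewrite -(tree_mean_cst (V := R^o) t 0); apply: tree_mean_le => w.
  exact: powR_ge0.
have H1 : a `^ s^-1 <= `|C| * b `^ s^-1.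
  apply: le_trans H _; apply: ler_wpM2r; first exact: powR_ge0.
  exact: ler_norm.
have := ler_powRl (ltW s0) (powR_ge0 _ _) H1.
rewrite powRM ?powR_ge0 // -!powRrM mulVf ?gt_eqF // !powRr1 //.
Qed.

End tree_cotype.

(** * Pisier's renorming *)

Section renorming.
Context {R : realType} {X : normedModType R}.

(** The midpoint inequality loses the original norm of h, with coefficient 1, because tree costs
    subtract exactly that; all the quantitative information is in K. *)
Record uniformly_convex_norm (s K : R) (N : X -> R) : Prop := {
  ucn_ge : forall x, `|x| <= N x;
  ucn_le : forall x, N x <= K * `|x|;
  ucnZ : forall c x, N (c *: x) = `|c| * N x;
  ucnD : forall x y, N (x + y) <= N x + N y;
  ucn_midpoint : forall x h,
    N x `^ s <= (N (x + h) `^ s + N (x - h) `^ s) / 2 - `|h| `^ s }.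

Fixpoint tree_scale (c : R) (t : @mtree R X) : mtree :=
  if t is MNode p h l r then MNode p (c *: h) (tree_scale c l) (tree_scale c r)
  else MLeaf.

Lemma tree_cost_scale s K c t x : 1 <= s ->
  tree_cost s K (tree_scale c t) (c *: x) = `|c| `^ s * tree_cost s K t x.
Proof.
move=> s1; elim: t x => [|p h l IHl r IHr] x /=.
  by rewrite normrZ powRM // mulrCA.
rewrite !scalerA ![_ * c]mulrC -!scalerA -scalerDr -scalerBr IHl IHr.
rewrite ![`|c *: _|]normrZ !powRM //; set a := `|c| `^ s.
by ring.
Qed.

Section pisier.
Variables (s : R) (s1 : 1 <= s) (hX : martingale_cotype X s).

(** With A = E|f_n|^s, cotype bounds the subtracted sum by C E|f_n - x|^s <= C 2^s (A + |x|^s), and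
    Jensen's inequality |x|^s <= A turns this into C 2^s 2 A. The chosen K leaves A itself, which is
    at least |x|^s. *)
Lemma tree_cost_lower_bound : exists2 K : R, 0 < K &
  forall (t : @mtree R X) (x : X),
  `|x| `^ s <= tree_cost s K t x.
Proof.
have [C C0 HC] := tree_cotype s1 hX.
pose K := 1 + C * (2 `^ s * 2); have p2 := powR_ge0 2 s.
exists K; first by apply: ltr_wpDr => //; rewrite !mulr_ge0.
move=> t x; rewrite (tree_costE s1 _ _ (leqnn _)).
have M1 := tree_mean_convex s1 x (leqnn (tree_depth t)).
rewrite tree_meanZ.
set A := tree_mean t _ in M1 *; set B := \sum_(_ < _) _.
have HB : B <= C * (2 `^ s * (2 * A)).
  apply: le_trans (HC t) _; apply: ler_wpM2l => //.
  apply: (@le_trans _ _ (tree_mean t (fun w => 2 `^ s *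
     (`|x + \sum_(k < tree_depth t) tree_diff t k w| `^ s + `|x| `^ s) : R^o))).
    apply: tree_mean_le => w; set y := \sum_(_ < _) _.
    have -> : y = (x + y) - x by rewrite addrAC subrr add0r.
    rewrite [x + (_ - _)]addrC subrK.
    apply: le_trans (powR_add_le s1 (normr_ge0 _) (normr_ge0 _)).
    apply: ler_powRl => //; first exact: le_trans s1.
    exact: ler_normB.
  rewrite tree_meanZ; apply: ler_wpM2l => //.
  rewrite (tree_meanD t (fun w => _ : R^o) (fun=> _ : R^o)) tree_mean_cst.
  by rewrite -/A; lra.
apply: le_trans M1 _.
rewrite /K; lra.
Qed.

Lemma renorming_cotype : exists2 K : R, 0 < K & exists N : X -> R,
  uniformly_convex_norm s K N.
Proof.
have [K K0 HK] := tree_cost_lower_bound.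
have s0 : 0 < s by exact: lt_le_trans s1.
have sN0 : s != 0 by rewrite gt_eqF.
pose S (x : X) := [set c | exists t, c = tree_cost s K t x].
pose U x := inf (S x).
have S0 x : S x !=set0 by exists (tree_cost s K MLeaf x); exists MLeaf.
have Slb x : lbound (S x) (`|x| `^ s) by move=> _ [t ->]; exact: HK.
have Uge x : `|x| `^ s <= U x by apply: lb_le_inf.
have Ule x t : U x <= tree_cost s K t x.
  by apply: ge_inf; [exists (`|x| `^ s)|exists t].
have U0 x : 0 <= U x by exact: le_trans (powR_ge0 _ _) (Uge x).
have UleP x A p B : 0 <= p -> (forall t, A <= p * tree_cost s K t x + B) ->
    A <= p * U x + B.
  rewrite le_eqVlt => /predU1P[<- /(_ MLeaf)|p0 H]; first by rewrite !mul0r.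
  suff : (A - B) / p <= U x by rewrite ler_pdivrMr //; lra.
  apply: lb_le_inf => // _ [t ->]; rewrite ler_pdivrMr //.
  by have := H t; lra.
(* Two trees grafted under one node form a tree at x. The infimum is taken over one subtree at a
   time; [E] and [E1] isolate the relevant term, and [UleP] admits coefficient 0 since branching
   weights may be 0 or 1. *)
have bellman (p : {i01 R}) x h :
    U x <= p%:num * (U (x + (1 - p%:num) *: h) - `|(1 - p%:num) *: h| `^ s) +
    (1 - p%:num) * (U (x - p%:num *: h) - `|p%:num *: h| `^ s).
  set a := `|(1 - _) *: h| `^ s; set b := `|_ *: h| `^ s.
  have E u v : p%:num * (u - a) + (1 - p%:num) * (v - b) = 
     p%:num * u + ((1 - p%:num) * v - p%:num * a - (1 - p%:num) * b) by ring.
  rewrite E; apply: (UleP _ _ _ _ _) => // t1.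
  have E1 u v : p%:num * u + ((1 - p%:num) * v - p%:num * a - (1 - p%:num) * b)
     = (1 - p%:num) * v + (p%:num * (u - a) - (1 - p%:num) * b) by ring.
  rewrite E1; apply: (UleP _); first exact: i01_le1.
  move=> t2; apply: le_trans (Ule x (MNode p h t1 t2)) _ => /=.
  by rewrite -/a -/b; lra.
have U00 : U 0 = 0.
  apply/eqP; rewrite eq_le U0 andbT; apply: le_trans (Ule 0 MLeaf) _ => /=.
  by rewrite normr0 powR0 // mulr0.
have UZle c x : U (c *: x) <= `|c| `^ s * U x.
  rewrite -[leRHS]addr0; apply: (UleP _); first exact: powR_ge0.
  by move=> t; rewrite addr0 -tree_cost_scale //; exact: Ule.
have UZ c x : U (c *: x) = `|c| `^ s * U x.
  have [->|c0] := eqVneq c 0; first by rewrite scale0r normr0 powR0 // mul0r.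
  apply/eqP; rewrite eq_le UZle /=.
  have := UZle c^-1 (c *: x); rewrite scalerA mulVf // scale1r.
  have cs : 0 < `|c| `^ s by rewrite powR_gt0 // normr_gt0.
  move=> /(ler_wpM2l (ltW cs)); rewrite mulrA -powRM // -normrM divff //.
  by rewrite normr1 powR1 mul1r.
pose N x := U x `^ s^-1.
have NU x : N x `^ s = U x by rewrite /N -powRrM mulVf // powRr1.
have N0 x : 0 <= N x by exact: powR_ge0.
have sV0 : 0 <= s^-1 by rewrite invr_ge0 ltW.
have Nge x : `|x| <= N x.
  rewrite -[leLHS]powRr1 // -(mulfV sN0) powRrM.
  by apply: ler_powRl => //; exact: powR_ge0.
have NZ c x : N (c *: x) = `|c| * N x.
  by rewrite /N UZ powRM ?powR_ge0 // -powRrM mulfV // powRr1.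
(* A homogeneous function with convex unit ball is subadditive. The normalized sum (x + y) / (a + b)
   is the mean of the unit vectors x / a and y / b with weights a / (a + b) and b / (a + b), so
   [bellman] with these weights gives U <= 1 there. *)
have ND x y : N (x + y) <= N x + N y.
  have [Nx0|Nx] := eqVneq (N x) 0.
    have : `|x| <= 0 by rewrite -Nx0.
    by rewrite normr_le0 => /eqP ->; rewrite add0r lerDr.
  have [Ny0|Ny] := eqVneq (N y) 0.
    have : `|y| <= 0 by rewrite -Ny0.
    by rewrite normr_le0 => /eqP ->; rewrite addr0 lerDl.
  have {}Nx : 0 < N x by rewrite lt_neqAle eq_sym Nx N0.
  have {}Ny : 0 < N y by rewrite lt_neqAle eq_sym Ny N0.
  set a := N x in Nx *; set b := N y in Ny *.
  have ab : 0 < a + b by exact: addr_gt0.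
  have t0 : 0 <= a / (a + b) by rewrite divr_ge0 ?ltW.
  have t1 : a / (a + b) <= 1 by rewrite ler_pdivrMr // mul1r lerDl ltW.
  have := bellman (Itv01 t0 t1) ((a + b)^-1 *: (x + y)) (a^-1 *: x - b^-1 *: y).
  rewrite /=; set t := a / (a + b).
  have tE : 1 - t = b / (a + b) by rewrite /t; field; rewrite gt_eqF.
  have -> : (a + b)^-1 *: (x + y) + (1 - t) *: (a^-1 *: x - b^-1 *: y)
      = a^-1 *: x.
    rewrite tE scalerDr scalerBr !scalerA addrACA -scalerDl -scalerBl.
    have -> : (a + b)^-1 + b / (a + b) / a = a^-1.
      by field; rewrite !gt_eqF.
    have -> : (a + b)^-1 - b / (a + b) / b = 0 by field; rewrite !gt_eqF.
    by rewrite scale0r addr0.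
  have -> : (a + b)^-1 *: (x + y) - t *: (a^-1 *: x - b^-1 *: y)
      = b^-1 *: y.
    rewrite /t scalerDr scalerBr opprB !scalerA [_ *: y - _]addrC addrACA.
    rewrite -scalerBl.
    have -> : (a + b)^-1 - a / (a + b) / a = 0 by field; rewrite !gt_eqF.
    rewrite scale0r add0r -scalerDl; congr (_ *: _).
    by field; rewrite !gt_eqF.
  have U1 z : 0 < N z -> U ((N z)^-1 *: z) = 1.
    move=> Nz; rewrite UZ -NU -powRM ?normr_ge0 //.
    by rewrite ger0_norm ?invr_ge0 ?(ltW Nz) // mulVf ?gt_eqF // powR1.
  rewrite (U1 x) // (U1 y) //.
  set u := `|_| `^ s; set v := `|_| `^ s => H.
  have Hz : U ((a + b)^-1 *: (x + y)) <= 1.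
    apply: le_trans H _.
    have u0 : 0 <= t * u by rewrite mulr_ge0 // powR_ge0.
    have v0 : 0 <= (1 - t) * v by rewrite mulr_ge0 ?powR_ge0 // subr_ge0.
    by lra.
  rewrite /N; have -> : x + y = (a + b) *: ((a + b)^-1 *: (x + y)).
    by rewrite scalerA mulfV ?scale1r // gt_eqF.
  rewrite -/(N _) NZ (gtr0_norm ab) ler_piMr ?(ltW ab) //.
  by apply: powR_le1 => //; rewrite U0.
have h0 : 0 <= (2^-1 : R) by lra.
have h1 : (2^-1 : R) <= 1 by lra.
exists (K `^ s^-1); first exact: powR_gt0.
exists N; split => //.
- move=> x; have -> : K `^ s^-1 * `|x| = (K * `|x| `^ s) `^ s^-1.
    by rewrite powRM ?powR_ge0 ?(ltW K0) // -powRrM mulfV // powRr1.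
  by apply: ler_powRl => //; exact: (Ule x MLeaf).
(* Weight 1/2 and increment 2 h make x + h and x - h the two children. *)
- move=> x h; have := bellman (Itv01 h0 h1) x (2 *: h).
  rewrite /= !scalerA.
  have -> : (1 - 2^-1) * 2 = 1 :> R by field.
  rewrite mulVf ?scale1r // !NU; lra.
Qed.

End pisier.
End renorming.

(** * Gain of convexity under Poisson averages *)

Section poisson_weights.
Context {R : realType}.
Implicit Types l : R.

Definition poisson_weight l (m : nat) : R := l ^+ m / m`!%:R * expR (- l).

Lemma poisson_weight_ge0 l m : 0 <= l -> 0 <= poisson_weight l m.
Proof. by move=> l0; rewrite !mulr_ge0 ?exprn_ge0 ?expR_ge0 ?invr_ge0. Qed.

Lemma sum_poisson_weight l : 0 <= l ->
  (\sum_(m <oo) (poisson_weight l m)%:E = 1)%E.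
Proof.
move=> l0; transitivity ((expR (- l))%:E * (expR l)%:E)%E; last first.
  by rewrite -EFinM expRN mulVf ?gt_eqF ?expR_gt0.
under eq_eseriesr do rewrite /poisson_weight EFinM muleC.
rewrite nneseriesZl; last by move=> m _; rewrite lee_fin divr_ge0 ?exprn_ge0.
congr *%E; rewrite expRE -EFin_lim; last first.
  rewrite /pseries/=; under eq_fun do rewrite mulrC.
  exact: is_cvg_series_exp_coeff.
apply/congr_lim/funext => n/=; rewrite /pseries/= /series/= -sumEFin//.
by under eq_bigr do rewrite mulrC.
Qed.

Lemma sum_poisson_weight_id l : 0 <= l ->
  (\sum_(m <oo) (poisson_weight l m * m%:R)%:E = l%:E)%E.
Proof.
move=> l0.
rewrite nneseries_recl //; last first.
  by move=> m _; rewrite lee_fin mulr_ge0 // poisson_weight_ge0.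
rewrite mulr0 add0e -(@nneseries_addn _ (fun m => (poisson_weight l m * m%:R)%:E) 1%N); last first.
  by move=> m; rewrite lee_fin mulr_ge0 // poisson_weight_ge0.
transitivity (l%:E * \sum_(m <oo) (poisson_weight l m)%:E)%E; last first.
  by rewrite sum_poisson_weight // mule1.
rewrite -nneseriesZl; last by move=> m _; rewrite lee_fin poisson_weight_ge0.
apply: eq_eseriesr => m _; rewrite -EFinM; congr EFin.
rewrite addn1 /poisson_weight exprS factS natrM.
have m0 : m.+1%:R != 0 :> R by rewrite pnatr_eq0.
have f0 : m`!%:R != 0 :> R by rewrite pnatr_eq0 -lt0n fact_gt0.
move: (m.+1%:R : R) m0 (m`!%:R : R) f0 => u u0 v v0.
by field; rewrite u0 v0.
Qed.

(* The slope k contributes nothing because the centred Poisson law has mean 0. *)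
Lemma poisson_weight_jensen l (h g : R -> R) (a k : R) : 0 <= l ->
  0 <= a -> (forall t, 0 <= g t) -> (forall t, 0 <= h t) ->
  (forall t, a + k * t + g t <= h t) ->
  ((a + poisson_weight l 1 * g (1 - l))%:E
     <= \sum_(m <oo) (poisson_weight l m * h (m%:R - l))%:E)%E.
Proof.
move=> l0 a0 g0 h0 H.
(* Series of nonnegative terms are wanted, while k t changes sign. Splitting k and adding (kn + kp)
   l to both sides, as a Poisson mean on the right, makes all terms nonnegative. *)
pose kp := Num.max k 0; pose kn := Num.max (- k) 0.
have kp0 : 0 <= kp by rewrite /kp le_max lexx orbT.
have kn0 : 0 <= kn by rewrite /kn le_max lexx orbT.
have kE : k = kp - kn.
  rewrite /kp /kn; have [k0|k0] := leP k 0; have [nk0|nk0] := leP (- k) 0; lra.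
have w0 m := @poisson_weight_ge0 l m l0.
have lin (c d : R) : 0 <= c -> 0 <= d ->
    (\sum_(m <oo) (poisson_weight l m * (c * m%:R + d))%:E = (c * l + d)%:E)%E.
  move=> c0 d0.
  transitivity (\sum_(m <oo) (c%:E * (poisson_weight l m * m%:R)%:E +
      d%:E * (poisson_weight l m)%:E))%E.
    apply: eq_eseriesr => m _; rewrite -!EFinM -EFinD; congr EFin; ring.
  rewrite nneseriesD.
  - rewrite nneseriesZl; last by move=> m _; rewrite lee_fin mulr_ge0 ?w0.
    rewrite nneseriesZl; last by move=> m _; rewrite lee_fin w0.
    by rewrite sum_poisson_weight // sum_poisson_weight_id // mule1.
  - by move=> m _ _; rewrite -EFinM lee_fin; apply: mulr_ge0 => //; apply: mulr_ge0.
  - by move=> m _ _; rewrite -EFinM lee_fin mulr_ge0 ?w0.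
rewrite -(@leeD2rE _ (kn * l + kp * l)%:E) //.
have d0 : 0 <= kp * l by exact: mulr_ge0.
rewrite -[X in (_ <= _ + X)%E](lin _ _ kn0 d0) -nneseriesD; last 2 first.
  - by move=> m _ _; rewrite lee_fin mulr_ge0.
  - by move=> m _ _; rewrite lee_fin mulr_ge0 // addr_ge0 // mulr_ge0.
have d1 : 0 <= a + kn * l by rewrite addr_ge0 // mulr_ge0.
(* The gain is kept at m = 1 only, written as a series with a single nonzero term. *)
have -> : ((a + poisson_weight l 1 * g (1 - l))%:E + (kn * l + kp * l)%:E
   = (kp * l + (a + kn * l))%:E
     + \sum_(m <oo) (if m == 1%N then poisson_weight l 1 * g (1 - l) else 0)%:E)%E.
  rewrite (nneseriesD1 (n := 1%N)) //; last first.
    by move=> m _; case: ifP => // _; rewrite lee_fin mulr_ge0.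
  rewrite eseries0 ?adde0; last by move=> m _ /andP[_ /negbTE ->].
  by rewrite -!EFinD /=; congr EFin; ring.
rewrite -(lin _ _ kp0 d1) -nneseriesD; last 2 first.
  - by move=> m _ _; rewrite lee_fin mulr_ge0 // addr_ge0 // mulr_ge0.
  - by move=> m _ _; case: ifP => // _; rewrite lee_fin mulr_ge0.
apply: lee_nneseries => m _.
  move=> _; apply: adde_ge0; rewrite lee_fin.
    by rewrite mulr_ge0 // addr_ge0 // mulr_ge0.
  by case: ifP => // _; rewrite mulr_ge0.
rewrite -!EFinD lee_fin -mulrDr.
have -> : (if m == 1%N then poisson_weight l 1 * g (1 - l) else 0)
    = poisson_weight l m * (if m == 1%N then g (1 - l) else 0).
  by case: eqP => [->|_] //; rewrite mulr0.
rewrite -mulrDr; apply: ler_wpM2l => //.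
have := H (m%:R - l); have := g0 (m%:R - l); rewrite kE.
by case: eqP => [->|_]; lra.
Qed.

Lemma poisson_weight1_ge l : 0 <= l <= 2^-1 -> expR (- 2^-1) * l <= poisson_weight l 1.
Proof.
move=> /andP[l0 l2]; rewrite /poisson_weight expr1 (_ : l / _ = l) ?divr1 // mulrC.
by apply: ler_wpM2l => //; rewrite ler_expR lerN2.
Qed.

End poisson_weights.

(** * Convexity of the new norm along lines and under Poisson averages *)

Section pointwise_convexity.
Context {R : realType} {X : normedModType R} {s K : R} {N : X -> R}.
Hypothesis s2 : 2 <= s.
Hypothesis HN : uniformly_convex_norm s K N.

Lemma ucn_ge0 x : 0 <= N x.
Proof. exact: le_trans (ucn_ge HN x). Qed.

Lemma ucnN x : N (- x) = N x.
Proof. by rewrite -scaleN1r (ucnZ HN) normrN1 mul1r. Qed.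

Lemma ucnB x y : N x - N y <= N (x - y).
Proof. by rewrite lerBlDr -{1}(subrK y x); exact: (ucnD HN). Qed.

Lemma ucn_continuous : continuous N.
Proof.
have H x y : `|N x - N y| <= K * `|x - y|.
  apply: le_trans (ucn_le HN _); rewrite ler_norml ucnB andbT.
  by rewrite lerNl opprB -[leRHS]ucnN opprB ucnB.
move=> x; apply/cvgrPdist_lt => e e0.
have K1 : 0 < `|K| + 1 by rewrite ltr_wpDl.
near=> y; apply: le_lt_trans (H _ _) _.
have : `|x - y| < e / (`|K| + 1).
  by near: y; apply: cvgr_dist_lt; rewrite ?divr_gt0.
rewrite ltr_pdivlMr // => H1; apply: le_lt_trans H1.
rewrite mulrC; apply: ler_wpM2l => //.
by have := ler_norm K; lra.
Unshelve. all: by end_near. Qed.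

(** Hahn-Banach on a line: the slope is the supremum of the left difference quotients at x, and the
    triangle inequality puts each of them below every right difference quotient. *)
Lemma ucn_support x y : exists u : R, forall t : R, N x + u * t <= N (x + t *: y).
Proof.
pose S := [set r | exists2 v, 0 < v & r = (N x - N (x - v *: y)) / v].
have key t v : 0 < t -> 0 < v ->
    (N x - N (x - v *: y)) / v <= (N (x + t *: y) - N x) / t.
  move=> t0 v0; rewrite ler_pdivrMr // mulrAC ler_pdivlMr //.
  suff : (t + v) * N x <= v * N (x + t *: y) + t * N (x - v *: y) by lra.
  have tv : 0 <= t + v by rewrite addr_ge0 ?ltW.
  rewrite -{1}(ger0_norm tv) -(ucnZ HN).
  have -> : (t + v) *: x = v *: (x + t *: y) + t *: (x - v *: y).
    rewrite !scalerDr scalerN !scalerA addrACA -scalerDl [v + t]addrC.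
    by rewrite [v * t]mulrC subrr addr0.
  apply: le_trans (ucnD HN _ _) _.
  by rewrite !(ucnZ HN) !gtr0_norm.
have S1 : S !=set0 by exists ((N x - N (x - 1 *: y)) / 1); exists 1.
exists (sup S) => t; have [t0|t0|->] := ltgtP t 0; last first.
- by rewrite mulr0 addr0 scale0r addr0.
- suff : sup S <= (N (x + t *: y) - N x) / t by rewrite ler_pdivlMr //; lra.
  by apply: ge_sup => // _ [v v0 ->]; exact: key.
have t0' : 0 < - t by rewrite oppr_gt0.
suff : (N x - N (x - (- t) *: y)) / (- t) <= sup S.
  rewrite ler_pdivrMr // scaleNr opprK; lra.
apply: ub_le_sup; last by exists (- t).
exists ((N (x + 1 *: y) - N x) / 1) => _ [v v0 ->].
exact: key.
Qed.

Lemma ucn_powR_convex (p : R) : 1 < p -> exists2 c : R, 0 < c & forall x y,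
  exists k : R, forall t : R,
    N x `^ p + k * t + c * gain p s (N x) (`|t| * `|y|) <= N (x + t *: y) `^ p.
Proof.
move: (s2) => s2' p1; have s0 : 0 < s by lra.
have k0 : 0 < 2 * 2^-1 `^ s :> R by rewrite mulr_gt0 // powR_gt0 // invr_gt0.
have [c c0 Hc] := gain_transfer p1 s2 k0.
exists c => // x y; have [u Hu] := ucn_support x y.
exists (p * N x `^ (p - 1) * u) => t.
rewrite -[_ * u * t]mulrA; apply: Hc => //; rewrite ?ucn_ge0 ?mulr_ge0 //.
(* The midpoint inequality for the segment from x to x + t y, whose centre is z, bounds N(x + t y)^s
   below by 2 N(z)^s - N(x)^s plus the gain. The tangent of the s-th power at N(x) and the
   supporting line at z then bring in the slope. The constant 2 * 2^(-s) arises because the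
   half-length is |t| |y| / 2. *)
- pose z := x + (t / 2) *: y.
  have := ucn_midpoint HN z ((t / 2) *: y).
  have -> : z + (t / 2) *: y = x + t *: y.
    by rewrite /z -addrA -scalerDl; congr (_ + _ *: _); field.
  have -> : z - (t / 2) *: y = x by rewrite /z addrK.
  have -> : `|(t / 2) *: y| `^ s = 2^-1 `^ s * (`|t| * `|y|) `^ s.
    rewrite -powRM ?mulr_ge0 // normrZ normrM; congr (_ `^ _).
    by rewrite [ `|2^-1| ]ger0_norm //; ring.
  have s1 : 1 <= s by lra.
  have := powR_tangent s1 (ucn_ge0 x) (ucn_ge0 z).
  have Hz : u * (t / 2) <= N z - N x by have := Hu (t / 2); rewrite -/z; lra.
  have q0 : 0 <= s * N x `^ (s - 1) by rewrite mulr_ge0 ?powR_ge0 //; lra.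
  by have := ler_wpM2l q0 Hz; lra.
- rewrite -normrZ; apply: le_trans (ucn_ge HN _) _.
  have -> : t *: y = (x + t *: y) - x by rewrite addrAC subrr add0r.
  apply: le_trans (ucnD HN _ _) _.
  by rewrite ucnN [x + (_ - x)]addrC subrK addrC.
Qed.

Lemma ucn_poisson_convex (p : R) : 1 < p -> exists2 c : R, 0 < c & forall (l : R) x y,
  0 <= l <= 2^-1 ->
  ((N x `^ p + c * (l * gain p s (N x) `|y|))%:E <=
   \sum_(m <oo) (poisson_weight l m * N (x + (m%:R - l) *: y) `^ p)%:E)%E.
Proof.
move: (s2) => s2' p1; have [c c0 Hc] := ucn_powR_convex p1.
have e0 : 0 < expR (- 2^-1 : R) by exact: expR_gt0.
have s0 : 0 < s by lra. have p0 : 0 < p by lra.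
have q0 : 0 < (2^-1 : R) `^ (p + s) by apply: powR_gt0; rewrite invr_gt0.
(* The first factor bounds exp(-l) in the one-jump probability, the second replaces (1 - l) y by y;
   both use l <= 1/2. *)
exists (c * (expR (- 2^-1) * 2^-1 `^ (p + s))); first by rewrite !mulr_gt0.
move=> l x y /[dup] l01 /andP[l0 l2]; have [k Hk] := Hc x y.
apply: le_trans (@poisson_weight_jensen _ l (fun t => N (x + t *: y) `^ p)
  (fun t => c * gain p s (N x) (`|t| * `|y|)) (N x `^ p) k l0 _ _ _ Hk).
- rewrite lee_fin; apply: lerD => //.
  have t1 : 2^-1 <= 1 - l <= 1 by apply/andP; split; lra.
  have tp : 0 <= 1 - l by lra.
  rewrite (ger0_norm tp) [leRHS]mulrCA.
  set G := gain _ _ _ `|y|.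
  have -> : c * (expR (- 2^-1) * 2^-1 `^ (p + s)) * (l * G)
     = c * ((expR (- 2^-1) * l) * (2^-1 `^ (p + s) * G)) by ring.
  apply: ler_wpM2l; first exact: ltW.
  apply: ler_pM.
  - by rewrite mulr_ge0 // ltW.
  - by rewrite mulr_ge0 ?gain_ge0 // ltW.
  - exact: poisson_weight1_ge.
  - exact: gain_scale_ge (ucn_ge0 x) (normr_ge0 y).
- exact: powR_ge0.
- by move=> t; rewrite mulr_ge0 ?gain_ge0 // ltW.
- by move=> t; exact: powR_ge0.
Qed.

(** The submartingale inequality of the norm itself, needed for Doob's inequality. It is convexity
    without gain, since at exponent 1 the supporting line is all there is. *)
Lemma ucn_poisson_convex1 (l : R) x y : 0 <= l ->
  ((N x)%:E <= \sum_(m <oo) (poisson_weight l m * N (x + (m%:R - l) *: y))%:E)%E.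
Proof.
move=> l0; have [u Hu] := ucn_support x y.
have := @poisson_weight_jensen _ l (fun t => N (x + t *: y)) (fun=> 0) (N x) u l0
  (ucn_ge0 x) (fun=> lexx _) (fun=> ucn_ge0 _).
rewrite mulr0 addr0; apply => t; rewrite addr0; exact: Hu.
Qed.

End pointwise_convexity.

(** * Independence of a Poisson random measure from its past *)

(** Both sides are finite measures in B that agree on a pi-system containing the whole space. *)
Lemma independent_sigma_algebra {R : realType} {d} {T : measurableType d}
    (P : probability T R) (G : set (set T)) (A : set T) :
  measurable A -> setI_closed G -> G setT -> G `<=` measurable ->
  (forall B, G B -> P (B `&` A) = (P A * P B)%E) ->
  forall B, <<s G >> B -> P (B `&` A) = (P A * P B)%E.
Proof.
move=> mA GI GT Gm GA B sB.
have PA0 : 0 <= fine (P A) by rewrite fine_ge0.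
have PAE : P A = (fine (P A))%:E by rewrite fineK // fin_num_measure.
have E C : P (C `&` A) = mrestr P mA C by [].
have E2 C : (P A * P C)%E = mscale (NngNum PA0) P C by rewrite /mscale /= -PAE.
rewrite E E2; apply: (@g_sigma_algebra_measure_unique _ R T G Gm (fun=> setT)) sB => //.
- by apply/seteqP; split => // x _; exists 0%N.
- by move=> C GC; have := GA _ GC; rewrite E E2.
- move=> _; apply: (@le_lt_trans _ _ (P setT)); last by rewrite probability_setT ltry.
  by apply: le_measure; rewrite ?inE //; exact: measurableI.
Qed.

Section poisson_independence.
Context {R : realType} {d d' : measure_display}.
Context {T : measurableType d} {E : measurableType d'}.
Variables (P : probability T R) (mu : {measure set E -> \bar R}) (N : R.-ker T ~> E).

(** Generators only; the sigma-algebra is [<<s past S >>]. It is indexed by a region of time and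
    space instead of a time, so that it can contain part of the cells of a time slice. *)
Definition past (S : set E) : set (set T) :=
  [set Z | exists H C, [/\ measurable H, H `<=` S, measurable C &
     Z = (fun w => N w H) @^-1` C]].

Lemma past_measurable S : past S `<=` measurable.
Proof.
move=> _ [H [C [mH _ mC ->]]]; rewrite -[X in measurable X]setTI.
exact: measurable_kernel.
Qed.

Lemma sigma_past_measurable S : <<s past S >> `<=` measurable.
Proof.
apply: smallest_sub; [exact: sigma_algebra_measurable|exact: past_measurable].
Qed.

Lemma past_subset S S' : S `<=` S' -> past S `<=` past S'.
Proof.
move=> SS _ [H [C [mH HS mC ->]]]; exists H, C; split=> //.
exact: subset_trans SS.
Qed.

(** The regions of the Venn diagram of the family H. A Poisson random measure is independent over
    disjoint sets only, and the sets that generate the past overlap. *)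
Definition atom n (H : 'I_n -> set E) (a : {set 'I_n}) : set E :=
  [set z | forall i, (z \in H i) = (i \in a)].

Lemma atom_measurable n (H : 'I_n -> set E) a :
  (forall i, measurable (H i)) -> measurable (atom H a).
Proof.
move=> mH.
have -> : atom H a = \bigcap_(i in setT) (if i \in a then H i else ~` H i).
  apply/seteqP; split => z /= za i.
    move=> _; case: ifP => ia; first by apply/set_mem; rewrite za.
    by move=> /mem_set; rewrite za ia.
  have := za i I; case: ifP => _ h; first by rewrite mem_set.
  by rewrite memNset.
apply: fin_bigcap_measurable; first exact: finite_finset.
by move=> i _; case: ifP => _ //; exact: measurableC.
Qed.

(* The slot of the empty set is free: atoms of the [H i] lying in their union are
   indexed by nonempty sets.  It carries [D]. *)
Definition atom_or n (H : 'I_n -> set E) (D : set E) (a : {set 'I_n}) : set E :=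
  if a == finset.set0 then D else atom H a.

Hypothesis HN : poisson_random_measure P mu N.

Section finite_family.
Variables (S D : set E) (n : nat) (H : 'I_n -> set E).
Hypotheses (mD : measurable D) (DS : D `&` S = set0).
Hypotheses (mH : forall i, measurable (H i)) (HS : forall i, H i `<=` S).
Let B := atom_or H D.

Let mB a : measurable (B a).
Proof. by rewrite /B /atom_or; case: ifP => _ //; exact: atom_measurable. Qed.

Let atomS a z : a != finset.set0 -> atom H a z -> S z.
Proof.
by case/set0Pn => i ia /(_ i); rewrite ia => /set_mem /HS.
Qed.

Let DSz z : D z -> S z -> False.
Proof. by move=> Dz Sz; have : (D `&` S) z by []; rewrite DS. Qed.

Let tB : trivIset setT B.
Proof.
move=> a b _ _ [z []]; rewrite /B /atom_or.
case: eqVneq => [->|a0]; case: eqVneq => [->|b0] //.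
- by move=> Dz /(atomS b0) /(DSz Dz).
- by move=> /(atomS a0) Sz Dz; case: (DSz Dz Sz).
- by move=> za zb; apply/setP => i; rewrite -za -zb.
Qed.

Let joint (C : {set 'I_n} -> set (\bar R)) : (forall a, measurable (C a)) ->
  P [set w | forall a, C a (N w (B a))] = (\prod_a P [set w | C a (N w (B a))])%E.
Proof.
move=> mC; case: HN => _ _ _ _ ind.
have := ind _ (fun k : 'I_#|{set 'I_n}| => B (enum_val k)) _ _
  (fun k => C (enum_val k)) _.
rewrite (reindex (fun k : 'I_#|{set 'I_n}| => enum_val k)) /=; last first.
  by exists enum_rank => a _; [exact: enum_valK|exact: enum_rankK].
move=> <- //; last first.
- by move=> i j _ _ ij; apply: enum_val_inj; exact: tB ij.
congr (P _); apply/seteqP; split => w /= h k //.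
by rewrite -(enum_rankK k).
Qed.

Let rect : set (set T) := [set Z | exists C : {set 'I_n} -> set (\bar R),
  [/\ forall a, measurable (C a), C finset.set0 = setT &
      Z = [set w | forall a, C a (N w (B a))]]].

Let mNB a (C : set (\bar R)) : measurable C -> measurable [set w | C (N w (B a))].
Proof.
move=> mC; rewrite -[X in measurable X]setTI.
exact: (measurable_kernel N _ (mB a)).
Qed.

Let rect_measurable : rect `<=` measurable.
Proof.
move=> _ [C [mC _ ->]].
have -> : [set w | forall a, C a (N w (B a))]
    = \bigcap_(a in setT) [set w | C a (N w (B a))].
  by apply/seteqP; split => w /= h a; [move=> _; exact: h|exact: h].
apply: fin_bigcap_measurable; first exact: finite_finset.
by move=> a _; exact: mNB.
Qed.

(** The events in [rect] constrain the counts of the atoms and leave that of D free. They form a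
    pi-system on which the claim is independence over disjoint sets, and they generate the counts of
    the H_i. *)
Lemma independent_finite_family (m : nat) (C : 'I_n -> set (\bar R)) :
  (forall i, measurable (C i)) ->
  P ([set w | forall i, C i (N w (H i))] `&` [set w | N w D = m%:R%:E]) =
  (P [set w | N w D = m%:R%:E] * P [set w | forall i, C i (N w (H i))])%E.
Proof.
move=> mC; set A := [set w | N w D = m%:R%:E].
have BD : B finset.set0 = D by rewrite /B /atom_or eqxx.
have mA : measurable A.
  have -> : A = [set w | [set m%:R%:E : \bar R] (N w (B finset.set0))] by rewrite BD.
  by apply: mNB; exact: emeasurable_set1.
apply: (@independent_sigma_algebra _ _ _ P rect) => //.
- move=> _ _ [C1 [m1 e1 ->]] [C2 [m2 e2 ->]].
  exists (fun a => C1 a `&` C2 a); split.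
  + by move=> a; exact: measurableI.
  + by rewrite e1 e2 setTI.
  + by apply/seteqP; split => w /=; [move=> [h1 h2] a; split|move=> h; split=> a; case: (h a)].
- by exists (fun=> setT); split => //; apply/seteqP; split.
- move=> _ [C1 [m1 e1 ->]].
  pose C2 a := if a == finset.set0 then [set m%:R%:E : \bar R] else C1 a.
  have m2 a : measurable (C2 a).
    by rewrite /C2; case: ifP => _; [exact: emeasurable_set1|exact: m1].
  have -> : [set w | forall a, C1 a (N w (B a))] `&` A
      = [set w | forall a, C2 a (N w (B a))].
    apply/seteqP; split => w /=.
      by move=> [h Aw] a; rewrite /C2; case: eqVneq => [->|_] //; rewrite BD.
    move=> h; split => [a|].
      by have := h a; rewrite /C2; case: eqVneq => [->|_] //; rewrite e1.
    by have := h finset.set0; rewrite /C2 eqxx BD.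
  rewrite !joint // (bigD1 finset.set0) //= [in RHS](bigD1 finset.set0) //=.
  rewrite e1 [in RHS](_ : [set w | _] = setT) ?probability_setT ?mul1e; last first.
    by apply/seteqP; split.
  congr (_ * _)%E; first by rewrite /C2 eqxx BD.
  by apply: eq_bigr => a a0; rewrite /C2 (negbTE a0).
(* N(H_i) is the finite sum of the counts of the atoms that make up H_i. *)
have mrect i : measurable_fun (setT : set (g_sigma_algebraType rect)) (fun w => N w (H i)).
  have HE : H i = \bigcup_(a in [set a : {set 'I_n} | i \in a]) B a.
    apply/seteqP; split => z.
      move=> Hz; exists [set j | z \in H j]%SET.
        by rewrite /= finset.inE mem_set.
      rewrite /B /atom_or ifF; last first.
        by apply/negP => /eqP/setP/(_ i); rewrite finset.inE mem_set // finset.inE.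
      by move=> j; rewrite finset.inE.
    move=> [a /= ia]; rewrite /B /atom_or ifF; last first.
      by apply/negP => /eqP a0; move: ia; rewrite a0 finset.inE.
    by move=> /(_ i); rewrite ia => /set_mem.
  have -> : (fun w => N w (H i)) =
      (fun w => \sum_(a \in [set a : {set 'I_n} | i \in a]) N w (B a))%E.
    apply/funext => w; rewrite HE measure_fin_bigcup //.
      exact: finite_finset.
    exact: sub_trivIset tB.
  under eq_fun do rewrite fsbig_mkcond.
  apply: emeasurable_fsum; first exact: finite_finset.
  move=> a; have [aD|aD] := boolP (a \in [set a : {set 'I_n} | i \in a]); last first.
    by under eq_fun do rewrite patchE (negbTE aD); exact: measurable_cst.
  under eq_fun do rewrite patchE aD.
  move: aD; rewrite inE /= => ia _ C1 mC1; rewrite setTI; apply: sub_sigma_algebra.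
  have a0 : a != finset.set0 by apply/set0Pn; exists i.
  exists (fun b => if b == a then C1 else setT); split.
  - by move=> b; case: ifP.
  - by rewrite eq_sym (negbTE a0).
  - apply/seteqP; split => w /=; last by move=> /(_ a); rewrite eqxx.
    by move=> h b; case: eqVneq => [->|].
have -> : [set w | forall i, C i (N w (H i))] =
    \bigcap_(i in setT) (fun w => N w (H i)) @^-1` C i.
  by apply/seteqP; split => w /= h i; [move=> _; exact: h|exact: h].
apply: (@fin_bigcap_measurable _ (g_sigma_algebraType rect)).
  exact: finite_finset.
by move=> i _; have := mrect i measurableT _ (mC i); rewrite setTI.
Qed.

End finite_family.

(** A second passage through a pi-system, now the events that involve finitely many counts; an
    intersection of two of them concatenates the two families. *)
Lemma past_independent (S D : set E) (m : nat) (Z : set T) :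
  measurable D -> D `&` S = set0 -> <<s past S>> Z ->
  P (Z `&` [set w | N w D = m%:R%:E]) = (P [set w | N w D = m%:R%:E] * P Z)%E.
Proof.
move=> mD DS sZ.
pose G : set (set T) := [set Z | exists n (H : 'I_n -> set E) (C : 'I_n -> set (\bar R)),
  [/\ forall i, measurable (H i), forall i, H i `<=` S, forall i, measurable (C i) &
   Z = [set w | forall i, C i (N w (H i))]]].
have mA : measurable [set w | N w D = m%:R%:E].
  rewrite -[X in measurable X]setTI.
  exact: (measurable_kernel N _ mD _ _ (emeasurable_set1 m%:R%:E)).
apply: (@independent_sigma_algebra _ _ _ P G) => //.
- move=> _ _ [n1 [H1 [C1 [mH1 HS1 mC1 ->]]]] [n2 [H2 [C2 [mH2 HS2 mC2 ->]]]].
  exists (n1 + n2)%N, (fun i => match fintype.split i with inl j => H1 j | inr j => H2 j end).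
  exists (fun i => match fintype.split i with inl j => C1 j | inr j => C2 j end).
  split; try by move=> i; case: (@fintype.split n1 n2 i).
  apply/seteqP; split => w /=.
    by move=> [h1 h2] i; case: (@fintype.split n1 n2 i).
  move=> h; split => i.
    by have := h (lshift _ i); rewrite -[lshift _ i]/(unsplit (inl i)) unsplitK.
  by have := h (rshift _ i); rewrite -[rshift _ i]/(unsplit (inr i)) unsplitK.
- exists 0%N, (fun=> set0), (fun=> set0); split => //; first by move=> _ z.
  by apply/seteqP; split => // w _ [].
- move=> _ [n [H [C [mH HS mC ->]]]].
  have -> : [set w | forall i, C i (N w (H i))]
      = \bigcap_(i in setT) ((fun w => N w (H i)) @^-1` C i).
    by apply/seteqP; split => w /= h i; [move=> _; exact: h|exact: h].
  apply: fin_bigcap_measurable; first exact: finite_finset.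
  by move=> i _; apply: past_measurable; exists (H i), (C i).
- move=> _ [n [H [C [mH HS mC ->]]]].
  exact: (independent_finite_family mD DS mH HS).
- apply: sZ; split; first exact: smallest_sigma_algebra.
  move=> _ [H [C [mH HS mC ->]]]; apply: sub_sigma_algebra.
  exists 1%N, (fun=> H), (fun=> C); split => //.
  by apply/seteqP; split => w /=; [move=> ? _|move=> /(_ ord0)].
Qed.

End poisson_independence.

(** * Strong measurability *)

Section strong_measurability_facts.
Context {R : realType}.
Implicit Types (d : measure_display).

Lemma is_simple_cst {d} {T : measurableType d} {X : normedModType R} (x : X) :
  is_simple (@measurable d T) (cst x).
Proof.
split; first by apply: sub_finite_set (finite_set1 x) => _ [w _ <-].
move=> y; rewrite preimage_cst; case: ifP => _ //.
Qed.

Lemma is_simple_op {d} {T : measurableType d} {X Y Z : normedModType R}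
    (h : X -> Y -> Z) (f : T -> X) (g : T -> Y) :
  is_simple measurable f -> is_simple measurable g ->
  is_simple measurable (fun w => h (f w) (g w)).
Proof.
move=> [ff mf] [fg mg]; split.
  apply: (@sub_finite_set _ _ [set h x y | x in range f & y in range g]).
    by move=> _ [w _ <-]; exists (f w) => //; exists (g w).
  exact: finite_image2.
move=> z; have -> : (fun w => h (f w) (g w)) @^-1` [set z] =
    \bigcup_(x in range f) \bigcup_(y in range g)
      (if `[< h x y = z >] then f @^-1` [set x] `&` g @^-1` [set y] else set0).
  apply/seteqP; split => w /=.
    move=> hz; exists (f w) => //; exists (g w) => //.
    by case: asboolP.
  by move=> [x _ [y _]]; case: asboolP => // hz [/= -> ->].
apply: fin_bigcup_measurable => // x _; apply: fin_bigcup_measurable => // y _.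
by case: asboolP => // _; apply: measurableI; [exact: mf|exact: mg].
Qed.

Lemma is_simple_measurable {d} {T : measurableType d} {X : normedModType R}
    (psi : X -> R) (f : T -> X) :
  is_simple measurable f -> measurable_fun setT (fun w => psi (f w)).
Proof.
move=> [ff mf] _ C mC; rewrite setTI.
have -> : (fun w => psi (f w)) @^-1` C =
    \bigcup_(x in range f) (if `[< C (psi x) >] then f @^-1` [set x] else set0).
  apply/seteqP; split => w /=.
    by move=> hC; exists (f w) => //; case: asboolP.
  by move=> [x _]; case: asboolP => // hz /= ->.
by apply: fin_bigcup_measurable => // x _; case: asboolP.
Qed.

Section closure.
Import HBSimple.
Context {d} {T : measurableType d} {X : normedModType R}.
Implicit Types f g : T -> X.

Lemma strongly_measurable_cst (x : X) :
  strongly_measurable (@measurable d T) (cst x).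
Proof.
exists (fun=> cst x); split; first by move=> _; exact: is_simple_cst.
by move=> w; exact: cvg_cst.
Qed.

Lemma strongly_measurableD f g : strongly_measurable measurable f ->
  strongly_measurable measurable g ->
  strongly_measurable measurable (fun w => f w + g w).
Proof.
move=> [u [su uf]] [v [sv vg]]; exists (fun n w => u n w + v n w); split.
  by move=> n; exact: is_simple_op.
by move=> w; apply: cvgD; [exact: uf|exact: vg].
Qed.

Lemma strongly_measurable_sum n (f : 'I_n -> T -> X) :
  (forall i, strongly_measurable measurable (f i)) ->
  strongly_measurable measurable (fun w => \sum_(i < n) f i w).
Proof.
elim: n f => [|n IH] f mf.
  by under eq_fun do rewrite big_ord0; exact: strongly_measurable_cst.
under eq_fun do rewrite big_ord_recl.
by apply: strongly_measurableD => //; exact: IH.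
Qed.

Lemma strongly_measurableZ (r : T -> R) f : measurable_fun setT r ->
  strongly_measurable measurable f ->
  strongly_measurable measurable (fun w => r w *: f w).
Proof.
move=> mr [u [su uf]].
have /measurable_EFinP mr' := mr.
have [v vr] := approximation_sfun measurableT mr'.
exists (fun n w => v n w *: u n w); split.
  move=> n; apply: (@is_simple_op _ _ R^o) => //.
move=> w; apply: cvgZ; last exact: uf.
by have /fine_cvgP[_] := vr w I.
Qed.

Lemma strongly_measurable_continuous (psi : X -> R) f : continuous psi ->
  strongly_measurable measurable f -> measurable_fun setT (fun w => psi (f w)).
Proof.
move=> cpsi [u [su uf]].
apply: (@measurable_fun_cvg _ _ _ setT (fun n w => psi (u n w))) => //.
  by move=> n; exact: is_simple_measurable.
by move=> w _; apply: continuous_cvg => //; exact: cpsi.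
Qed.

Lemma strongly_measurable_norm f : strongly_measurable measurable f ->
  measurable_fun setT (fun w => `|f w|).
Proof. by apply: strongly_measurable_continuous => x; exact: norm_continuous. Qed.

Lemma strongly_measurable_comp {d'} {T' : measurableType d'} (g : T' -> T) f :
  measurable_fun setT g -> strongly_measurable measurable f ->
  strongly_measurable measurable (f \o g).
Proof.
move=> mg [u [su uf]]; exists (fun n => u n \o g); split; last by move=> w; exact: uf.
move=> n; have [fu mu] := su n; split.
  by apply: sub_finite_set fu => _ [w _ <-]; exists (g w).
by move=> x; have := mg measurableT _ (mu x); rewrite setTI.
Qed.

End closure.
End strong_measurability_facts.

(** * Integration over an independent Poisson count *)

Section independence_integral.
Context {R : realType} {d} {T : measurableType d}.
Variables (P : probability T R) (G : set (set T)).
Hypothesis Gm : <<s G>> `<=` measurable.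
Local Open Scope ereal_scope.

Lemma sub_measurable_fun d' (Y : measurableType d') (f : T -> Y) :
  measurable_fun (setT : set (g_sigma_algebraType G)) f ->
  measurable_fun (setT : set T) f.
Proof.
move=> mf _ C mC; have := mf measurableT _ mC.
by rewrite !setTI; exact: Gm.
Qed.

Lemma integral_independent (A : set T) (f : T -> \bar R) : measurable A ->
  (forall B, <<s G>> B -> P (B `&` A) = P A * P B) ->
  measurable_fun (setT : set (g_sigma_algebraType G)) f -> (forall w, 0 <= f w) ->
  \int[P]_(w in A) f w = P A * \int[P]_w f w.
Proof.
move=> mA ind mf f0; have mfT := sub_measurable_fun mf.
have PA0 : (0 <= fine (P A))%R by rewrite fine_ge0.
have PAE : P A = (fine (P A))%:E by rewrite fineK // fin_num_measure.
(* The identity onto the coarser sigma-algebra: pushing forward along it restricts a measure to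
   [<<s G>>], where P(B & A), the mass of the intersection, and P(A) P(B) coincide as measures in
   B. *)
pose i : T -> g_sigma_algebraType G := id.
have mi : measurable_fun setT i.
  by move=> _ C mC; rewrite setTI; exact: Gm.
transitivity (\int[mrestr P mA]_w f w).
  rewrite -[in RHS](setUv A) ge0_integral_setU //; last 3 first.
  - exact: measurableC.
  - by rewrite setUv.
  - by rewrite disj_set2E setICr.
  rewrite [X in _ + X](_ : _ = 0) ?adde0; last first.
    apply: null_set_integral; first exact: measurableC.
      exact: measurable_funTS.
    by rewrite /= /mrestr setICl measure0.
  apply: eq_measure_integral => B mB BA.
  by rewrite /= /mrestr setIidl.
have f0' : {in (setT : set (g_sigma_algebraType G)), forall w, 0 <= f w} by [].
have E1 := ge0_integral_pushforward mi (mrestr P mA) measurableT mf f0'.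
have E2 := ge0_integral_pushforward mi (mscale (NngNum PA0) P) measurableT mf f0'.
transitivity (\int[mscale (NngNum PA0) P]_w f w).
  move: E1 E2; rewrite !preimage_setT => <- <-.
  apply: eq_measure_integral => B mB _.
  by rewrite /= /pushforward /mscale /mrestr /= -PAE; exact: ind.
by rewrite ge0_integral_mscale //= -PAE.
Qed.

(** This plays the part of conditioning on G: on each event {xi = m} the integrand is G-measurable
    and independence factors the integral. Points where xi is no natural number are dropped, which
    is harmless for a lower bound of the integral of Phi. *)
Lemma integral_independent_le (xi : T -> \bar R) (pi : nat -> R)
    (Psi : nat -> T -> R) (Phi L : T -> R) :
  measurable_fun (setT : set T) xi ->
  (forall m, (0 <= pi m)%R) ->
  (forall m, P [set w | xi w = m%:R%:E] = (pi m)%:E) ->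
  (forall m B, <<s G>> B -> P (B `&` [set w | xi w = m%:R%:E]) =
     P [set w | xi w = m%:R%:E] * P B) ->
  (forall m, measurable_fun (setT : set (g_sigma_algebraType G)) (Psi m)) ->
  (forall m w, (0 <= Psi m w)%R) ->
  measurable_fun (setT : set T) Phi -> (forall w, (0 <= Phi w)%R) ->
  (forall m w, xi w = m%:R%:E -> Phi w = Psi m w) ->
  measurable_fun (setT : set T) L -> (forall w, (0 <= L w)%R) ->
  (forall w, (L w)%:E <= \sum_(m <oo) (pi m * Psi m w)%:E) ->
  \int[P]_w (L w)%:E <= \int[P]_w (Phi w)%:E.
Proof.
move=> mxi pi0 Ppi ind mPsi Psi0 mPhi Phi0 PhiPsi mL L0 HL.
pose A m := [set w | xi w = m%:R%:E].
have mA m : measurable (A m).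
  have := mxi measurableT _ (emeasurable_set1 m%:R%:E).
  by rewrite setTI.
have mPsiT m : measurable_fun (setT : set T) (fun w => (Psi m w)%:E).
  by apply/measurable_EFinP; exact: sub_measurable_fun.
have tA : trivIset setT A.
  by move=> m n _ _ [w [/= Am]]; rewrite /A /= Am => -[] /eqP; rewrite eqr_nat => /eqP.
have mPhiE : measurable_fun (setT : set T) (fun w => (Phi w)%:E) by exact/measurable_EFinP.
have mLE : measurable_fun (setT : set T) (fun w => (L w)%:E) by exact/measurable_EFinP.
apply: (@le_trans _ _ (\int[P]_(w in \bigcup_m A m) (Phi w)%:E)); last first.
  apply: ge0_subset_integral => //; first exact: bigcup_measurable.
  by move=> w _; rewrite lee_fin.
rewrite ge0_integral_bigcup //; last 2 first.
- exact: measurable_funTS.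
- by move=> w _; rewrite lee_fin.
apply: (@le_trans _ _ (\int[P]_w (\sum_(m <oo) (pi m * Psi m w)%:E))).
  apply: ge0_le_integral => //.
  - by move=> w _; rewrite lee_fin.
  - apply: ge0_emeasurable_sum => [m w _ _|m _]; first by rewrite lee_fin mulr_ge0.
    by under eq_fun do rewrite EFinM; exact: measurable_funeM.
rewrite integral_nneseries //; last 2 first.
- by move=> m; under eq_fun do rewrite EFinM; exact: measurable_funeM.
- by move=> m w _; rewrite lee_fin mulr_ge0.
apply: lee_nneseries => [m _ _|m _].
  by apply: integral_ge0 => w _; rewrite lee_fin mulr_ge0.
rewrite [leRHS](_ : _ = \int[P]_(w in A m) (Psi m w)%:E); last first.
  by apply: eq_integral => w; rewrite inE => Aw; rewrite (PhiPsi m).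
rewrite integral_independent //; last 3 first.
- exact: ind.
- exact/measurable_EFinP.
- by move=> w; rewrite lee_fin.
rewrite Ppi -ge0_integralZl //; last 2 first.
- by move=> w _; rewrite lee_fin.
- by rewrite lee_fin.
Qed.

End independence_integral.

Section nonnegative_integrals.
Context {R : realType} {d} {T : measurableType d} (mu : {measure set T -> \bar R}).
Implicit Types f g : T -> R.
Local Open Scope ereal_scope.

Lemma integral_EFin_le f g : measurable_fun setT f -> measurable_fun setT g ->
  (forall w, (0 <= f w)%R) -> (forall w, (f w <= g w)%R) ->
  \int[mu]_w (f w)%:E <= \int[mu]_w (g w)%:E.
Proof.
move=> /measurable_EFinP mf /measurable_EFinP mg f0 fg.
by apply: ge0_le_integral => // w _; rewrite lee_fin.
Qed.

Lemma integral_EFinD f g : measurable_fun setT f -> measurable_fun setT g ->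
  (forall w, (0 <= f w)%R) -> (forall w, (0 <= g w)%R) ->
  \int[mu]_w (f w + g w)%:E = \int[mu]_w (f w)%:E + \int[mu]_w (g w)%:E.
Proof.
move=> /measurable_EFinP mf /measurable_EFinP mg f0 g0.
rewrite -ge0_integralD //; first by move=> w _; rewrite lee_fin.
by move=> w _; rewrite lee_fin.
Qed.

Lemma integral_EFinZ (c : R) f : (0 <= c)%R -> measurable_fun setT f ->
  (forall w, (0 <= f w)%R) ->
  \int[mu]_w (c * f w)%:E = c%:E * \int[mu]_w (f w)%:E.
Proof.
move=> c0 /measurable_EFinP mf f0.
by rewrite -ge0_integralZl //; move=> w _; rewrite lee_fin.
Qed.

Lemma integral_EFin_ge0 f : (forall w, (0 <= f w)%R) -> 0 <= \int[mu]_w (f w)%:E.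
Proof. by move=> f0; apply: integral_ge0 => w _; rewrite lee_fin. Qed.

End nonnegative_integrals.

Lemma ereal_absorb {R : realType} (x y : \bar R) :
  (0 <= x -> x < +oo -> x <= (2^-1)%:E * x + y -> x <= 2%:E * y)%E.
Proof.
case: x => [x| |] //; case: y => [y| |] //.
- by move=> _ _; rewrite !lee_fin; lra.
- by move=> _ _ _; rewrite gt0_muley ?leey // lte_fin.
Qed.

(** * Scalar inequalities for absorption and for Doob's maximal inequality *)

Section young.
Context {R : realType}.
Implicit Types a b r e : R.

(** Either b <= e a, and the first term suffices, or a < b / e, and the second does. *)
Lemma young_absorb e r : 0 < e -> 1 <= r -> forall a b, 0 <= a -> 0 <= b ->
  a `^ (r - 1) * b <= e * a `^ r + e^-1 `^ (r - 1) * b `^ r.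
Proof.
move=> e0 r1 a b a0 b0; have r0 : 0 < r by lra.
have eV : 0 <= e^-1 by rewrite invr_ge0 ltW.
have [bea|eab] := leP b (e * a).
  apply: (@le_trans _ _ (e * a `^ r)).
    rewrite -(mulr_powRB1 a0 r0) mulrA [leRHS]mulrC.
    by apply: ler_wpM2l => //; exact: powR_ge0.
  by rewrite lerDl mulr_ge0 ?powR_ge0.
apply: (@le_trans _ _ (e^-1 `^ (r - 1) * b `^ r)).
  rewrite -(mulr_powRB1 b0 r0) mulrA [leRHS]mulrAC -powRM //.
  apply: ler_wpM2r => //; apply: ler_powRl => //; first lra.
  by rewrite mulrC ler_pdivlMr // mulrC ltW.
by rewrite lerDr mulr_ge0 ?powR_ge0 // ltW.
Qed.

(** Weighted geometric means are at most the maximum, hence at most the sum. *)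
Lemma powR_weighted_le r a b : 0 <= r <= 1 -> 0 <= a -> 0 <= b ->
  a `^ (1 - r) * b `^ r <= a + b.
Proof.
move=> /andP[r0 r1] a0 b0.
pose m := Num.max a b.
have am : a <= m by rewrite le_max lexx.
have bm : b <= m by rewrite le_max lexx orbT.
have m0 : 0 <= m by exact: le_trans am.
apply: (@le_trans _ _ (m `^ (1 - r) * m `^ r)).
  by apply: ler_pM; rewrite ?powR_ge0 //; apply: ler_powRl => //; lra.
have -> : m `^ (1 - r) * m `^ r = m.
  by rewrite -powRD ?subrK ?oner_eq0 // powRr1.
by rewrite /m ge_max lerDl lerDr a0 b0.
Qed.

(** One step of the pathwise Doob inequality, with a the running maximum and b the new value. If b
    <= a the two sides are equal; otherwise, multiplied by p - 1, it is the tangent inequality for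
    the p-th power at a. *)
Lemma doob_pointwise p a b : 1 < p -> 0 <= a -> 0 <= b ->
  let m := Num.max a b in
  m `^ p + p / (p - 1) * (a `^ (p - 1) * b)
  <= a `^ p + p / (p - 1) * (m `^ (p - 1) * b).
Proof.
move=> p1 a0 b0 /=; have p0 : 0 < p by lra. have pB : 0 < p - 1 by lra.
have [ba|ab] := leP b a; first by [].
have T := powR_tangent (ltW p1) a0 b0.
rewrite [b `^ (p - 1) * b]mulrC mulr_powRB1 //.
have E : a `^ (p - 1) * a = a `^ p by rewrite mulrC mulr_powRB1.
rewrite -(ler_pM2l pB) !mulrDr !mulrA.
have -> : (p - 1) * p / (p - 1) = p by field; lra.
have -> : p * a `^ (p - 1) * b
    = p * a `^ (p - 1) * (b - a) + p * a `^ p by rewrite -E; ring.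
lra.
Qed.

End young.

Section measurable_powR.
Context {R : realType} {d} {T : measurableType d}.
Implicit Types h : T -> R.

Lemma measurable_fun_powR h (p : R) : measurable_fun setT h ->
  measurable_fun setT (fun w => h w `^ p).
Proof.
by move=> mh; apply: (@measurableT_comp _ _ _ _ _ _ (fun x : R => x `^ p)).
Qed.

Lemma measurable_gain (p s : R) (a b : T -> R) : measurable_fun setT a ->
  measurable_fun setT b -> measurable_fun setT (fun w => gain p s (a w) (b w)).
Proof.
move=> ma mb; rewrite /gain; case: (p < s); last exact: measurable_fun_powR.
by apply: measurable_funM; apply: measurable_fun_powR => //; exact: measurable_funD.
Qed.

Lemma measurable_funMl h (c : R) : measurable_fun setT h ->
  measurable_fun setT (fun w => c * h w).
Proof. by move=> mh; apply: measurable_funM => //; exact: measurable_cst. Qed.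

End measurable_powR.

(** * Sums over adapted cells *)

Lemma strongly_measurable_sub {R : realType} {T : Type} {X : normedModType R}
    (S S' : set (set T)) (f : T -> X) :
  S `<=` S' -> strongly_measurable S f -> strongly_measurable S' f.
Proof.
move=> SS [u [su uf]]; exists u; split=> // n.
by have [fu mu] := su n; split=> // x; exact/SS/mu.
Qed.

(** S k is the region revealed before cell k: it misses D k, and S k.+1 contains D k. The
    coefficient y k may depend on all counts inside S k, so several cells can share a time slice. *)
Record cell_system {R : realType} {d d' : measure_display} {T : measurableType d}
    {E : measurableType d'} {X : normedModType R} (mu : {measure set E -> \bar R})
    (N : R.-ker T ~> E) (n : nat) (D S : nat -> set E) (y : nat -> T -> X) : Prop := {
  cs_measurable : forall k, (k < n)%N -> measurable (D k);
  cs_disjoint : forall k, (k < n)%N -> D k `&` S k = set0;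
  cs_increasing : forall k, (k < n)%N -> S k `<=` S k.+1;
  cs_next : forall k, (k < n)%N -> D k `<=` S k.+1;
  cs_finite : forall k, (k < n)%N -> (mu (D k) < +oo)%E;
  cs_half : forall k, (k < n)%N -> fine (mu (D k)) <= 2^-1;
  cs_adapted : forall k, (k < n)%N ->
    strongly_measurable (<<s past N (S k) >>) (y k) }.

Section cells.
Context {R : realType} {d d' : measure_display}.
Context {T : measurableType d} {E : measurableType d'} {X : normedModType R}.
Variables (P : probability T R) (mu : {measure set E -> \bar R}) (N : R.-ker T ~> E).
Hypothesis HN : poisson_random_measure P mu N.
Variables (s K : R) (Nm : X -> R).
Hypothesis s2 : 2 <= s.
Hypothesis HNm : uniformly_convex_norm s K Nm.
Variables (n : nat) (D S : nat -> set E) (y : nat -> T -> X).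
Hypothesis HC : cell_system mu N n D S y.

Local Notation TS k := (g_sigma_algebraType (past N (S k))).
Local Notation meas k := (measurable_fun (setT : set (TS k))).

Definition cell_sum (k : nat) (w : T) : X :=
  \sum_(i < k) compensated mu N (D i) w *: y i w.

Local Notation lam k := (fine (mu (D k))).
Local Notation Ex h := (\int[P]_w (h w)%:E)%E.

Lemma cell_lam_ge0 k : 0 <= lam k.
Proof. by rewrite fine_ge0. Qed.

Lemma past_increasing i k : (i <= k <= n)%N -> S i `<=` S k.
Proof.
move=> /andP[]; elim: k => [|k IH]; first by rewrite leqn0 => /eqP -> _ z.
rewrite leq_eqVlt => /predU1P[-> _ z|] //.
rewrite ltnS => ik kn; apply: subset_trans (cs_increasing HC kn).
by apply: IH => //; exact: ltnW.
Qed.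

Lemma sigma_past_increasing i k : (i <= k <= n)%N ->
  <<s past N (S i) >> `<=` <<s past N (S k) >>.
Proof.
move=> ik; apply: smallest_sub; first exact: smallest_sigma_algebra.
move=> Z /(past_subset (past_increasing ik)); exact: sub_sigma_algebra.
Qed.

Lemma meas_increasing i k {dY} {Y : measurableType dY} (h : T -> Y) :
  (i <= k <= n)%N -> meas i h -> meas k h.
Proof.
move=> ik mh _ C mC; have := mh measurableT _ mC; rewrite !setTI.
exact: sigma_past_increasing.
Qed.

Lemma meas_sub (S0 : set E) {dY} {Y : measurableType dY} (h : T -> Y) :
  measurable_fun (setT : set (g_sigma_algebraType (past N S0))) h ->
  measurable_fun (setT : set T) h.
Proof. exact/sub_measurable_fun/sigma_past_measurable. Qed.

Lemma strongly_measurable_cell i k : (i <= k <= n)%N -> (i < n)%N ->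
  strongly_measurable (@measurable _ (TS k)) (y i).
Proof.
move=> ik i_n; apply: strongly_measurable_sub (cs_adapted HC i_n).
exact: sigma_past_increasing.
Qed.

Lemma meas_count i k : (i < k <= n)%N -> meas k (fun w => N w (D i)).
Proof.
move=> /andP[ik kn] _ C mC; rewrite setTI; apply: sub_sigma_algebra.
have i_n := leq_trans ik kn.
exists (D i), C; split=> //; first exact: (cs_measurable HC).
apply: subset_trans (cs_next HC i_n) _; apply: past_increasing.
by rewrite ik kn.
Qed.

Lemma meas_compensated i k : (i < k <= n)%N -> meas k (compensated mu N (D i)).
Proof.
move=> ik; apply: measurable_funB; last exact: measurable_cst.
by apply: measurableT_comp; [exact: fine_measurable|exact: meas_count].
Qed.

Lemma strongly_measurable_cell_sum k : (k <= n)%N ->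
  strongly_measurable (@measurable _ (TS k)) (cell_sum k).
Proof.
move=> kn; apply: (@strongly_measurable_sum _ _ (TS k)) => i.
apply: (@strongly_measurableZ _ _ (TS k)).
  by apply: meas_compensated; rewrite ltn_ord.
apply: strongly_measurable_cell; first by rewrite (ltnW (ltn_ord i)).
exact: leq_trans (ltn_ord i) kn.
Qed.

Lemma meas_Nm k : (k <= n)%N -> meas k (fun w => Nm (cell_sum k w)).
Proof.
move=> kn; apply: (@strongly_measurable_continuous _ _ (TS k)).
  exact: ucn_continuous HNm.
exact: strongly_measurable_cell_sum.
Qed.

Lemma meas_norm_cell k : (k < n)%N -> meas k (fun w => `|y k w|).
Proof.
move=> kn; apply: (@strongly_measurable_norm _ _ (TS k)).
by apply: strongly_measurable_cell => //; rewrite leqnn ltnW.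
Qed.

(** Conditioning on the past of cell k, with a weight Z known beforehand. H and g are left general:
    H is a power of the norm when convexity gains are collected, and the norm itself with g = 0 for
    Doob's inequality. *)
Lemma cell_one_step k (Z : T -> R) (H : X -> R) (g : T -> R) : (k < n)%N ->
  meas k Z -> (forall w, 0 <= Z w) ->
  (forall j h, strongly_measurable (@measurable _ (TS j)) h ->
    meas j (fun w => H (h w))) -> (forall x, 0 <= H x) ->
  meas k g -> (forall w, 0 <= g w) ->
  (forall w, ((H (cell_sum k w) + g w)%:E <=
    \sum_(m <oo) (poisson_weight (lam k) m *
       H (cell_sum k w + (m%:R - lam k) *: y k w))%:E)%E) ->
  (Ex (fun w => Z w * (H (cell_sum k w) + g w)) <=
   Ex (fun w => Z w * H (cell_sum k.+1 w)))%E.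
Proof.
move=> kn mZ Z0 mH H0 mg g0 HL.
have mD := cs_measurable HC kn.
have kk : (k <= k.+1 <= n)%N by rewrite leqnSn.
have kn' := ltnW kn.
have mf := strongly_measurable_cell_sum kn'.
have my : strongly_measurable (@measurable _ (TS k)) (y k).
  by apply: strongly_measurable_cell; rewrite ?leqnn.
have mN : measurable_fun (setT : set T) (fun w => N w (D k)).
  exact: measurable_kernel.
have indk (m : nat) := @past_independent _ _ _ _ _ P mu N HN _ _ m _ mD (cs_disjoint HC kn).
case: HN => _ _ PN _ _.
apply: (@integral_independent_le _ _ _ P _ (@sigma_past_measurable _ _ _ _ _ N (S k))
  (fun w => N w (D k)) (poisson_weight (lam k))
  (fun m w => Z w * H (cell_sum k w + (m%:R - lam k) *: y k w))) => //.
- by move=> m; apply: poisson_weight_ge0; exact: cell_lam_ge0.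
- by move=> m; rewrite PN // (cs_finite HC kn).
- move=> m B sB; exact: indk.
- move=> m; apply: measurable_funM => //; apply: mH.
  apply: (@strongly_measurableD _ _ (TS k)) => //.
  exact: (@strongly_measurableZ _ _ (TS k)).
- by move=> m w; rewrite mulr_ge0.
- apply: measurable_funM; first exact: meas_sub mZ.
  apply: meas_sub (mH k.+1 _ _); exact: strongly_measurable_cell_sum.
- by move=> w; rewrite mulr_ge0.
- move=> m w Nm0; congr (_ * H _).
  by rewrite /cell_sum big_ord_recr /= /compensated Nm0.
- apply: (@meas_sub (S k)); apply: measurable_funM => //.
  by apply: measurable_funD => //; exact: mH.
- by move=> w; rewrite mulr_ge0 // addr_ge0.
- move=> w; rewrite EFinM.
  apply: (@le_trans _ _ ((Z w)%:E * (\sum_(m <oo) (poisson_weight (lam k) m *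
       H (cell_sum k w + (m%:R - lam k) *: y k w))%:E))%E).
    by apply: lee_wpmul2l; rewrite ?lee_fin.
  rewrite -nneseriesZl; last first.
    by move=> m _; rewrite lee_fin mulr_ge0 // poisson_weight_ge0 // cell_lam_ge0.
  by under eq_eseriesr do rewrite -EFinM mulrCA.
Qed.


Local Notation xn k := (fun w => Nm (cell_sum k w)).

Lemma meas_Nm_powR (p : R) j h : strongly_measurable (@measurable _ (TS j)) h ->
  meas j (fun w => Nm (h w) `^ p).
Proof.
move=> mh; apply: measurable_fun_powR; apply: (@strongly_measurable_continuous _ _ (TS j)) => //.
exact: ucn_continuous HNm.
Qed.

Section exponent.
Variables (p c : R).
Hypotheses (p1 : 1 < p) (c0 : 0 < c).
Hypothesis Hc : forall (l : R) x z, 0 <= l <= 2^-1 ->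
  ((Nm x `^ p + c * (l * gain p s (Nm x) `|z|))%:E <=
   \sum_(m <oo) (poisson_weight l m * Nm (x + (m%:R - l) *: z) `^ p)%:E)%E.

Local Notation gn k := (fun w => lam k * gain p s (xn k w) `|y k w|).

Lemma cell_gain_ge0 k w : 0 <= gn k w.
Proof. by rewrite mulr_ge0 ?cell_lam_ge0 ?gain_ge0. Qed.

Lemma meas_cell_gain k : (k < n)%N -> meas k (gn k).
Proof.
move=> kn; apply: measurable_funM; first exact: measurable_cst.
by apply: measurable_gain; [exact: meas_Nm (ltnW kn)|exact: meas_norm_cell].
Qed.

Lemma cell_step_gain k (Z : T -> R) : (k < n)%N -> meas k Z ->
  (forall w, 0 <= Z w) ->
  (Ex (fun w => Z w * (xn k w `^ p + c * gn k w)) <=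
   Ex (fun w => Z w * xn k.+1 w `^ p))%E.
Proof.
move=> kn mZ Z0.
apply: (@cell_one_step k Z (fun x => Nm x `^ p) (fun w => c * gn k w)) => //.
- exact: meas_Nm_powR.
- by move=> x; exact: powR_ge0.
- by apply: measurable_funM; [exact: measurable_cst|exact: meas_cell_gain].
- by move=> w; apply: mulr_ge0; [exact: ltW|exact: cell_gain_ge0].
- by move=> w; apply: Hc; rewrite cell_lam_ge0 (cs_half HC).
Qed.

Lemma cell_step_gain1 k : (k < n)%N ->
  (Ex (fun w => xn k w `^ p + c * gn k w) <= Ex (fun w => xn k.+1 w `^ p))%E.
Proof.
move=> kn; have := @cell_step_gain k (fun=> 1) kn (measurable_cst _) (fun=> ler01).
congr (is_true (_ <= _)%E); apply: eq_integral => w _; by rewrite mul1r.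
Qed.

(** Telescoping, carried out by additions only because the expectations may be infinite. *)
Lemma cell_gain_sum k : (k <= n)%N ->
  (Ex (fun w => c * \sum_(i < k) gn i w) <= Ex (fun w => xn k w `^ p))%E.
Proof.
have c0' := ltW c0.
elim: k => [_|k IH kn].
  apply: integral_EFin_le.
  - by under eq_fun do rewrite big_ord0; exact: measurable_cst.
  - apply: meas_sub; apply: measurable_fun_powR; exact: (@meas_Nm 0).
  - by move=> w; rewrite big_ord0 mulr0.
  - by move=> w; rewrite big_ord0 mulr0 powR_ge0.
have mS j : (j <= k)%N -> measurable_fun setT (fun w => c * \sum_(i < j) gn i w).
  move=> jk; apply: measurable_funM; first exact: measurable_cst.
  apply: measurable_sum => i; apply: (@meas_sub (S i)); apply: meas_cell_gain.
  exact: leq_trans (ltn_ord i) (leq_trans jk (ltnW kn)).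
have mk : measurable_fun setT (gn k) by apply: (@meas_sub (S k)); exact: meas_cell_gain.
have S0 j w : 0 <= \sum_(i < j) gn i w.
  by apply: sumr_ge0 => i _; exact: cell_gain_ge0.
have mx : measurable_fun setT (fun w => xn k w `^ p).
  by apply: (@meas_sub (S k)); apply: measurable_fun_powR; exact: meas_Nm (ltnW kn).
have mck : measurable_fun setT (fun w => c * gn k w).
  by apply: measurable_funM => //; exact: measurable_cst.
have ck0 w : 0 <= c * gn k w by rewrite mulr_ge0 // cell_gain_ge0.
under eq_integral do rewrite big_ord_recr /= mulrDr.
rewrite integral_EFinD //; [|exact: mS|by move=> w; rewrite mulr_ge0 ?S0].
apply: le_trans (leeD2r _ (IH (ltnW kn))) _.
rewrite -integral_EFinD //; last by move=> w; exact: powR_ge0.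
by rewrite (le_trans _ (cell_step_gain1 kn)).
Qed.

Lemma cell_Nm_powR_step k : (k < n)%N ->
  (Ex (fun w => xn k w `^ p) <= Ex (fun w => xn k.+1 w `^ p))%E.
Proof.
move=> kn; apply: le_trans (cell_step_gain1 kn); apply: integral_EFin_le.
- by apply: (@meas_sub (S k)); apply: measurable_fun_powR; exact: meas_Nm (ltnW kn).
- apply: measurable_funD.
    by apply: (@meas_sub (S k)); apply: measurable_fun_powR; exact: meas_Nm (ltnW kn).
  apply: measurable_funM; first exact: measurable_cst.
  by apply: (@meas_sub (S k)); exact: meas_cell_gain.
- by move=> w; exact: powR_ge0.
- by move=> w; rewrite lerDl mulr_ge0 ?cell_gain_ge0 // ltW.
Qed.

Lemma cell_Nm_powR_le k : (k <= n)%N ->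
  (Ex (fun w => xn k w `^ p) <= Ex (fun w => xn n w `^ p))%E.
Proof.
pose e j := (Ex (fun w => xn j w `^ p))%E.
have step j : (j < n)%N -> (e j <= e j.+1)%E by exact: cell_Nm_powR_step.
move=> kn; suff : (e k <= e n)%E by [].
clearbody e; elim: (n) kn step => [|j IH]; first by rewrite leqn0 => /eqP ->.
rewrite leq_eqVlt => /predU1P[->//|]; rewrite ltnS => kj step.
apply: le_trans (step j (ltnSn j)); apply: IH => // i ij.
by apply: step; exact: leqW.
Qed.

End exponent.
End cells.

(** * The intersection bound, p >= s *)

Section cells_intersection.
Context {R : realType} {d d' : measure_display}.
Context {T : measurableType d} {E : measurableType d'} {X : normedModType R}.
Variables (P : probability T R) (mu : {measure set E -> \bar R}) (N : R.-ker T ~> E).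
Hypothesis HN : poisson_random_measure P mu N.
Variables (s K : R) (Nm : X -> R).
Hypothesis s2 : 2 <= s.
Hypothesis HNm : uniformly_convex_norm s K Nm.
Variables (n : nat) (D S : nat -> set E) (y : nat -> T -> X).
Hypothesis HC : cell_system mu N n D S y.
Variables (p r cp cs : R).
Hypotheses (r1 : 1 <= r) (pE : p = s * r) (cp0 : 0 < cp) (cs0 : 0 < cs).
Hypothesis Hp : forall (l : R) x z, 0 <= l <= 2^-1 ->
  ((Nm x `^ p + cp * (l * gain p s (Nm x) `|z|))%:E <=
   \sum_(m <oo) (poisson_weight l m * Nm (x + (m%:R - l) *: z) `^ p)%:E)%E.
Hypothesis Hs : forall (l : R) x z, 0 <= l <= 2^-1 ->
  ((Nm x `^ s + cs * (l * gain s s (Nm x) `|z|))%:E <=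
   \sum_(m <oo) (poisson_weight l m * Nm (x + (m%:R - l) *: z) `^ s)%:E)%E.

Local Notation TS k := (g_sigma_algebraType (past N (S k))).
Local Notation meas k := (measurable_fun (setT : set (TS k))).
Local Notation lam k := (fine (mu (D k))).
Local Notation Ex h := (\int[P]_w (h w)%:E)%E.
Local Notation f := (cell_sum mu N D y).

Let s0 : 0 < s. Proof. by move: (s2) => s2'; lra. Qed.
Let sp : s <= p. Proof. by rewrite pE ler_peMr // ltW. Qed.
Let lam0 k : 0 <= lam k. Proof. exact: cell_lam_ge0. Qed.
Let mNm k (kn : (k <= n)%N) := meas_Nm HNm HC kn.
Let my k (kn : (k < n)%N) := meas_norm_cell HC kn.

(** For disjoint cells this is the integral over time and space of the q-th power of the norm of the
    process. *)
Definition cell_power (q : R) k w := \sum_(i < k) lam i * `|y i w| `^ q.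

Lemma cell_power_ge0 q k w : 0 <= cell_power q k w.
Proof. by apply: sumr_ge0 => i _; rewrite mulr_ge0 // powR_ge0. Qed.

Lemma cell_powerS q k w :
  cell_power q k.+1 w = cell_power q k w + lam k * `|y k w| `^ q.
Proof. by rewrite /cell_power big_ord_recr. Qed.

Lemma meas_cell_power q k : (k < n)%N -> meas k (cell_power q k.+1).
Proof.
move=> kn; apply: measurable_sum => i; apply: measurable_funM.
  exact: measurable_cst.
have ik : (i <= k)%N by rewrite -ltnS.
apply: (meas_increasing HC (i := i)); first by rewrite ik ltnW.
by apply: measurable_fun_powR; apply: my; exact: leq_ltn_trans kn.
Qed.

Lemma measurable_cell_power q k : (k <= n)%N ->
  measurable_fun (setT : set T) (cell_power q k).
Proof.
case: k => [_|k kn]; last by apply: (@meas_sub _ _ _ _ _ N (S k)); exact: meas_cell_power.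
rewrite (_ : cell_power q 0 = cst 0); first exact: measurable_cst.
by apply/funext => w; rewrite /cell_power big_ord0.
Qed.

Lemma integral_cell_power :
  (Ex (cell_power p n) <= (cp^-1)%:E * Ex (fun w => Nm (f n w) `^ p))%E.
Proof.
have := cell_gain_sum HN HNm HC cp0 Hp (leqnn n).
have -> : (\int[P]_w (cp * (\sum_(i < n) lam i * gain p s (Nm (f i w)) `|y i w|))%:E =
   \int[P]_w (cp * cell_power p n w)%:E)%E.
  apply: eq_integral => w _; congr (_ * _)%:E; apply: eq_bigr => i _.
  by rewrite /gain ltNge sp.
rewrite integral_EFinZ ?(ltW cp0) //; last 2 first.
- exact: measurable_cell_power.
- exact: cell_power_ge0.
by move=> H; rewrite muleC lee_pdivlMr // muleC.
Qed.

Let V := cell_power s.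

(** The tangent of x^r at V_(k+1), taken at V_k, bounds V_(k+1)^r - V_k^r by r V_(k+1)^(r-1) l
    |y|^s. Up to the factor cs this is the gain of step k under the weight r V_(k+1)^(r-1). In the
    remaining term the weight may grow from V_k to V_(k+1) because r >= 1. *)
Lemma cell_power_step k : (k <= n)%N ->
  (Ex (fun w => cs * V k w `^ r) <=
   Ex (fun w => (r * V k w `^ (r - 1)) * Nm (f k w) `^ s))%E.
Proof.
have r0 : 0 <= r by apply: le_trans r1.
elim: k => [_|k IH kn].
  rewrite (_ : (\int[P]_w (cs * V 0 w `^ r)%:E)%E = 0%E).
    by apply: integral_EFin_ge0 => w; rewrite !mulr_ge0 ?powR_ge0.
  rewrite -[RHS](@integral0 _ _ _ P setT); apply: eq_integral => w _.
  rewrite /V /cell_power big_ord0 powR0 ?mulr0 //.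
  by rewrite gt_eqF // (lt_le_trans _ r1).
have kn' := ltnW kn.
pose Z w := r * V k.+1 w `^ (r - 1).
have Z0 w : 0 <= Z w by rewrite mulr_ge0 ?powR_ge0.
have mZ : meas k Z.
  apply: measurable_funM; first exact: measurable_cst.
  by apply: measurable_fun_powR; exact: meas_cell_power.
have Hstep := cell_step_gain HN HNm HC cs0 Hs kn mZ Z0.
apply: le_trans Hstep.
have V0 j w : 0 <= V j w by exact: cell_power_ge0.
have mV j : (j <= n)%N -> measurable_fun (setT : set T) (V j) by exact: measurable_cell_power.
have mVr j q : (j <= n)%N -> measurable_fun (setT : set T) (fun w => V j w `^ q).
  by move=> jn; apply: measurable_fun_powR; exact: mV.
have mb : measurable_fun (setT : set T) (fun w => lam k * `|y k w| `^ s).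
  apply: (@meas_sub _ _ _ _ _ N (S k)); apply: measurable_funM; first exact: measurable_cst.
  by apply: measurable_fun_powR; exact: my.
have b0 w : 0 <= lam k * `|y k w| `^ s by rewrite mulr_ge0 // powR_ge0.
have mx : measurable_fun (setT : set T) (fun w => Nm (f k w) `^ s).
  by apply: (@meas_sub _ _ _ _ _ N (S k)); apply: measurable_fun_powR; exact: mNm.
have mZT : measurable_fun (setT : set T) Z by exact: meas_sub mZ.
have mcb : measurable_fun (setT : set T) (fun w => cs * (lam k * `|y k w| `^ s)).
  by apply: measurable_funM => //; exact: measurable_cst.
have mZcb : measurable_fun (setT : set T) (fun w => Z w * (cs * (lam k * `|y k w| `^ s))).
  exact: measurable_funM.
have Zcb0 w : 0 <= Z w * (cs * (lam k * `|y k w| `^ s)).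
  by rewrite mulr_ge0 // mulr_ge0 // ltW.
have mcV : measurable_fun (setT : set T) (fun w => cs * V k w `^ r).
  by apply: measurable_funM; [exact: measurable_cst|exact: mVr].
have cV0 w : 0 <= cs * V k w `^ r by rewrite mulr_ge0 ?powR_ge0 // ltW.
pose Z' w := r * V k w `^ (r - 1).
have mZ' : measurable_fun (setT : set T) Z'.
  by apply: measurable_funM; [exact: measurable_cst|exact: mVr].
have Z'0 w : 0 <= Z' w by rewrite mulr_ge0 ?powR_ge0.
have mZx : measurable_fun (setT : set T) (fun w => Z' w * Nm (f k w) `^ s).
  exact: measurable_funM.
have Zx0 w : 0 <= Z' w * Nm (f k w) `^ s by rewrite mulr_ge0 ?powR_ge0.
apply: (@le_trans _ _ (Ex (fun w => cs * V k w `^ r +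
    Z w * (cs * (lam k * `|y k w| `^ s))))).
  apply: integral_EFin_le.
  - by apply: measurable_funM; [exact: measurable_cst|exact: mVr].
  - exact: measurable_funD.
  - by move=> w; rewrite mulr_ge0 ?powR_ge0 // ltW.
  - move=> w; have := powR_tangent r1 (V0 k.+1 w) (V0 k w).
    have -> : V k w - V k.+1 w = - (lam k * `|y k w| `^ s).
      by rewrite /V cell_powerS opprD addrA subrr sub0r.
    move=> /(ler_wpM2l (ltW cs0)); rewrite /Z.
    set a := V k.+1 w `^ r; set b := V k.+1 w `^ (r - 1).
    set u := lam k * _; set q := V k w `^ r => H.
    have E0 : cs * (a + r * b * - u) = cs * a - r * b * (cs * u) by ring.
    rewrite E0 in H.
    lra.
rewrite integral_EFinD //; apply: le_trans (leeD2r _ (IH kn')) _.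
rewrite -integral_EFinD //; apply: integral_EFin_le.
- exact: measurable_funD.
- apply: measurable_funM => //; apply: measurable_funD => //.
  apply: measurable_funM; first exact: measurable_cst.
  apply: (@meas_sub _ _ _ _ _ N (S k)); apply: measurable_funM; first exact: measurable_cst.
  by apply: measurable_gain; [exact: mNm|exact: my].
- by move=> w; exact: addr_ge0 (Zx0 w) (Zcb0 w).
- move=> w; rewrite mulrDr /gain ltxx; apply: lerD => //.
  apply: ler_wpM2r; first exact: powR_ge0.
  rewrite /Z' /Z; apply: ler_wpM2l => //; apply: ler_powRl => //.
    by rewrite subr_ge0.
  by rewrite {2}/V cell_powerS lerDl.
Qed.

(** The absorption below needs this. As l <= 1/2 and r >= 1, (l |y|^s)^r <= l |y|^p, so the bound in
    D^p_p already implies finiteness. *)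
Lemma cell_power_finite k : (Ex (cell_power p n) < +oo)%E -> (k <= n)%N ->
  (Ex (fun w => V k w `^ r) < +oo)%E.
Proof.
move=> fin; have r0 : 0 <= r by apply: le_trans r1.
have V0 j w : 0 <= V j w by exact: cell_power_ge0.
have mVr j : (j <= n)%N -> measurable_fun (setT : set T) (fun w => V j w `^ r).
  by move=> jn; apply: measurable_fun_powR; exact: measurable_cell_power.
elim: k => [_|k IH kn].
  rewrite (_ : (\int[P]_w (V 0 w `^ r)%:E)%E = 0%E) ?ltry //.
  rewrite -[RHS](@integral0 _ _ _ P setT); apply: eq_integral => w _.
  rewrite /V /cell_power big_ord0 powR0 //.
  by rewrite gt_eqF // (lt_le_trans _ r1).
have mA : measurable_fun (setT : set T) (cell_power p n) by exact: measurable_cell_power.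
have A0 w : 0 <= cell_power p n w by exact: cell_power_ge0.
apply: (@le_lt_trans _ _ (Ex (fun w => 2 `^ r * (V k w `^ r + cell_power p n w)))).
  apply: integral_EFin_le.
  - exact: mVr.
  - apply: measurable_funM; first exact: measurable_cst.
    by apply: measurable_funD => //; exact: mVr (ltnW kn).
  - by move=> w; exact: powR_ge0.
  - move=> w; rewrite {1}/V cell_powerS.
    apply: le_trans (powR_add_le r1 (V0 k w) _) _.
      by rewrite mulr_ge0 // powR_ge0.
    apply: ler_wpM2l; first exact: powR_ge0.
    apply: lerD => //.
    apply: (@le_trans _ _ (lam k * `|y k w| `^ p)).
      rewrite powRM ?powR_ge0 // -powRrM -pE.
      apply: ler_wpM2r; first exact: powR_ge0.
      have := lam0 k; rewrite le_eqVlt => /predU1P[<-|l0].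
        by rewrite powR0 // gt_eqF // (lt_le_trans _ r1).
      apply: ge1r_powR => //; rewrite l0 /=.
      by have := cs_half HC kn; lra.
    rewrite /cell_power (bigD1 (Ordinal kn)) //= lerDl.
    by apply: sumr_ge0 => i _; rewrite mulr_ge0 // powR_ge0.
rewrite integral_EFinZ ?powR_ge0 //; last 2 first.
- by apply: measurable_funD => //; exact: mVr (ltnW kn).
- by move=> w; rewrite addr_ge0 ?powR_ge0.
rewrite integral_EFinD //; [|exact: mVr (ltnW kn)|by move=> w; exact: powR_ge0].
apply: lte_mul_pinfty; rewrite ?lee_fin ?powR_ge0 //.
by apply: lte_add_pinfty => //; exact: IH (ltnW kn).
Qed.

Lemma integral_cell_power_powR :
  (Ex (fun w => V n w `^ r) <=
   (2 * (r / cs * (cs / (2 * r))^-1 `^ (r - 1)))%:E * Ex (fun w => Nm (f n w) `^ p))%E.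
Proof.
have r0 : 0 < r by apply: lt_le_trans r1.
have V0 j w : 0 <= V j w by exact: cell_power_ge0.
(* Chosen so that r / cs * e = 1/2, the coefficient to be absorbed. *)
pose e := cs / (2 * r); have e0 : 0 < e by rewrite /e divr_gt0 // mulr_gt0.
set C := r / cs * e^-1 `^ (r - 1).
have C0 : 0 < C by rewrite /C mulr_gt0 ?divr_gt0 // powR_gt0 // invr_gt0.
have [fin|] := ltP (Ex (fun w => Nm (f n w) `^ p)) +oo%E; last first.
  rewrite leye_eq => /eqP ->; rewrite gt0_muley ?leey //.
  by rewrite lte_fin mulr_gt0.
have mx (q : R) : measurable_fun (setT : set T) (fun w => Nm (f n w) `^ q).
  by apply: (@meas_sub _ _ _ _ _ N (S n)); apply: measurable_fun_powR; exact: mNm.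
have mVr q : measurable_fun (setT : set T) (fun w => V n w `^ q).
  by apply: measurable_fun_powR; exact: measurable_cell_power.
have finV : (Ex (fun w => V n w `^ r) < +oo)%E.
  apply: cell_power_finite => //; apply: le_lt_trans integral_cell_power _.
  by apply: lte_mul_pinfty => //; rewrite lee_fin invr_ge0 ltW.
rewrite EFinM -muleA; apply: ereal_absorb => //.
  by apply: integral_EFin_ge0 => w; exact: powR_ge0.
have := cell_power_step (leqnn n).
rewrite integral_EFinZ ?(ltW cs0) //; last by move=> w; exact: powR_ge0.
rewrite muleC -lee_pdivlMr // => H; apply: le_trans H _.
rewrite muleC -integral_EFinZ ?invr_ge0 ?(ltW cs0) //; last 2 first.
- apply: measurable_funM => //; apply: measurable_funM => //; exact: measurable_cst.
- by move=> w; rewrite !mulr_ge0 ?powR_ge0 // ltW.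
rewrite -!integral_EFinZ ?(ltW C0) ?invr_ge0 //; try by move=> w; exact: powR_ge0.
have m1 (c q : R) : measurable_fun (setT : set T) (fun w => c * V n w `^ q).
  by apply: measurable_funM => //; exact: measurable_cst.
have m2 (c q : R) : measurable_fun (setT : set T) (fun w => c * Nm (f n w) `^ q).
  by apply: measurable_funM => //; exact: measurable_cst.
rewrite -integral_EFinD //; last 2 first.
- by move=> w; rewrite mulr_ge0 ?powR_ge0.
- by move=> w; rewrite mulr_ge0 ?powR_ge0 // ltW.
apply: integral_EFin_le.
- apply: measurable_funM; first exact: measurable_cst.
  exact: measurable_funM.
- exact: measurable_funD.
- by move=> w; rewrite !mulr_ge0 ?powR_ge0 ?invr_ge0 // ltW.
- move=> w; have := young_absorb e0 r1 (V0 n w) (powR_ge0 (Nm (f n w)) s).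
  rewrite -powRrM -pE => H.
  have rc : 0 <= r / cs by rewrite divr_ge0 // ltW.
  have := ler_wpM2l rc H; rewrite /C mulrDr.
  have -> : r / cs * (e * V n w `^ r) = 2^-1 * V n w `^ r.
    by rewrite /e; field; rewrite !gt_eqF.
  rewrite !mulrA [cs^-1 * r]mulrC; lra.
Qed.

End cells_intersection.

(** * The sum bound, 1 < p < s *)

Section cells_sum.
Context {R : realType} {d d' : measure_display}.
Context {T : measurableType d} {E : measurableType d'} {X : normedModType R}.
Variables (P : probability T R) (mu : {measure set E -> \bar R}) (N : R.-ker T ~> E).
Hypothesis HN : poisson_random_measure P mu N.
Variables (s K : R) (Nm : X -> R).
Hypothesis HNm : uniformly_convex_norm s K Nm.
Variables (n : nat) (D S : nat -> set E) (y : nat -> T -> X).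
Hypothesis HC : cell_system mu N n D S y.
Variables (p c : R).
Hypotheses (p1 : 1 < p) (ps : p < s) (c0 : 0 < c).
Hypothesis Hp : forall (l : R) x z, 0 <= l <= 2^-1 ->
  ((Nm x `^ p + c * (l * gain p s (Nm x) `|z|))%:E <=
   \sum_(m <oo) (poisson_weight l m * Nm (x + (m%:R - l) *: z) `^ p)%:E)%E.

Local Notation TS k := (g_sigma_algebraType (past N (S k))).
Local Notation meas k := (measurable_fun (setT : set (TS k))).
Local Notation lam k := (fine (mu (D k))).
Local Notation Ex h := (\int[P]_w (h w)%:E)%E.
Local Notation f := (cell_sum mu N D y).

Let lam0 k : 0 <= lam k. Proof. exact: cell_lam_ge0. Qed.
Let mNm k (kn : (k <= n)%N) := meas_Nm HNm HC kn.
Let my k (kn : (k < n)%N) := meas_norm_cell HC kn.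
Let p0 : 0 < p. Proof. exact: lt_trans p1. Qed.
Let x0 k w : 0 <= Nm (f k w). Proof. exact: ucn_ge0 HNm _. Qed.

(** The initial value 0 agrees with the norm of the empty sum. *)
Fixpoint cell_max k w : R :=
  if k is j.+1 then Num.max (cell_max j w) (Nm (f k w)) else 0.

Lemma cell_max_ge0 k w : 0 <= cell_max k w.
Proof. by case: k => //= k; rewrite le_max x0 orbT. Qed.

Lemma Nm_le_cell_max k w : Nm (f k w) <= cell_max k w.
Proof.
case: k => [|k] /=; last by rewrite le_max lexx orbT.
by rewrite /cell_sum big_ord0 -(scale0r 0) (ucnZ HNm) normr0 mul0r.
Qed.

Lemma cell_max_le j k w : (j <= k)%N -> cell_max j w <= cell_max k w.
Proof.
elim: k => [|k IH]; first by rewrite leqn0 => /eqP ->.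
rewrite leq_eqVlt => /predU1P[->//|]; rewrite ltnS => /IH H.
by rewrite /= le_max H.
Qed.

Lemma meas_cell_max k : (k <= n)%N -> meas k (cell_max k).
Proof.
elim: k => [_|k IH kn]; first exact: measurable_cst.
apply: measurable_maxr; last exact: mNm.
by apply: (meas_increasing HC (i := k)) (IH (ltnW kn)); rewrite leqnSn.
Qed.

Let mMT k q : (k <= n)%N -> measurable_fun (setT : set T) (fun w => cell_max k w `^ q).
Proof.
move=> kn; apply: measurable_fun_powR.
by apply: (@meas_sub _ _ _ _ _ N (S k)); exact: meas_cell_max.
Qed.

Let mxT k : (k <= n)%N -> measurable_fun (setT : set T) (fun w => Nm (f k w)).
Proof. by move=> kn; apply: (@meas_sub _ _ _ _ _ N (S k)); exact: mNm. Qed.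

Let mxpT k q : (k <= n)%N -> measurable_fun (setT : set T) (fun w => Nm (f k w) `^ q).
Proof. by move=> kn; apply: measurable_fun_powR; exact: mxT. Qed.

Lemma cell_submartingale k (Z : T -> R) : (k < n)%N -> meas k Z ->
  (forall w, 0 <= Z w) ->
  (Ex (fun w => Z w * Nm (f k w)) <= Ex (fun w => Z w * Nm (f k.+1 w)))%E.
Proof.
move=> kn mZ Z0.
have := @cell_one_step _ _ _ _ _ _ P mu N HN n D S y HC k Z Nm (fun=> 0) kn mZ Z0.
under [X in _ -> _ -> _ -> _ -> _ -> (X <= _)%E]eq_integral do rewrite addr0.
apply => //.
- move=> j h mh; apply: (@strongly_measurable_continuous _ _ (TS j)) => //.
  exact: ucn_continuous HNm.
- exact: ucn_ge0 HNm.
- by move=> w; rewrite addr0; apply: (ucn_poisson_convex1 HNm).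
Qed.

Section finite.
Hypothesis fin : (Ex (fun w => Nm (f n w) `^ p) < +oo)%E.

Let finx k : (k <= n)%N -> (Ex (fun w => Nm (f k w) `^ p) < +oo)%E.
Proof. by move=> kn; apply: le_lt_trans fin; exact: (cell_Nm_powR_le HN HNm HC c0 Hp kn). Qed.

Lemma cell_max_finite k : (k <= n)%N -> (Ex (fun w => cell_max k w `^ p) < +oo)%E.
Proof.
elim: k => [_|k IH kn].
  rewrite (_ : (\int[P]_w (cell_max 0 w `^ p)%:E)%E = 0%E) ?ltry //.
  rewrite -[RHS](@integral0 _ _ _ P setT); apply: eq_integral => w _ /=.
  by rewrite powR0 // gt_eqF.
apply: (@le_lt_trans _ _ (Ex (fun w => cell_max k w `^ p + Nm (f k.+1 w) `^ p))).
  apply: integral_EFin_le.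
  - exact: mMT.
  - by apply: measurable_funD; [exact: mMT (ltnW kn)|exact: mxpT].
  - by move=> w; exact: powR_ge0.
  - move=> w /=; have [_|_] := leP (cell_max k w) (Nm (f k.+1 w)).
      by rewrite lerDr powR_ge0.
    by rewrite lerDl powR_ge0.
rewrite integral_EFinD //.
- by apply: lte_add_pinfty; [exact: IH (ltnW kn)|exact: finx].
- exact: mMT (ltnW kn).
- exact: mxpT.
- by move=> w; exact: powR_ge0.
- by move=> w; exact: powR_ge0.
Qed.

Let q := p / (p - 1).
Let q0 : 0 < q. Proof. by rewrite /q divr_gt0 // subr_gt0. Qed.

Let mprod j k : (j <= n)%N -> (k <= n)%N ->
  measurable_fun (setT : set T) (fun w => q * (cell_max j w `^ (p - 1) * Nm (f k w))).
Proof.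
move=> jn kn; apply: measurable_funMl; apply: measurable_funM; [exact: mMT|exact: mxT].
Qed.

Let prod0 j k w : 0 <= q * (cell_max j w `^ (p - 1) * Nm (f k w)).
Proof. by apply: mulr_ge0; [exact: ltW|apply: mulr_ge0 => //; exact: powR_ge0]. Qed.

(** By [doob_pointwise], the new term costs a cross product of M_k^(p-1) with the norm of f_(k+1).
    The submartingale inequality with weight M_k^(p-1), known before step k, compares it with the
    norm of f_k and so with the induction hypothesis. The cross product is added to both sides and
    cancelled, hence the need for [finb]. *)
Lemma cell_doob_step k : (k <= n)%N ->
  (Ex (fun w => cell_max k w `^ p) <=
   Ex (fun w => q * (cell_max k w `^ (p - 1) * Nm (f k w))))%E.
Proof.
elim: k => [_|k IH kn].
  rewrite (_ : (\int[P]_w (cell_max 0 w `^ p)%:E)%E = 0%E).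
    by apply: integral_EFin_ge0 => w; exact: prod0.
  rewrite -[RHS](@integral0 _ _ _ P setT); apply: eq_integral => w _ /=.
  by rewrite powR0 // gt_eqF.
have kn' := ltnW kn.
have finb : (Ex (fun w => q * (cell_max k w `^ (p - 1) * Nm (f k.+1 w))) < +oo)%E.
  apply: (@le_lt_trans _ _ (Ex (fun w => q * (cell_max k w `^ p + Nm (f k.+1 w) `^ p)))).
    apply: integral_EFin_le => //; first exact: mprod.
      by apply: measurable_funMl; apply: measurable_funD; [exact: mMT|exact: mxpT].
    move=> w; apply: ler_wpM2l; first exact: ltW.
    have := young_absorb ltr01 (ltW p1) (cell_max_ge0 k w) (x0 k.+1 w).
    by rewrite invr1 powR1 !mul1r.
  rewrite integral_EFinZ ?(ltW q0) //; last 2 first.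
  - by apply: measurable_funD; [exact: mMT|exact: mxpT].
  - by move=> w; rewrite addr_ge0 ?powR_ge0.
  rewrite integral_EFinD //; [|exact: mMT|exact: mxpT|by move=> w; exact: powR_ge0
    |by move=> w; exact: powR_ge0].
  apply: lte_mul_pinfty; rewrite ?lee_fin ?(ltW q0) //.
  by apply: lte_add_pinfty; [exact: cell_max_finite|exact: finx].
have b0 : (0 <= Ex (fun w => q * (cell_max k w `^ (p - 1) * Nm (f k.+1 w))))%E.
  by apply: integral_EFin_ge0 => w; exact: prod0.
have bfin : (Ex (fun w => q * (cell_max k w `^ (p - 1) * Nm (f k.+1 w))))%E \is a fin_num.
  by rewrite ge0_fin_numE.
rewrite -(@leeD2rE _ _ _ _ bfin) -integral_EFinD; last 4 first.
- exact: mMT.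
- exact: mprod.
- by move=> w; exact: powR_ge0.
- by move=> w; exact: prod0.
apply: (@le_trans _ _ (Ex (fun w => cell_max k w `^ p +
    q * (cell_max k.+1 w `^ (p - 1) * Nm (f k.+1 w))))).
  apply: integral_EFin_le.
  - by apply: measurable_funD; [exact: mMT|exact: mprod].
  - by apply: measurable_funD; [exact: mMT|exact: mprod].
  - by move=> w; apply: addr_ge0; [exact: powR_ge0|exact: prod0].
  - by move=> w; exact: doob_pointwise p1 (cell_max_ge0 k w) (x0 k.+1 w).
rewrite integral_EFinD; last 4 first.
- exact: mMT.
- exact: mprod.
- by move=> w; exact: powR_ge0.
- by move=> w; exact: prod0.
rewrite addeC; apply: leeD2l; apply: le_trans (IH kn') _.
have mZ : meas k (fun w => q * cell_max k w `^ (p - 1)).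
  by apply: measurable_funMl; apply: measurable_fun_powR; exact: meas_cell_max.
have Z0 w : 0 <= q * cell_max k w `^ (p - 1) by rewrite mulr_ge0 ?powR_ge0 ?ltW.
have := cell_submartingale kn mZ Z0.
by congr (is_true (_ <= _)%E); apply: eq_integral => w _; rewrite mulrA.
Qed.

Lemma cell_doob_finite :
  (Ex (fun w => cell_max n w `^ p) <=
   (2 * (q * (2 * q) `^ (p - 1)))%:E * Ex (fun w => Nm (f n w) `^ p))%E.
Proof.
(* Chosen so that q e = 1/2, the coefficient to be absorbed. *)
pose e := (2 * q)^-1; have e0 : 0 < e by rewrite invr_gt0 mulr_gt0.
rewrite EFinM -muleA; apply: ereal_absorb.
- by apply: integral_EFin_ge0 => w; exact: powR_ge0.
- exact: cell_max_finite.
apply: le_trans (cell_doob_step (leqnn n)) _.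
have C0 : 0 <= q * (2 * q) `^ (p - 1) by rewrite mulr_ge0 ?powR_ge0 ?ltW.
rewrite -!integral_EFinZ ?invr_ge0 //; [|exact: mxpT|by move=> w; exact: powR_ge0
  |exact: mMT|by move=> w; exact: powR_ge0].
have h0 : 0 <= (2^-1 : R) by rewrite invr_ge0.
rewrite -integral_EFinD; last 4 first.
- by apply: measurable_funMl; exact: mMT.
- by apply: measurable_funMl; exact: mxpT.
- by move=> w; rewrite mulr_ge0 ?powR_ge0.
- by move=> w; rewrite mulr_ge0 ?powR_ge0.
apply: integral_EFin_le.
- exact: mprod.
- by apply: measurable_funD; apply: measurable_funMl; [exact: mMT|exact: mxpT].
- by move=> w; exact: prod0.
- move=> w; have := young_absorb e0 (ltW p1) (cell_max_ge0 n w) (x0 n w).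
  move=> /(ler_wpM2l (ltW q0)); rewrite {2}/e invrK mulrDr !mulrA.
  have -> : q * e = 2^-1 by rewrite /e; field; rewrite gt_eqF.
  by [].
Qed.

End finite.

(** Equal to (2 q)^p with q = p / (p - 1): the absorption loses a factor 2^p against Doob's constant
    q^p. *)
Definition doob_constant : R := 2 * (p / (p - 1) * (2 * (p / (p - 1))) `^ (p - 1)).

Lemma doob_constant_gt0 : 0 < doob_constant.
Proof.
have q0 : 0 < p / (p - 1) by rewrite divr_gt0 // subr_gt0.
by apply: mulr_gt0 => //; apply: mulr_gt0 => //; apply: powR_gt0; exact: mulr_gt0.
Qed.

Lemma cell_doob :
  (Ex (fun w => cell_max n w `^ p) <=
   doob_constant%:E * Ex (fun w => Nm (f n w) `^ p))%E.
Proof.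
have [fin|] := ltP (Ex (fun w => Nm (f n w) `^ p)) +oo%E; first exact: cell_doob_finite.
rewrite leye_eq => /eqP ->; rewrite gt0_muley ?leey //.
by rewrite lte_fin doob_constant_gt0.
Qed.

Definition big_part k w := if Nm (f k w) < `|y k w| then y k w else 0.
Definition small_part k w := if Nm (f k w) < `|y k w| then 0 else y k w.

Lemma big_small_partE k w : y k w = small_part k w + big_part k w.
Proof. by rewrite /small_part /big_part; case: ifP; rewrite ?add0r ?addr0. Qed.

Let mlt k : (k < n)%N ->
  measurable_fun (setT : set T) (fun w => Nm (f k w) < `|y k w|).
Proof.
move=> kn; apply: measurable_fun_ltr; first exact: mxT (ltnW kn).
by apply: (@meas_sub _ _ _ _ _ N (S k)); exact: my.
Qed.

Let ym k : (k < n)%N -> strongly_measurable (@measurable _ T) (y k).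
Proof.
move=> kn; apply: strongly_measurable_sub (cs_adapted HC kn).
exact: sigma_past_measurable.
Qed.

Lemma strongly_measurable_big_part k : (k < n)%N ->
  strongly_measurable (@measurable _ T) (big_part k).
Proof.
move=> kn; have -> : big_part k =
    (fun w => (if Nm (f k w) < `|y k w| then 1 else 0) *: y k w).
  by apply/funext => w; rewrite /big_part; case: ifP; rewrite ?scale1r ?scale0r.
apply: strongly_measurableZ; last exact: ym.
by apply: measurable_fun_ifT; [exact: mlt|exact: measurable_cst|exact: measurable_cst].
Qed.

Lemma strongly_measurable_small_part k : (k < n)%N ->
  strongly_measurable (@measurable _ T) (small_part k).
Proof.
move=> kn; have -> : small_part k =
    (fun w => (if Nm (f k w) < `|y k w| then 0 else 1) *: y k w).
  by apply/funext => w; rewrite /small_part; case: ifP; rewrite ?scale1r ?scale0r.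
apply: strongly_measurableZ; last exact: ym.
by apply: measurable_fun_ifT; [exact: mlt|exact: measurable_cst|exact: measurable_cst].
Qed.

Local Notation gn k := (fun w => lam k * gain p s (Nm (f k w)) `|y k w|).

Let gn0 k w : 0 <= gn k w.
Proof. by apply: mulr_ge0 => //; exact: gain_ge0. Qed.

Let mW : measurable_fun (setT : set T) (fun w => \sum_(i < n) gn i w).
Proof.
apply: measurable_sum => i; apply: measurable_funMl; apply: measurable_gain.
  exact: mxT (ltnW (ltn_ord i)).
by apply: (@meas_sub _ _ _ _ _ N (S i)); exact: my.
Qed.

Let W0 w : 0 <= \sum_(i < n) gn i w.
Proof. by apply: sumr_ge0 => i _; exact: gn0. Qed.

Let EW : (Ex (fun w => (\sum_(i < n) gn i w))
  <= (c^-1)%:E * Ex (fun w => Nm (f n w) `^ p))%E.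
Proof.
have := cell_gain_sum HN HNm HC c0 Hp (leqnn n).
rewrite integral_EFinZ ?(ltW c0) //.
by move=> H; rewrite muleC lee_pdivlMr // muleC.
Qed.

Let mpart (h : nat -> T -> X) (e : R) :
  (forall k, (k < n)%N -> strongly_measurable (@measurable _ T) (h k)) ->
  measurable_fun (setT : set T) (fun w => \sum_(i < n) lam i * `|h i w| `^ e).
Proof.
move=> mh; apply: measurable_sum => i; apply: measurable_funMl.
by apply: measurable_fun_powR; apply: strongly_measurable_norm; exact: mh.
Qed.

(** When a < b, a + b <= 2 b and p - s < 0 give a gain of at least 2^(p - s) b^p. *)
Lemma integral_big_part :
  (Ex (fun w => \sum_(i < n) lam i * `|big_part i w| `^ p) <=
   (2 `^ (s - p) * c^-1)%:E * Ex (fun w => Nm (f n w) `^ p))%E.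
Proof.
have t0 : 0 <= (2 : R) `^ (s - p) by exact: powR_ge0.
rewrite EFinM -muleA.
apply: (@le_trans _ _ ((2 `^ (s - p))%:E * Ex (fun w => \sum_(i < n) gn i w))%E); last first.
  by apply: lee_wpmul2l; rewrite ?lee_fin.
rewrite -integral_EFinZ //; apply: integral_EFin_le.
- by apply: mpart => k kn; exact: strongly_measurable_big_part.
- exact: measurable_funMl.
- by move=> w; apply: sumr_ge0 => i _; rewrite mulr_ge0 ?powR_ge0.
- move=> w; rewrite mulr_sumr; apply: ler_sum => i _.
  rewrite mulrCA; apply: ler_wpM2l => //; rewrite /big_part.
  have [ab|_] := ltP (Nm (f i w)) `|y i w|; last first.
    by rewrite normr0 powR0 ?gt_eqF // mulr_ge0 // gain_ge0.
  rewrite /gain ps; set b := `|y i w| in ab *; set a := Nm _ in ab *.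
  have a0 : 0 <= a by exact: x0.
  have b0 : 0 < b by exact: le_lt_trans ab.
  apply: (@le_trans _ _ (2 `^ (s - p) * (b `^ s * (2 * b) `^ (p - s)))).
    rewrite powRM ?(ltW b0) //.
    have -> : 2 `^ (s - p) * (b `^ s * (2 `^ (p - s) * b `^ (p - s))) =
        (2 `^ (s - p) * 2 `^ (p - s)) * (b `^ s * b `^ (p - s)) by ring.
    rewrite -powRD; last by rewrite pnatr_eq0 implybT.
    rewrite -powRD; last by rewrite (gt_eqF b0) implybT.
    have -> : s - p + (p - s) = 0 by ring.
    by rewrite powRr0 mul1r subrKC.
  apply: ler_wpM2l => //; apply: ler_wpM2l; first exact: powR_ge0.
  by move: (ps) => ps'; apply: ler_powRl_neg; lra.
Qed.

(** On the small part a + b <= 2 M, with M the final maximum, so the sum of l |y|^s is at most (2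
    M)^(s - p) W, where W is the sum of the gains. The power p / s turns this into a weighted
    geometric mean of (2 M)^p and W. *)
Lemma integral_small_part :
  (Ex (fun w => (\sum_(i < n) lam i * `|small_part i w| `^ s) `^ (p / s)) <=
   (2 `^ p * doob_constant + c^-1)%:E * Ex (fun w => Nm (f n w) `^ p))%E.
Proof.
have s0 : 0 < s by exact: lt_trans ps.
have Dc0 := doob_constant_gt0.
have t0 : 0 <= (2 : R) `^ p by exact: powR_ge0.
have r01 : 0 <= p / s <= 1 by rewrite divr_ge0 ?(ltW p0) ?(ltW s0) //= ler_pdivrMr // mul1r ltW.
rewrite EFinD ge0_muleDl; last 2 first.
- by rewrite lee_fin; apply: mulr_ge0 => //; exact: ltW.
- by rewrite lee_fin invr_ge0 ltW.
apply: (@le_trans _ _ ((2 `^ p)%:E * Ex (fun w => cell_max n w `^ p) +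
    Ex (fun w => \sum_(i < n) gn i w))%E); last first.
  apply: leeD; last exact: EW.
  rewrite EFinM -muleA; apply: lee_wpmul2l; first by rewrite lee_fin.
  exact: cell_doob.
rewrite -integral_EFinZ //; [|exact: mMT|by move=> w; exact: powR_ge0].
rewrite -integral_EFinD //; [|by apply: measurable_funMl; exact: mMT
  |by move=> w; rewrite mulr_ge0 ?powR_ge0].
apply: integral_EFin_le.
- by apply: measurable_fun_powR; apply: mpart => k kn; exact: strongly_measurable_small_part.
- by apply: measurable_funD => //; apply: measurable_funMl; exact: mMT.
- by move=> w; exact: powR_ge0.
move=> w; set W := \sum_(i < n) gn i w.
set M := cell_max n w; have M0 : 0 <= M by exact: cell_max_ge0.
have M20 : 0 <= 2 * M by rewrite mulr_ge0.
have HQ : \sum_(i < n) lam i * `|small_part i w| `^ s <= (2 * M) `^ (s - p) * W.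
  rewrite /W mulr_sumr; apply: ler_sum => i _.
  rewrite mulrCA; apply: ler_wpM2l => //; rewrite /small_part.
  have [_|ba] := ltP (Nm (f i w)) `|y i w|.
    by rewrite normr0 powR0 ?gt_eqF // mulr_ge0 ?gain_ge0 ?powR_ge0.
  rewrite /gain ps; set b := `|y i w| in ba *; set a := Nm _ in ba *.
  have b0 : 0 <= b by exact: normr_ge0.
  have aM : a <= M.
    by apply: le_trans (Nm_le_cell_max i w) _; apply: cell_max_le; exact: ltnW.
  (* A zero coefficient is treated apart, since M may then vanish and the negative power of 2 M is
     of no use. *)
  move: b0; rewrite le_eqVlt => /predU1P[<-|b0].
    by rewrite powR0 ?gt_eqF // mul0r mulr0.
  have Mpos : 0 < 2 * M by lra.
  apply: (@le_trans _ _ ((2 * M) `^ (s - p) * (b `^ s * (2 * M) `^ (p - s)))).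
    rewrite mulrCA -powRD; last by rewrite (gt_eqF Mpos) implybT.
    have -> : s - p + (p - s) = 0 by ring.
    by rewrite powRr0 mulr1.
  apply: ler_wpM2l; first exact: powR_ge0.
  apply: ler_wpM2l; first exact: powR_ge0.
  by move: (ps) => ps'; apply: ler_powRl_neg; lra.
have Q0 : 0 <= \sum_(i < n) lam i * `|small_part i w| `^ s.
  by apply: sumr_ge0 => i _; rewrite mulr_ge0 ?powR_ge0.
have r0 : 0 <= p / s by case/andP: r01.
apply: le_trans (ler_powRl r0 Q0 HQ) _.
rewrite powRM ?powR_ge0 //; last exact: W0.
rewrite -[X in _ <= X + _]powRM //.
(* The exponents agree: (s - p) p / s = p (1 - p / s). *)
have -> : (2 * M) `^ (s - p) `^ (p / s) = (2 * M) `^ p `^ (1 - p / s).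
  by rewrite -!powRrM; congr (_ `^ _); field; rewrite gt_eqF.
by apply: powR_weighted_le => //; [exact: powR_ge0|exact: W0].
Qed.

End cells_sum.

(** * From simple processes to cells *)

Section cell_process.
Context {R : realType} {d d' : measure_display}.
Context {T : measurableType d} {E : measurableType d'} {X : normedModType R}.
Variables (P : probability T R) (mu : {measure set E -> \bar R}).
Variables (n : nat) (D : nat -> set E).
Hypothesis mD : forall k, (k < n)%N -> measurable (D k).
Hypothesis finD : forall k, (k < n)%N -> (mu (D k) < +oo)%E.
Hypothesis tD : forall j k, (j < k < n)%N -> D j `&` D k = set0.

Definition cell_process (y : nat -> T -> X) (w : T) (z : E) : X :=
  \sum_(i < n) \1_(D i) z *: y i w.

Lemma cell_disjoint (i j : 'I_n) z : D i z -> D j z -> i = j.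
Proof.
move=> Di Dj; apply: ord_inj; case: (ltngtP i j) => // ij.
  have E0 : D i `&` D j = set0 by apply: tD; rewrite ij ltn_ord.
  by suff : (set0 : set E) z by []; rewrite -E0.
have E0 : D j `&` D i = set0 by apply: tD; rewrite ij ltn_ord.
by suff : (set0 : set E) z by []; rewrite -E0.
Qed.

Lemma cell_process_norm y w z (q : R) : 0 < q ->
  `|cell_process y w z| `^ q = \sum_(i < n) \1_(D i) z * `|y i w| `^ q.
Proof.
move=> q0; rewrite /cell_process.
have [[i Di]|H] := pselect (exists i : 'I_n, D i z).
  have zero (j : 'I_n) : j != i -> \1_(D j) z = 0 :> R.
    move=> ji; rewrite indicE memNset // => Dj.
    by move/eqP: ji; apply; exact: cell_disjoint Dj Di.
  rewrite (bigD1 i) //= big1 ?addr0; last by move=> j ji; rewrite zero // scale0r.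
  rewrite [RHS](bigD1 i) //= big1 ?addr0; last by move=> j ji; rewrite zero // mul0r.
  by rewrite indicE mem_set // scale1r mul1r.
have zero (j : 'I_n) : \1_(D j) z = 0 :> R.
  by rewrite indicE memNset // => Dj; apply: H; exists j.
rewrite !big1 => [|j _|j _]; rewrite ?zero ?scale0r ?mul0r //.
by rewrite normr0 powR0 // gt_eqF.
Qed.

Lemma bochner_norm_cell_process y w (q : R) : 0 < q ->
  bochner_norm mu q (cell_process y w) =
  (cell_power (X := X) mu D y q n w `^ q^-1)%:E.
Proof.
move=> q0; rewrite bochner_normE -poweR_EFin; congr (poweR _ _).
under eq_integral do rewrite cell_process_norm //.
under eq_integral do rewrite -sumEFin.
have mI (i : 'I_n) : measurable_fun setT (fun z => (\1_(D i) z * `|y i w| `^ q)%:E).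
  apply/measurable_EFinP; apply: measurable_funM; last exact: measurable_cst.
  by apply: measurable_indic; exact: mD.
have I0 (i : 'I_n) z : setT z -> (0 <= (\1_(D i) z * `|y i w| `^ q)%:E)%E.
  by move=> _; rewrite lee_fin mulr_ge0 ?powR_ge0.
rewrite (ge0_integral_sum mu measurableT mI I0).
rewrite -sumEFin; apply: eq_bigr => i _.
under eq_integral do rewrite mulrC EFinM.
have mI1 : measurable_fun (setT : set E) (fun z => (\1_(D i) z : R)%:E).
  by apply/measurable_EFinP; apply: measurable_indic; exact: mD.
have I1 z : (setT : set E) z -> (0 <= (\1_(D i) z : R)%:E)%E by rewrite lee_fin.
rewrite (ge0_integralZl mu measurableT mI1 I1); last by rewrite lee_fin powR_ge0.
rewrite integral_indic ?setIT //; last exact: mD.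
by rewrite muleC EFinM fineK // ge0_fin_numE // finD.
Qed.

Lemma mixed_norm_cell_process y (p q : R) : 0 < q ->
  mixed_norm P mu p q (cell_process y) =
  ((\int[P]_w (cell_power mu D y q n w `^ (p / q))%:E) `^ p^-1)%E.
Proof.
move=> q0; rewrite /mixed_norm unlock; congr (poweR _ _).
apply: eq_integral => w _; rewrite bochner_norm_cell_process // abse_EFin.
rewrite ger0_norm ?powR_ge0 // poweR_EFin -powRrM [q^-1 * p]mulrC //.
Qed.

Lemma strongly_measurable_cell_process y :
  (forall k, (k < n)%N -> strongly_measurable (@measurable _ T) (y k)) ->
  strongly_measurable measurable (fun z : T * E => cell_process y z.1 z.2).
Proof.
move=> my; apply: strongly_measurable_sum => i; apply: strongly_measurableZ.
  apply: (@measurableT_comp _ _ _ _ _ _ (\1_(D i) : E -> R)); last exact: measurable_snd.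
  by apply: measurable_indic; exact: mD.
exact: (strongly_measurable_comp measurable_fst (my _ (ltn_ord i))).
Qed.

End cell_process.

Section poisson_finite.
Context {R : realType} {d d' : measure_display}.
Context {T : measurableType d} {E : measurableType d'}.
Variables (P : probability T R) (mu : {measure set E -> \bar R}) (N : R.-ker T ~> E).
Hypothesis HN : poisson_random_measure P mu N.

(** The Poisson weights sum to 1, so the events N(B) = m exhaust the space up to a null set. *)
Lemma poisson_ae_finite (B : set E) : measurable B -> (mu B < +oo)%E ->
  {ae P, forall w, N w B \is a fin_num}.
Proof.
move=> mB fB; case: HN => _ NE PN _ _.
pose A m := [set w | N w B = m%:R%:E].
have mA m : measurable (A m).
  rewrite -[X in measurable X]setTI.
  exact: (measurable_kernel N _ mB _ _ (emeasurable_set1 m%:R%:E)).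
have tA : trivIset setT A.
  by move=> i j _ _ [w [/= Ai]]; rewrite /A /= Ai => -[] /eqP; rewrite eqr_nat => /eqP.
have PA : P (\bigcup_m A m) = 1%E.
  rewrite measure_bigcup //.
  rewrite -(@sum_poisson_weight R (fine (mu B))) ?fine_ge0 //.
  rewrite (@eq_eseriesl _ _ xpredT); last by move=> m; rewrite in_setT.
  by apply: eq_eseriesr => m _; exact: PN.
exists (~` \bigcup_m A m); split.
- by apply: measurableC; exact: bigcup_measurable.
- by rewrite probability_setC ?PA ?subee //; exact: bigcup_measurable.
- move=> w /= NN [m _ Am]; apply: NN; by rewrite Am.
Qed.

End poisson_finite.

Section interval_partition.
Context {R : realType} {d} {J : measurableType d}.
Implicit Types (t e : R) (C : set J).

Definition slice t e (a : nat) : set R := `]t + a%:R * e, t + a.+1%:R * e]%classic.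

Lemma indic_slices t e M u : 0 <= e ->
  \1_(`]t, t + M%:R * e]%classic) u = \sum_(a < M) \1_(slice t e a) u :> R.
Proof.
move=> e0; elim: M => [|M IH].
  rewrite big_ord0 mul0r addr0 indicE memNset //= in_itv /= => /andP[tu ut].
  by move: (lt_le_trans tu ut); rewrite ltxx.
rewrite big_ord_recr /= -IH !indicE.
have h : t <= t + M%:R * e by rewrite lerDl mulr_ge0.
have h1 : t + M%:R * e <= t + M.+1%:R * e.
  by rewrite lerD2l; apply: ler_wpM2r => //; rewrite ler_nat.
have E0 a b : (u \in (`]a, b]%classic : set R)) = (a < u <= b).
  by apply/idP/idP; rewrite inE /= in_itv.
rewrite /slice !E0.
have [tu|ut] := ltP t u => /=; last first.
  by rewrite ltNge (le_trans ut h) /= addr0.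
have [uM|Mu] := leP u (t + M%:R * e) => /=.
  by rewrite (le_trans uM h1) addr0.
by rewrite add0r.
Qed.

Lemma measure_slices (m : {measure set (measurableTypeR R * J) -> \bar R}) t e M C :
  0 <= e -> measurable C ->
  m (`]t, t + M%:R * e]%classic `*` C) = (\sum_(a < M) m (slice t e a `*` C))%E.
Proof.
move=> e0 mC; elim: M => [|M IH].
  rewrite big_ord0 mul0r addr0 (_ : _ `*` _ = set0) ?measure0 //.
  apply/seteqP; split => // -[u v] /= []; rewrite in_itv /= => /andP[tu ut] _.
  by move: (lt_le_trans tu ut); rewrite ltxx.
rewrite big_ord_recr /= -IH -measureU //.
- congr (m _); have h : t <= t + M%:R * e by rewrite lerDl mulr_ge0.
  have h1 : t + M%:R * e <= t + M.+1%:R * e.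
    by rewrite lerD2l; apply: ler_wpM2r => //; rewrite ler_nat.
  apply/seteqP; split => -[u v]; rewrite /slice /= !in_itv /=.
    move=> [/andP[tu uM] Cv]; have [uM'|Mu] := leP u (t + M%:R * e).
      by left; rewrite tu.
    by right; rewrite uM.
  move=> [[/andP[-> uM] Cv]|[/andP[Mu uM] Cv]]; split=> //.
    by rewrite (le_trans uM h1).
  by rewrite (le_lt_trans h Mu) uM.
- by apply: measurableX => //; exact: measurable_itv.
- by apply: measurableX => //; exact: measurable_itv.
- apply/seteqP; split => // -[u v] /= [[+ _] [+ _]].
  rewrite /slice /= !in_itv /= => /andP[_ uM] /andP[Mu _].
  by move: (lt_le_trans Mu uM); rewrite ltxx.
Qed.

End interval_partition.

Lemma sum_mul_ord {V : zmodType} (n m : nat) (F : nat -> V) :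
  \sum_(k < n * m) F k = \sum_(i < n) \sum_(j < m) F (i * m + j)%N.
Proof.
elim: n => [|n IH]; first by rewrite mul0n !big_ord0.
rewrite big_ord_recr /= -IH mulSn addnC big_split_ord /=.
by congr (_ + _); apply: eq_bigr => i _.
Qed.

(** * The refined grid of a simple process *)

Section refined_grid.
Context {R : realType} {d d' : measure_display}.
Context {T : measurableType d} {J : measurableType d'}.
Context {P : probability T R} {nu : {sigma_finite_measure set J -> \bar R}}.
Context {N : R.-ker T ~> (measurableTypeR R * J)%type} {X : normedModType R}.
Hypothesis HN : poisson_random_measure P (intensity nu) N.
Variable phi : simple_process P nu N X.
Variables (B : set J) (mB : measurable B).

Let l := sp_l phi.
Let m := sp_m phi.
Let t := sp_t phi.

(** Cells are indexed by [nat]; outside the range of the process the set is empty and, below, the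
    coefficient is 0. *)
Definition grid_set (j : nat) : set J :=
  if insub j is Some j' then sp_A (s := phi) j' `&` B else set0.

Definition grid_value (i j : nat) (w : T) : X :=
  if (insub i, insub j) is (Some i', Some j') then
    \sum_(k < sp_n phi) sp_F i' j' k w *: sp_x (s := phi) i' j' k
  else 0.

Lemma grid_setE (j : 'I_m) : grid_set j = sp_A (s := phi) j `&` B.
Proof. by rewrite /grid_set valK. Qed.

Lemma grid_valueE (i : 'I_l) (j : 'I_m) w :
  grid_value i j w = \sum_(k < sp_n phi) sp_F i j k w *: sp_x (s := phi) i j k.
Proof. by rewrite /grid_value !valK. Qed.

Lemma measurable_grid_set j : measurable (grid_set j).
Proof.
rewrite /grid_set; case: insub => [j'|] //.
by apply: measurableI => //; exact: sp_A_measurable.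
Qed.

Lemma grid_set_finite j : (nu (grid_set j) < +oo)%E.
Proof.
rewrite /grid_set; case: insub => [j'|]; last by rewrite measure0.
apply: le_lt_trans (sp_A_finite j'); apply: le_measure; rewrite ?inE //.
  by apply: measurableI => //; exact: sp_A_measurable.
exact: sp_A_measurable.
Qed.

Lemma grid_set_disjoint i j v : grid_set i v -> grid_set j v -> i = j.
Proof.
rewrite /grid_set; case: insubP => [i' _ <-|//]; case: insubP => [j' _ <-|//].
move=> [Ai _] [Aj _]; congr val.
by apply: (@sp_A_disjoint _ _ _ _ _ _ _ _ _ phi) => //; exists v.
Qed.

Lemma sp_t_ge0 i : (i <= l)%N -> 0 <= t i.
Proof.
elim: i => [_|i IH il]; first by rewrite /t sp_t0.
by apply: le_trans (IH (ltnW il)) _; apply: ltW; exact: sp_t_lt.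
Qed.

Variable M : nat.
Hypothesis M0 : (0 < M)%N.

Definition mesh (i : nat) : R := (t i.+1 - t i) / M%:R.

Lemma mesh_ge0 i : (i < l)%N -> 0 <= mesh i.
Proof. by move=> il; rewrite divr_ge0 // subr_ge0 ltW // sp_t_lt. Qed.

Definition grid_time (q : nat) : R := t (q %/ M)%N + (q %% M)%:R * mesh (q %/ M)%N.

Lemma grid_timeS q : (q < l * M)%N ->
  grid_time q.+1 = t (q %/ M)%N + (q %% M).+1%:R * mesh (q %/ M)%N.
Proof.
move=> ql; rewrite /grid_time.
have qE : q.+1 = (q %/ M * M + (q %% M).+1)%N by rewrite addnS -divn_eq.
have [qM|qM] := ltnP (q %% M).+1 M.
  have -> : (q.+1 %/ M = q %/ M)%N.
    by rewrite {1}qE divnMDl // (divn_small qM) addn0.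
  by have -> : (q.+1 %% M = (q %% M).+1)%N by rewrite {1}qE modnMDl modn_small.
(* The last slice of an interval: q + 1 already belongs to the next interval, whose left end is t_i
   + M times the mesh. *)
have qM' : (q %% M).+1 = M by apply/eqP; rewrite eqn_leq qM ltn_pmod.
have qE' : q.+1 = ((q %/ M).+1 * M)%N by rewrite {1}qE qM' mulSnr.
have -> : (q.+1 %/ M = (q %/ M).+1)%N by rewrite {1}qE' mulnK.
have -> : (q.+1 %% M = 0)%N by rewrite {1}qE' modnMl.
rewrite qM' mul0r addr0.
have M0' : M%:R != 0 :> R by rewrite pnatr_eq0 -lt0n.
by rewrite /mesh mulrC divfK // subrKC.
Qed.

Lemma grid_time_le q q' : (q <= q' <= l * M)%N -> grid_time q <= grid_time q'.
Proof.
move=> /andP[]; elim: q' => [|q' IH]; first by rewrite leqn0 => /eqP ->.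
rewrite leq_eqVlt => /predU1P[->//|]; rewrite ltnS => qq' ql.
apply: le_trans (IH qq' (ltnW ql)) _; rewrite grid_timeS //.
rewrite /grid_time lerD2l; apply: ler_wpM2r; last by rewrite ler_nat.
by apply: mesh_ge0; rewrite ltn_divLR.
Qed.

Definition grid_size : nat := (l * M * m)%N.

(** Mixed-radix coding k = (i M + a) m + j of interval i, slice a and set j: time comes first, and
    the sets follow one another within a slice. *)
Definition grid_cell (k : nat) : set (measurableTypeR R * J) :=
  slice (t (k %/ m %/ M)) (mesh (k %/ m %/ M)) (k %/ m %% M) `*` grid_set (k %% m).

(** The strip up to the start of the current slice spans all of J, because the filtration observes
    every measurable set of marks. The union adds the cells of the current slice that have already
    been visited. *)
Definition grid_past (k : nat) : set (measurableTypeR R * J) :=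
  (`]0, grid_time (k %/ m)]%classic `*` setT) `|`
  \bigcup_(k' in `I_k) grid_cell k'.

Definition grid_coef (k : nat) : T -> X := grid_value (k %/ m %/ M) (k %% m).

Lemma measurable_grid_cell k : measurable (grid_cell k).
Proof.
by apply: measurableX; [exact: measurable_itv|exact: measurable_grid_set].
Qed.

Let m_gt0 k : (k < grid_size)%N -> (0 < m)%N.
Proof. by rewrite /grid_size; case: m => //; rewrite muln0. Qed.

Let q_lt k : (k < grid_size)%N -> (k %/ m < l * M)%N.
Proof. by move=> kn; rewrite ltn_divLR // (m_gt0 kn). Qed.

Let q_le k : (k <= grid_size)%N -> (k %/ m <= l * M)%N.
Proof.
move=> kn; have [->|m0] := posnP m; first by rewrite divn0.
by rewrite -(mulnK (l * M) m0) leq_div2r.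
Qed.

Let q_le2 j k : (j <= k)%N -> (j %/ m <= k %/ m)%N.
Proof. exact: leq_div2r. Qed.

Lemma grid_cellE k : (k < grid_size)%N -> grid_cell k =
  `]grid_time (k %/ m), grid_time (k %/ m).+1]%classic `*` grid_set (k %% m).
Proof. by move=> kn; rewrite grid_timeS ?q_lt. Qed.

Lemma grid_cell_disjoint j k : (j < k < grid_size)%N -> grid_cell j `&` grid_cell k = set0.
Proof.
move=> /andP[jk kn]; apply/seteqP; split => // -[u v] [].
rewrite (grid_cellE kn) (grid_cellE (ltn_trans jk kn)).
move=> [/= + Aj] [/= + Ak]; rewrite !in_itv /= => /andP[_ u1] /andP[u2 _].
have [e|ne] := eqVneq (j %/ m)%N (k %/ m)%N.
  have em := grid_set_disjoint Aj Ak.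
  by move: jk; rewrite (divn_eq j m) (divn_eq k m) e em ltnn.
have jk' : (j %/ m < k %/ m)%N by rewrite ltn_neqAle ne q_le2 // ltnW.
have : grid_time (j %/ m).+1 <= grid_time (k %/ m).
  by apply: grid_time_le; rewrite jk' ltnW // q_lt.
by move=> h; move: (lt_le_trans u2 (le_trans u1 h)); rewrite ltxx.
Qed.

Lemma intensity_slice (a b : R) (C : set J) : 0 <= a -> a <= b -> measurable C ->
  intensity nu (`]a, b]%classic `*` C) = ((b - a)%:E * nu C)%E.
Proof.
move=> a0 ab mC.
transitivity (lebesgue_Rplus R `]a, b]%classic * nu C)%E.
  by apply: product_measure1E => //; exact: measurable_itv.
congr (_ * _)%E; rewrite /lebesgue_Rplus /= /mrestr.
rewrite setIidl; last first.
  by move=> u /=; rewrite !in_itv /= andbT => /andP[au _]; exact: le_trans (ltW au).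
rewrite lebesgue_measure_itv /= lte_fin; case: ltgtP ab => // -> _.
by rewrite subrr.
Qed.

Lemma slice_ge0 (i a : nat) : (i < l)%N -> 0 <= t i + a%:R * mesh i.
Proof.
move=> il; apply: addr_ge0; first exact: sp_t_ge0 (ltnW il).
by apply: mulr_ge0 => //; exact: mesh_ge0.
Qed.

Lemma intensity_grid_cell k : (k < grid_size)%N ->
  intensity nu (grid_cell k) = ((mesh (k %/ m %/ M))%:E * nu (grid_set (k %% m)))%E.
Proof.
move=> kn; have il : (k %/ m %/ M < l)%N by rewrite ltn_divLR // q_lt.
rewrite /grid_cell /slice intensity_slice.
- by congr (_%:E * _)%E; rewrite opprD addrACA subrr add0r -mulrBl -natrB // subSnn mul1r.
- exact: slice_ge0.
- by rewrite lerD2l; apply: ler_wpM2r; [exact: mesh_ge0|rewrite ler_nat].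
- exact: measurable_grid_set.
Qed.

Lemma filtration_past (i k : nat) : (i <= l)%N -> t i <= grid_time (k %/ m) ->
  <<s filtration_generators N (t i) >> `<=` <<s past N (grid_past k) >>.
Proof.
move=> il tk; apply: smallest_sub; first exact: smallest_sigma_algebra.
move=> Z [a [b [A [C [a0 ab bt mA [mC ->]]]]]]; apply: sub_sigma_algebra.
exists (`]a, b]%classic `*` A), C; split => //.
  by apply: measurableX => //; exact: measurable_itv.
move=> [u v] [/= + _]; rewrite in_itv /= => /andP[au ub].
left; split => //=; rewrite in_itv /= (le_lt_trans a0 au) /=.
exact: le_trans ub (le_trans bt tk).
Qed.

Lemma strongly_measurable_grid_coef k : (k < grid_size)%N ->
  strongly_measurable (<<s past N (grid_past k) >>) (grid_coef k).
Proof.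
move=> kn; have il : (k %/ m %/ M < l)%N by rewrite ltn_divLR // q_lt.
have jm : (k %% m < m)%N by rewrite ltn_pmod // (m_gt0 kn).
rewrite /grid_coef.
have -> : grid_value (k %/ m %/ M) (k %% m) =
    (fun w => \sum_(i < sp_n phi) sp_F (Ordinal il) (Ordinal jm) i w *:
       sp_x (s := phi) (Ordinal il) (Ordinal jm) i).
  by apply/funext => w; exact: (grid_valueE (Ordinal il) (Ordinal jm)).
apply: (@strongly_measurable_sum _ _ (g_sigma_algebraType (past N (grid_past k)))) => i.
apply: (@strongly_measurableZ _ _ (g_sigma_algebraType (past N (grid_past k)))); last first.
  exact: (@strongly_measurable_cst _ _ (g_sigma_algebraType (past N (grid_past k)))).
move=> _ C mC; have := @sp_F_measurable _ _ _ _ _ _ _ _ _ phi (Ordinal il) (Ordinal jm) i measurableT _ mC.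
rewrite !setTI; apply: (@filtration_past (k %/ m %/ M)); first exact: ltnW.
by rewrite /grid_time lerDl mulr_ge0 // mesh_ge0.
Qed.

Lemma grid_cell_system :
  (forall k, (k < grid_size)%N -> fine (intensity nu (grid_cell k)) <= 2^-1) ->
  cell_system (intensity nu) N grid_size grid_cell grid_past grid_coef.
Proof.
move=> half; split => //.
- by move=> k _; exact: measurable_grid_cell.
- move=> k kn; apply/seteqP; split => // -[u v] [Dk [|[k' /= k'k Dk']]].
    move: Dk; rewrite (grid_cellE kn) => -[/= + _] [/= + _].
    rewrite !in_itv /= => /andP[ku _] /andP[_ uk].
    by move: (lt_le_trans ku uk); rewrite ltxx.
  have : (grid_cell k' `&` grid_cell k) (u, v) by [].
  by rewrite grid_cell_disjoint // k'k.
- move=> k kn [u v] [[/= uk _]|[k' /= k'k Dk']]; last first.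
    by right; exists k' => //=; exact: ltnW.
  left; split => //=; move: uk; rewrite !in_itv /= => /andP[-> uk] /=.
  apply: le_trans uk _; apply: grid_time_le.
  by rewrite q_le2 //= q_le.
- by move=> k kn z Dk; right; exists k => /=.
- move=> k kn; rewrite intensity_grid_cell //; apply: lte_mul_pinfty => //.
    by rewrite lee_fin mesh_ge0 // ltn_divLR // q_lt.
  exact: grid_set_finite.
- exact: strongly_measurable_grid_coef.
Qed.

Lemma sum_grid (V : zmodType) (F : nat -> nat -> nat -> V) :
  \sum_(k < grid_size) F (k %/ m %/ M)%N (k %/ m %% M)%N (k %% m)%N =
  \sum_(i < l) \sum_(j < m) \sum_(a < M) F i a j.
Proof.
rewrite (sum_mul_ord (l * M) m (fun k => F (k %/ m %/ M)%N (k %/ m %% M)%N (k %% m)%N)).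
rewrite (sum_mul_ord l M (fun q => \sum_(j < m)
  F ((q * m + j) %/ m %/ M)%N ((q * m + j) %/ m %% M)%N ((q * m + j) %% m)%N)).
apply: eq_bigr => i _; rewrite exchange_big; apply: eq_bigr => j _ /=.
apply: eq_bigr => a _.
have m0 : (0 < m)%N by exact: leq_ltn_trans (ltn_ord j).
have E1 : (((i * M + a) * m + j) %/ m = i * M + a)%N.
  by rewrite divnMDl // (divn_small (ltn_ord j)) addn0.
have E2 : (((i * M + a) * m + j) %% m = j)%N by rewrite modnMDl modn_small.
have E3 : ((i * M + a) %/ M = i)%N.
  by rewrite divnMDl // (divn_small (ltn_ord a)) addn0.
have E4 : ((i * M + a) %% M = a)%N by rewrite modnMDl modn_small.
by rewrite E1 E2 E3 E4.
Qed.

Let tE i : t i + M%:R * mesh i = t i.+1.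
Proof.
have M0' : M%:R != 0 :> R by rewrite pnatr_eq0 -lt0n.
by rewrite /mesh mulrC divfK // subrKC.
Qed.

Lemma process_restr_grid w z :
  process_restr phi B w z = cell_process grid_size grid_cell grid_coef w z.
Proof.
rewrite /process_restr /process_fun scaler_sumr /cell_process.
rewrite (sum_grid (fun i a j => \1_(slice (t i) (mesh i) a `*` grid_set j) z *: grid_value i j w)).
apply: eq_bigr => i _; rewrite scaler_sumr; apply: eq_bigr => j _.
under [RHS]eq_bigr => a _.
  have -> : \1_(slice (t i) (mesh i) a `*` grid_set j) z =
      \1_(slice (t i) (mesh i) a) z.1 * \1_(grid_set j) z.2 :> R.
    rewrite !indicE -natrM mulnb; congr (_%:R); congr nat_of_bool.
    by apply/idP/andP; rewrite !inE.
  over.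
rewrite -scaler_suml -mulr_suml -indic_slices; last exact: mesh_ge0.
rewrite tE grid_valueE !scaler_sumr; apply: eq_bigr => k _.
rewrite !scalerA; congr (_ *: _).
have -> : \1_(grid_set j) z.2 = \1_(sp_A (s := phi) j) z.2 * \1_B z.2 :> R.
  by rewrite grid_setE indicI.
rewrite -/t; set a := \1_B _; set b := \1_(`]_, _]) _; set c := \1_(sp_A _) _.
by ring.
Qed.

(** Only almost everywhere, since [compensated] goes through [fine], which is additive over the
    slices where the counts are finite. Finitely many cells are involved, so one null set is
    enough. *)
Lemma stochastic_integral_grid :
  {ae P, forall w, stochastic_integral phi B w =
     cell_sum (intensity nu) N grid_cell grid_coef grid_size w}.
Proof.
pose C (i : 'I_l) (j : 'I_m) : set (measurableTypeR R * J) :=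
  `]t i, t i.+1]%classic `*` (sp_A (s := phi) j `&` B).
have mA j : measurable (sp_A (s := phi) j `&` B).
  by apply: measurableI => //; exact: sp_A_measurable.
have mC i j : measurable (C i j).
  by apply: measurableX => //; exact: measurable_itv.
have finC i j : (intensity nu (C i j) < +oo)%E.
  rewrite /C intensity_slice ?sp_t_ge0 ?(ltW (sp_t_lt (ltn_ord i))) ?(ltnW (ltn_ord i)) //.
  apply: lte_mul_pinfty => //; first by rewrite lee_fin subr_ge0 ltW // sp_t_lt.
  by rewrite -grid_setE grid_set_finite.
have : {ae P, forall w (ij : 'I_l * 'I_m), N w (C ij.1 ij.2) \is a fin_num}.
  by apply: filter_forall => -[i j]; exact: (poisson_ae_finite HN).
apply: filterS => w Hw; rewrite /stochastic_integral /cell_sum.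
rewrite (sum_grid (fun i a j => compensated (intensity nu) N
   (slice (t i) (mesh i) a `*` grid_set j) w *: grid_value i j w)).
apply: eq_bigr => i _; apply: eq_bigr => j _.
rewrite -scaler_suml grid_valueE.
have -> : \sum_(a < M) compensated (intensity nu) N
    (slice (t i) (mesh i) a `*` grid_set j) w = compensated (intensity nu) N (C i j) w.
  have e0 := mesh_ge0 (ltn_ord i).
  have part (mm : {measure set (measurableTypeR R * J) -> \bar R}) :
      mm (C i j) \is a fin_num ->
      \sum_(a < M) fine (mm (slice (t i) (mesh i) a `*` grid_set j)) = fine (mm (C i j)).
    move=> fm; rewrite grid_setE; have E := measure_slices mm (t i) M e0 (mA j).
    move: fm; rewrite /C -tE E => fm; rewrite sum_fine // => a _.
    move: fm; rewrite sum_fin_num => /allP; apply.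
    by apply/mapP; exists a => //; rewrite mem_filter //= mem_index_enum.
  rewrite /compensated big_split /= sumrN part; last exact: (Hw (i, j)).
  by rewrite part // ge0_fin_numE.
rewrite scaler_sumr; apply: eq_bigr => k _; rewrite scalerA mulrC.
by congr ((_ * _) *: _).
Qed.

End refined_grid.

Section refined_process.
Context {R : realType} {d d' : measure_display}.
Context {T : measurableType d} {J : measurableType d'}.
Context {P : probability T R} {nu : {sigma_finite_measure set J -> \bar R}}.
Context {N : R.-ker T ~> (measurableTypeR R * J)%type} {X : normedModType R}.
Hypothesis HN : poisson_random_measure P (intensity nu) N.
Variable phi : simple_process P nu N X.
Variables (B : set J) (mB : measurable B).

Lemma strongly_measurable_stochastic_integral :
  strongly_measurable measurable (stochastic_integral phi B).
Proof.
apply: strongly_measurable_sum => i; apply: strongly_measurable_sum => j.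
apply: strongly_measurable_sum => k; apply: strongly_measurableZ; last first.
  exact: strongly_measurable_cst.
apply: measurable_funM.
  move=> _ C mC; rewrite setTI.
  have := @sp_F_measurable _ _ _ _ _ _ _ _ _ phi i j k measurableT _ mC.
  rewrite setTI; apply: smallest_sub; first exact: sigma_algebra_measurable.
  move=> Z [a [b [A [C' [a0 ab bt mA [mC' ->]]]]]].
  rewrite -[X in measurable X]setTI; apply: measurable_kernel => //.
  by apply: measurableX => //; exact: measurable_itv.
apply: measurable_funB; last exact: measurable_cst.
apply: measurableT_comp; first exact: fine_measurable.
apply: measurable_kernel; apply: measurableX; first exact: measurable_itv.
by apply: measurableI => //; exact: sp_A_measurable.
Qed.

Lemma mesh_bound : exists2 M : nat, (0 < M)%N &
  forall k, (k < grid_size phi M)%N ->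
    fine (intensity nu (grid_cell phi B M k)) <= 2^-1.
Proof.
pose t := sp_t phi.
pose a (i j : nat) := (t i.+1 - t i) * fine (nu (grid_set phi B j)).
have a0 i j : (i < sp_l phi)%N -> 0 <= a i j.
  by move=> il; rewrite mulr_ge0 ?fine_ge0 // subr_ge0 ltW // sp_t_lt.
(* The total intensity of the rectangles. Each cell has intensity at most W / M, hence at most 1/2
   once M exceeds 2 W. *)
pose W := \sum_(i < sp_l phi) \sum_(j < sp_m phi) a i j.
have W0 : 0 <= 2 * W.
  by rewrite mulr_ge0 // sumr_ge0 // => i _; rewrite sumr_ge0 // => j _; exact: a0.
have WM := archi_boundP W0; set M := Num.bound _ in WM.
have M0 : (0 < M)%N by rewrite -(ltr_nat R); exact: le_lt_trans WM.
exists M => // k kn.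
have m0 : (0 < sp_m phi)%N.
  by move: kn; rewrite /grid_size; case: (sp_m phi) => //; rewrite muln0.
have il : (k %/ sp_m phi %/ M < sp_l phi)%N by rewrite !ltn_divLR.
have jm : (k %% sp_m phi < sp_m phi)%N by rewrite ltn_pmod.
rewrite intensity_grid_cell // fineM //; last first.
  by rewrite ge0_fin_numE // grid_set_finite.
set i := (k %/ sp_m phi %/ M)%N in il *; set j := (k %% sp_m phi)%N in jm *.
have aW : a i j <= W.
  rewrite /W (bigD1 (Ordinal il)) //= (bigD1 (Ordinal jm)) //= -addrA lerDl.
  apply: addr_ge0; first by apply: sumr_ge0 => j' _; exact: a0.
  by apply: sumr_ge0 => i' _; apply: sumr_ge0 => j' _; exact: a0.
have Mp : 0 < M%:R :> R by rewrite ltr0n.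
rewrite /= /mesh -/t mulrAC ler_pdivrMr // -/(a i j).
lra.
Qed.

Lemma integral_renorm_grid (M : nat) (s K p : R) (Nm : X -> R) : (0 < M)%N ->
  0 <= K -> 1 < p -> uniformly_convex_norm s K Nm ->
  cell_system (intensity nu) N (grid_size phi M) (grid_cell phi B M)
    (grid_past phi B M) (grid_coef phi M) ->
  (\int[P]_w (Nm (cell_sum (intensity nu) N (grid_cell phi B M) (grid_coef phi M)
     (grid_size phi M) w) `^ p)%:E <=
   (K `^ p)%:E * \int[P]_w (`|stochastic_integral phi B w| `^ p)%:E)%E.
Proof.
move=> M0 K0 p1 HNm HC; have p0 : 0 <= p by rewrite ltW // (lt_trans _ p1).
have sf := strongly_measurable_cell_sum HC (leqnn (grid_size phi M)).
have mnf : measurable_fun (setT : set T) (fun w => `|cell_sum (intensity nu) N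
    (grid_cell phi B M) (grid_coef phi M) (grid_size phi M) w| `^ p).
  apply: measurable_fun_powR.
  apply: (@meas_sub _ _ _ _ _ N (grid_past phi B M (grid_size phi M))).
  exact: (@strongly_measurable_norm _ _ (g_sigma_algebraType _)).
have mNf : measurable_fun (setT : set T) (fun w => Nm (cell_sum (intensity nu) N
    (grid_cell phi B M) (grid_coef phi M) (grid_size phi M) w) `^ p).
  apply: measurable_fun_powR.
  apply: (@meas_sub _ _ _ _ _ N (grid_past phi B M (grid_size phi M))).
  exact: (meas_Nm HNm HC).
have -> : (\int[P]_w (`|stochastic_integral phi B w| `^ p)%:E =
    \int[P]_w (`|cell_sum (intensity nu) N
    (grid_cell phi B M) (grid_coef phi M) (grid_size phi M) w| `^ p)%:E)%E.
  apply: ge0_ae_eq_integral => //.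
  - apply/measurable_EFinP/measurable_fun_powR/strongly_measurable_norm.
    exact: strongly_measurable_stochastic_integral.
  - exact/measurable_EFinP.
  - have := stochastic_integral_grid HN phi mB M0.
    by apply: filterS => w /= ->.
rewrite -integral_EFinZ ?powR_ge0 //.
apply: integral_EFin_le => //; first exact: measurable_funMl.
  by move=> w; exact: powR_ge0.
move=> w; rewrite -powRM //; apply: ler_powRl => //; first exact: ucn_ge0 HNm _.
exact: (ucn_le HNm).
Qed.

End refined_process.

Lemma lee_poweRl {R : realType} (x y : \bar R) (r : R) :
  0 <= r -> (0 <= x)%E -> (x <= y)%E -> (x `^ r <= y `^ r)%E.
Proof.
move=> r0 x0 xy; apply: gt0_ler_poweR => //; rewrite in_itv /= leey andbT //.
exact: le_trans xy.
Qed.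

Lemma poweR_le_EFinM {R : realType} (x y : \bar R) (c r : R) :
  0 <= r -> 0 <= c -> (0 <= x)%E -> (0 <= y)%E -> (x <= c%:E * y)%E ->
  (x `^ r <= (c `^ r)%:E * y `^ r)%E.
Proof.
move=> r0 c0 x0 y0 /(lee_poweRl r0 x0).
by rewrite poweRM ?lee_fin // poweR_EFin.
Qed.

Theorem theorem2p13 (R : realType) (X : completeNormedModType R) (s : R)
    (hs : 2 <= s) (hX : martingale_cotype X s) :
  (forall p : R, s <= p ->
    exists C : R, forall (d d' : measure_display) (T : measurableType d)
      (J : measurableType d') (P : probability T R)
      (nu : {sigma_finite_measure set J -> \bar R})
      (N : R.-ker T ~> (measurableTypeR R * J)%type),
    poisson_random_measure P (intensity nu) N ->
    forall (phi : simple_process P nu N X) (B : set J), measurable B ->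
    (mixed_cap_norm P (intensity nu) p s p (process_restr phi B) <=
      C%:E * bochner_norm P p (stochastic_integral phi B))%E)
  /\
  (forall p : R, 1 < p -> p < s ->
    exists C : R, forall (d d' : measure_display) (T : measurableType d)
      (J : measurableType d') (P : probability T R)
      (nu : {sigma_finite_measure set J -> \bar R})
      (N : R.-ker T ~> (measurableTypeR R * J)%type),
    poisson_random_measure P (intensity nu) N ->
    forall (phi : simple_process P nu N X) (B : set J), measurable B ->
    (mixed_sum_norm P (intensity nu) p s p (process_restr phi B) <=
      C%:E * bochner_norm P p (stochastic_integral phi B))%E).
Proof.
have s0 : 0 < s by lra.
have s1 : 1 <= s by lra.
have s1' : 1 < s by lra.
have [K K0 [Nm HNm]] := renorming_cotype s1 hX.
have K0' := ltW K0.
split=> p.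
- move=> sp; have p1 : 1 < p by lra.
  have p0 : 0 < p by lra.
  have pV0 : 0 <= p^-1 by rewrite invr_ge0 ltW.
  have [cp cp0 Hp] := ucn_poisson_convex hs HNm p1.
  have [cs cs0 Hs] := ucn_poisson_convex hs HNm s1'.
  pose r := p / s.
  have r1 : 1 <= r by rewrite /r ler_pdivlMr // mul1r.
  have pE : p = s * r by rewrite /r mulrC divfK ?gt_eqF.
  (* Each constant is that of the corresponding cell estimate, times K^p for the return to the
     original norm. *)
  pose c1 := 2 * (r / cs * (cs / (2 * r))^-1 `^ (r - 1)) * K `^ p.
  pose c2 := cp^-1 * K `^ p.
  have c10 : 0 <= c1.
    rewrite /c1 mulr_ge0 ?powR_ge0 // mulr_ge0 // mulr_ge0 ?powR_ge0 //.
    by rewrite divr_ge0 // ?(ltW cs0) //; lra.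
  have c20 : 0 <= c2 by rewrite /c2 mulr_ge0 ?powR_ge0 ?invr_ge0 ?(ltW cp0).
  exists (Num.max (c1 `^ p^-1) (c2 `^ p^-1)) => d d' T J P nu N HN phi B mB.
  have [M M0 half] := mesh_bound phi mB.
  have HC := grid_cell_system (phi := phi) mB M0 half.
  have HI := integral_renorm_grid HN mB M0 K0' p1 HNm HC.
  have -> : process_restr phi B = cell_process (grid_size phi M)
      (grid_cell phi B M) (grid_coef phi M).
    by apply/funext => w; apply/funext => z; exact: process_restr_grid.
  rewrite /mixed_cap_norm !mixed_norm_cell_process //; try exact: cs_finite HC;
    try exact: cs_measurable HC; try by move=> j k; exact: grid_cell_disjoint.
  rewrite bochner_normE.
  set I := (\int[P]_w (`|stochastic_integral phi B w| `^ p)%:E)%E in HI *.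
  have I0 : (0 <= I)%E by apply: integral_EFin_ge0 => w; exact: powR_ge0.
  have B1 : (\int[P]_w (cell_power (intensity nu) (grid_cell phi B M)
      (grid_coef phi M) s (grid_size phi M) w `^ (p / s))%:E <= c1%:E * I)%E.
    apply: le_trans (integral_cell_power_powR HN hs HNm HC r1 pE cp0 cs0 Hp Hs) _.
    rewrite /c1 [X in (_ <= X * _)%E]EFinM -muleA; apply: lee_wpmul2l; last exact: HI.
    by rewrite lee_fin mulr_ge0 // mulr_ge0 ?powR_ge0 // divr_ge0 // ?(ltW cs0) //; lra.
  have B2 : (\int[P]_w (cell_power (intensity nu) (grid_cell phi B M)
      (grid_coef phi M) p (grid_size phi M) w `^ (p / p))%:E <= c2%:E * I)%E.
    under eq_integral do rewrite divff ?gt_eqF // powRr1 ?cell_power_ge0 //.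
    apply: le_trans (integral_cell_power HN hs HNm HC r1 pE cp0 Hp) _.
    rewrite /c2 [X in (_ <= X * _)%E]EFinM -muleA; apply: lee_wpmul2l; last exact: HI.
    by rewrite lee_fin invr_ge0 ltW.
  rewrite ge_max; apply/andP; split.
    apply: le_trans (poweR_le_EFinM pV0 c10 _ I0 B1) _.
      by apply: integral_EFin_ge0 => w; exact: powR_ge0.
    by apply: lee_wpmul2r; rewrite ?poweR_ge0 // lee_fin le_max lexx.
  apply: le_trans (poweR_le_EFinM pV0 c20 _ I0 B2) _.
    by apply: integral_EFin_ge0 => w; exact: powR_ge0.
  by apply: lee_wpmul2r; rewrite ?poweR_ge0 // lee_fin le_max lexx orbT.
- move=> p1 ps.
  have p0 : 0 < p by lra.
  have pV0 : 0 <= p^-1 by rewrite invr_ge0 ltW.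
  have [c c0 Hp] := ucn_poisson_convex hs HNm p1.
  have Dc0 := doob_constant_gt0 p1.
  pose c1 := (2 `^ p * doob_constant p + c^-1) * K `^ p.
  pose c2 := (2 `^ (s - p) * c^-1) * K `^ p.
  have cV0 : 0 < c^-1 by rewrite invr_gt0.
  have c10' : 0 < 2 `^ p * doob_constant p + c^-1.
    by apply: addr_gt0 => //; apply: mulr_gt0 => //; exact: powR_gt0.
  have c20' : 0 < 2 `^ (s - p) * c^-1 by apply: mulr_gt0 => //; exact: powR_gt0.
  have c10 : 0 < c1 by apply: mulr_gt0 => //; exact: powR_gt0.
  have c20 : 0 < c2 by apply: mulr_gt0 => //; exact: powR_gt0.
  exists (c1 `^ p^-1 + c2 `^ p^-1) => d d' T J P nu N HN phi B mB.
  have [M M0 half] := mesh_bound phi mB.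
  have HC := grid_cell_system (phi := phi) mB M0 half.
  have HI := integral_renorm_grid HN mB M0 K0' p1 HNm HC.
  rewrite bochner_normE.
  set I := (\int[P]_w (`|stochastic_integral phi B w| `^ p)%:E)%E in HI *.
  have I0 : (0 <= I)%E by apply: integral_EFin_ge0 => w; exact: powR_ge0.
  (* The decomposition has to lie in the two mixed spaces, whose norms are finite only if I is; for
     infinite I the right-hand side is infinite, the constant being positive. *)
  have [fin|] := ltP I +oo%E; last first.
    rewrite leye_eq => /eqP ->; rewrite poweRyr ?gt_eqF ?invr_gt0 //.
    rewrite gt0_muley ?leey // lte_fin.
    by apply: addr_gt0; exact: powR_gt0.
  pose n := grid_size phi M; pose D := grid_cell phi B M.
  pose S := grid_past phi B M; pose y := grid_coef phi M.
  pose mu := intensity nu.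
  pose sm := small_part mu N Nm D y.
  pose bg := big_part mu N Nm D y.
  have mD := cs_measurable HC.
  have finD := cs_finite HC.
  have tD j k : (j < k < n)%N -> D j `&` D k = set0 by exact: grid_cell_disjoint.
  have S1 : (\int[P]_w (cell_power mu D sm s n w `^ (p / s))%:E <= c1%:E * I)%E.
    apply: le_trans (integral_small_part HN HNm HC p1 ps c0 Hp) _.
    by rewrite /c1 [X in (_ <= X * _)%E]EFinM -muleA; apply: lee_wpmul2l; [rewrite lee_fin ltW|exact: HI].
  have S2 : (\int[P]_w (cell_power mu D bg p n w `^ (p / p))%:E <= c2%:E * I)%E.
    under eq_integral do rewrite divff ?gt_eqF // powRr1 ?cell_power_ge0 //.
    apply: le_trans (integral_big_part HN HNm HC p1 ps c0 Hp) _.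
    by rewrite /c2 [X in (_ <= X * _)%E]EFinM -muleA; apply: lee_wpmul2l; [rewrite lee_fin ltW|exact: HI].
  have T1 : (mixed_norm P mu p s (cell_process n D sm) <= (c1 `^ p^-1)%:E * I `^ p^-1)%E.
    rewrite (mixed_norm_cell_process P mD finD tD _ _ s0).
    apply: poweR_le_EFinM pV0 (ltW c10) _ I0 S1.
    by apply: integral_EFin_ge0 => w; exact: powR_ge0.
  have T2 : (mixed_norm P mu p p (cell_process n D bg) <= (c2 `^ p^-1)%:E * I `^ p^-1)%E.
    rewrite (mixed_norm_cell_process P mD finD tD _ _ p0).
    apply: poweR_le_EFinM pV0 (ltW c20) _ I0 S2.
    by apply: integral_EFin_ge0 => w; exact: powR_ge0.
  have IV : (I `^ p^-1 < +oo)%E by exact: poweR_lty.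
  rewrite EFinD ge0_muleDl ?lee_fin ?powR_ge0 //.
  apply: le_trans (leeD T1 T2); apply: ereal_inf_lbound.
  exists (cell_process n D sm), (cell_process n D bg); split => //.
  + split.
      apply: strongly_measurable_cell_process => // k kn.
      exact: (strongly_measurable_small_part HNm HC kn).
    by apply: le_lt_trans T1 _; apply: lte_mul_pinfty; rewrite ?lee_fin ?powR_ge0.
  + split.
      apply: strongly_measurable_cell_process => // k kn.
      exact: (strongly_measurable_big_part HNm HC kn).
    by apply: le_lt_trans T2 _; apply: lte_mul_pinfty; rewrite ?lee_fin ?powR_ge0.
  + apply: aeW => w; apply: aeW => z.
    rewrite (process_restr_grid phi B M0) /cell_process -big_split /=.
    apply: eq_bigr => i _; rewrite -scalerDr; congr (_ *: _).
    exact: big_small_partE.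
Qed.
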